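(* Let $C\subset\Sigma_d$ be a trigonal curve. Then $C$ is reducible if and only if the group $\pi^{\mathrm{afn}}_C$ admits a quotient isomorphic to $\mathbb D_4=\mathbb Z_2\oplus\mathbb Z_2$; and $C$ splits into three components if and only if $\pi^{\mathrm{afn}}_C$ admits a quotient isomorphic to $\mathbb D(\mathbb Z_2\oplus\mathbb Z_2)=\mathbb Z_2\oplus\mathbb Z_2\oplus\mathbb Z_2$.
   Context: All varieties are over $\mathbb C$; $\mathbb Z_n=\mathbb Z/n\mathbb Z$. $\Sigma_d$ ($d\ge 0$) is the Hirzebruch surface: the geometrically ruled rational surface $\Sigma_d\to\mathbb P^1$ with an exceptional section $E$, $E^2=-d$; ''fibers'' are the fibers of the ruling. A trigonal curve is a reduced curve $C\subset\Sigma_d$ disjoint from $E$ and intersecting each fiber at three points counted with multiplicity (i.e. $C\in|3E+3dF|$, $F$ a fiber). A fiber is singular for $C$ if it meets $C$ in fewer than three distinct points, and nonsingular otherwise. The affine fundamental group is $\pi^{\mathrm{afn}}_C:=\pi_1(\Sigma_d\smallsetminus(C\cup E\cup F))$, where $F$ is a nonsingular fiber. For an abelian group $Q$, $\mathbb D(Q)=Q\rtimes\mathbb Z_2$ is the (generalized) dihedral group, with the generator of $\mathbb Z_2$ acting on $Q$ by $-\mathrm{id}$; $\mathbb D_{2n}=\mathbb D(\mathbb Z_n)$. *)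

(* Defs.v *)
From HB Require Import structures.
(* The notations of mpoly clash with those of the analysis library; importing it
   first keeps its [symmetric] from shadowing that of ssrbool. *)
From mathcomp Require Import -(notations) mpoly.
From mathcomp Require Import all_boot all_order all_algebra.
From mathcomp Require Import generic_quotient complex.
From mathcomp Require Import lra.
From mathcomp Require Import all_classical reals topology normedtype homotopy.

Set Implicit Arguments.
Unset Strict Implicit.
Unset Printing Implicit Defensive.

Import Order.TTheory GRing.Theory Num.Theory.
Import numFieldNormedType.Exports.

Local Open Scope classical_set_scope.
Local Open Scope ring_scope.
Local Open Scope quotient_scope.

Definition isomorphic (G H : groupType) : Prop :=
  exists f : {multiplicative G -> H}, bijective f.

Definition has_quotient (G H : groupType) : Prop :=
  exists f : {multiplicative G -> H}, forall h : H, exists g : G, f g = h.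

(* The semidirect product of Q by Z/2 acting by -id; Z/2 is (bool, addb), so
   that [true] is the generator. *)
Definition dihedral (Q : zmodType) : Type := (Q * bool)%type.

Section Dihedral.
Variable Q : zmodType.
Implicit Types u v : dihedral Q.

HB.instance Definition _ := Choice.copy (dihedral Q) (Q * bool)%type.

Definition dihedral_act (e : bool) (a : Q) : Q := if e then - a else a.

Definition dihedral_one : dihedral Q := (0, false).
Definition dihedral_mul u v : dihedral Q :=
  (u.1 + dihedral_act u.2 v.1, u.2 (+) v.2).
Definition dihedral_inv u : dihedral Q := (dihedral_act u.2 (- u.1), u.2).

Lemma dihedral_mulA : associative dihedral_mul.
Proof.
move=> [a []] [b []] [c []]; rewrite /dihedral_mul/= ?opprD ?opprK ?addrA //.
Qed.
Lemma dihedral_mul1 : left_id dihedral_one dihedral_mul.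
Proof. by move=> [a e]; rewrite /dihedral_mul/= add0r. Qed.
Lemma dihedral_mulr1 : right_id dihedral_one dihedral_mul.
Proof. by move=> [a []]; rewrite /dihedral_mul/= ?oppr0 addr0. Qed.
Lemma dihedral_mulV : left_inverse dihedral_one dihedral_inv dihedral_mul.
Proof. by move=> [a []]; rewrite /dihedral_mul/= ?opprK ?subrr ?addNr. Qed.
Lemma dihedral_mulrV : right_inverse dihedral_one dihedral_inv dihedral_mul.
Proof. by move=> [a []]; rewrite /dihedral_mul/= ?opprK ?subrr. Qed.

HB.instance Definition _ := isGroup.Build (dihedral Q) dihedral_mulA
  dihedral_mul1 dihedral_mulr1 dihedral_mulV dihedral_mulrV.

End Dihedral.

(* 'Z_2 carries its additive group structure, also as a groupType. *)
Section DihedralElementary.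

Definition Z2_of_bool (b : bool) : 'Z_2 := if b then 1%R else 0%R.

Let Z2N (a : 'Z_2) : - a = a.
Proof. by apply/val_inj; case: a => [[|[|]]]. Qed.

Let Z2D (a b : bool) : Z2_of_bool (a (+) b) = (Z2_of_bool a * Z2_of_bool b)%g.
Proof. by apply/val_inj; case: a b => [] []. Qed.

Lemma Z2_of_bool_bij : bijective Z2_of_bool.
Proof.
exists (fun a : 'Z_2 => val a == 1%N); first by case.
by move=> a; apply/val_inj; case: a => [[|[|]]].
Qed.

Definition D4_map (u : dihedral 'Z_2) : ('Z_2 * 'Z_2)%type :=
  (u.1, Z2_of_bool u.2).

Let D4_mapM : {morph D4_map : u v / (u * v)%g}.
Proof.
move=> [a e] [b f]; rewrite /D4_map /= Z2D; congr (_, _).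
by case: e => //=; rewrite Z2N.
Qed.

HB.instance Definition _ := isMultiplicative.Build _ _ D4_map D4_mapM.

Lemma D4_isomorphic : isomorphic (dihedral 'Z_2) ('Z_2 * 'Z_2)%type.
Proof.
exists D4_map; have [g fK gK] := Z2_of_bool_bij.
exists (fun u => (u.1, g u.2)) => -[a b] /=; first by rewrite fK.
by rewrite /D4_map/= gK.
Qed.

Definition D8_map (u : dihedral ('Z_2 * 'Z_2)%type) :
  (('Z_2 * 'Z_2) * 'Z_2)%type := (u.1, Z2_of_bool u.2).

Let D8_mapM : {morph D8_map : u v / (u * v)%g}.
Proof.
move=> [[a a'] e] [[b b'] f]; rewrite /D8_map /= Z2D; congr (_, _).
by case: e => //=; congr (_, _) => /=; rewrite Z2N.
Qed.

HB.instance Definition _ := isMultiplicative.Build _ _ D8_map D8_mapM.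

Lemma D8_isomorphic :
  isomorphic (dihedral ('Z_2 * 'Z_2)%type) (('Z_2 * 'Z_2) * 'Z_2)%type.
Proof.
exists D8_map; have [g fK gK] := Z2_of_bool_bij.
exists (fun u => (u.1, g u.2)) => -[a b] /=; first by rewrite fK.
by rewrite /D8_map/= gK.
Qed.

End DihedralElementary.

Section UnitInterval.
Variable R : realType.

Definition unit_interval : Type := set_type (`[0, 1]%classic : set R).

HB.instance Definition _ := Topological.copy unit_interval
  (set_type (`[0, 1]%classic : set R)).

Definition ival (t : unit_interval) : R := set_val t.

Lemma clamp_subproof (r : R) : Num.max 0 (Num.min r 1) \in `[0, 1]%classic.
Proof.
apply/mem_set; rewrite /= in_itv/= le_max lexx/= ge_max ler01/=.
by rewrite ge_min lexx orbT.
Qed.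

(* The retraction of R onto [0, 1]. *)
Definition clamp (r : R) : unit_interval := SigSub (clamp_subproof r).

Lemma ival_ge0 t : 0 <= ival t.
Proof. by have /set_mem := valP t; rewrite /= in_itv/= => /andP[]. Qed.

Lemma ival_le1 t : ival t <= 1.
Proof. by have /set_mem := valP t; rewrite /= in_itv/= => /andP[]. Qed.

Lemma ival_clamp r : ival (clamp r) = Num.max 0 (Num.min r 1).
Proof. by []. Qed.

Lemma clampK r : 0 <= r <= 1 -> ival (clamp r) = r.
Proof. by move=> /andP[r0 r1]; rewrite ival_clamp (min_idPl r1) (max_idPr r0). Qed.

Lemma ival_inj : injective ival.
Proof. by move=> s t st; apply/val_inj. Qed.

Lemma ivalK : cancel ival clamp.
Proof. by move=> t; apply: ival_inj; rewrite clampK// ival_ge0 ival_le1. Qed.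

Lemma clamp_le0 r : r <= 0 -> clamp r = clamp 0.
Proof.
move=> r0; apply: ival_inj; rewrite !ival_clamp.
rewrite (min_idPl (le_trans r0 ler01)) (max_idPl r0).
by rewrite (min_idPl ler01) maxxx.
Qed.

Lemma clamp_ge1 r : 1 <= r -> clamp r = clamp 1.
Proof. by move=> r0; apply: ival_inj; rewrite !ival_clamp (min_idPr r0) minxx. Qed.

Lemma ival_continuous : continuous ival.
Proof. exact: initial_continuous. Qed.

Lemma clamp_continuous : continuous clamp.
Proof.
apply: continuous_comp_initial => r.
apply: (@continuous_max R R (cst 0) (fun r => Num.min r 1)); first exact: cvg_cst.
by apply: (@continuous_min R R id (cst 1)); [exact: cvg_id|exact: cvg_cst].
Qed.

Lemma continuous_comp_clamp (T : topologicalType) (h : T -> R) :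
  continuous h -> continuous (fun u => clamp (h u)).
Proof.
move=> ch u; apply: (@continuous_comp _ _ _ h clamp); first exact: ch.
exact: clamp_continuous.
Qed.

Lemma unit_interval_neq01 : clamp 0 != clamp 1.
Proof.
apply/eqP => /(congr1 ival); rewrite !clampK ?lexx ?ler01//.
by move/eqP; rewrite eq_sym oner_eq0.
Qed.

HB.instance Definition _ :=
  isBiPointed.Build unit_interval unit_interval_neq01.

Lemma clamp0 : clamp 0 = zero. Proof. by []. Qed.
Lemma clamp1 : clamp 1 = one. Proof. by []. Qed.
Lemma ival0 : ival zero = 0. Proof. by rewrite clampK ?lexx ?ler01. Qed.
Lemma ival1 : ival one = 1. Proof. by rewrite clampK ?lexx ?ler01. Qed.

End UnitInterval.

Lemma continuous_compose (S T U : topologicalType) (f : S -> T) (g : T -> U) :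
  continuous f -> continuous g -> continuous (fun u => g (f u)).
Proof. by move=> cf cg u; apply: (continuous_comp (cf u) (cg (f u))). Qed.

Section RealContinuity.
Variables (R : realType) (T : topologicalType).
Implicit Types (h k : T -> R) (a b : R).

Lemma continuous_shift h b : continuous h -> continuous (fun u => h u + b).
Proof. by move=> ch u; apply: cvgD; [exact: ch|exact: cvg_cst]. Qed.

Lemma continuous_scale h a : continuous h -> continuous (fun u => a * h u).
Proof. by move=> ch u; apply: cvgM; [exact: cvg_cst|exact: ch]. Qed.

Lemma continuous_affine h a b :
  continuous h -> continuous (fun u => a * h u + b).
Proof. by move=> ch; apply/continuous_shift/continuous_scale. Qed.

Lemma continuous_flip h b : continuous h -> continuous (fun u => b - h u).
Proof. by move=> ch u; apply: cvgB; [exact: cvg_cst|exact: ch]. Qed.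

Lemma continuous_maxr h k :
  continuous h -> continuous k -> continuous (fun u => Num.max (h u) (k u)).
Proof. by move=> ch ck u; exact: (@continuous_max R T h k u (ch u) (ck u)). Qed.

Lemma continuous_minr h k :
  continuous h -> continuous k -> continuous (fun u => Num.min (h u) (k u)).
Proof. by move=> ch ck u; exact: (@continuous_min R T h k u (ch u) (ck u)). Qed.

Lemma continuous_id : continuous (id : T -> T).
Proof. by move=> u; exact: cvg_id. Qed.

Lemma continuous_convex (h f g : T -> R) :
  continuous h -> continuous f -> continuous g ->
  continuous (fun u => (1 - h u) * f u + h u * g u).
Proof.
move=> ch cf cg u; apply: cvgD; apply: cvgM.
- exact: continuous_flip.
- exact: cf.
- exact: ch.
- exact: cg.
Qed.

End RealContinuity.

Lemma continuous_glue (R : realType) (T X : topologicalType) (h : T -> R)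
    (c : R) (f g : T -> X) :
    continuous h -> continuous f -> continuous g ->
    (forall t, h t = c -> f t = g t) ->
  continuous (fun t => if h t <= c then f t else g t).
Proof.
move=> ch cf cg fg t U; case: (ltgtP (h t) c) => [htc|htc|htc] nU.
- have := ch t _ (lt_nbhsl htc); rewrite nbhs_simpl => ht.
  have := cf t U; rewrite nbhs_simpl => /(_ nU) ft.
  change (\forall y \near t, U (if h y <= c then f y else g y)).
  by near=> y; rewrite ltW//; near: y.
- have := ch t _ (lt_nbhsr htc); rewrite nbhs_simpl => ht.
  have := cg t U; rewrite nbhs_simpl => /(_ nU) gt.
  change (\forall y \near t, U (if h y <= c then f y else g y)).
  by near=> y; rewrite leNgt ifF; [near: y|apply/negbF; near: y].
- have := cf t U; rewrite nbhs_simpl => /(_ nU) ft.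
  have := cg t U; rewrite nbhs_simpl -(fg t htc) => /(_ nU) gt.
  change (\forall y \near t, U (if h y <= c then f y else g y)).
  by near=> y; case: ifP => _; near: y.
Unshelve. all: by end_near. Qed.

Section FundamentalGroup.
Variables (R : realType) (X : topologicalType).
Local Notation I := (unit_interval R).
Implicit Types x y z : X.

(* Homotopy relative to the end points. *)
Definition path_homotopic x y (p q : {path I from x to y}) : Prop :=
  exists H : I * I -> X,
    [/\ continuous H,
        (forall t, H (zero, t) = p t),
        (forall t, H (one, t) = q t),
        (forall s, H (s, zero) = x) &
        (forall s, H (s, one) = y)].

Lemma path_continuous x y (p : {path I from x to y}) : continuous p.
Proof. by move=> t; apply: cts_fun. Qed.

Lemma path_clamp0 x y (p : {path I from x to y}) r : r <= 0 -> p (clamp r) = x.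
Proof. by move=> /clamp_le0 ->; rewrite path_zero. Qed.

Lemma path_clamp1 x y (p : {path I from x to y}) r : 1 <= r -> p (clamp r) = y.
Proof. by move=> /clamp_ge1 ->; rewrite path_one. Qed.

Definition path_cat_fun x y z (p : {path I from x to y})
    (q : {path I from y to z}) (t : I) : X :=
  if ival t <= 2^-1 then p (clamp (2 * ival t))
  else q (clamp (2 * ival t - 1)).

Lemma continuous_path_clamp (T : topologicalType) x y (p : {path I from x to y})
  (h : T -> R) : continuous h -> continuous (fun t => p (clamp (h t))).
Proof.
move=> ch t; apply: (@continuous_comp _ _ _ (fun t => clamp (h t)) p).
  by apply: continuous_comp; [exact: ch|exact: clamp_continuous].
exact: path_continuous.
Qed.

Lemma path_cat_continuous x y z (p : {path I from x to y})
    (q : {path I from y to z}) : continuous (path_cat_fun p q).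
Proof.
apply: continuous_glue; first exact: ival_continuous.
- apply/continuous_path_clamp/continuous_scale; exact: ival_continuous.
- apply/continuous_path_clamp/continuous_affine; exact: ival_continuous.
- by move=> t ->; rewrite path_clamp1 ?path_clamp0//; lra.
Qed.

Lemma path_cat_zero x y z (p : {path I from x to y})
    (q : {path I from y to z}) : path_cat_fun p q zero = x.
Proof. by rewrite /path_cat_fun ival0 ifT ?path_clamp0//; lra. Qed.

Lemma path_cat_one x y z (p : {path I from x to y})
    (q : {path I from y to z}) : path_cat_fun p q one = z.
Proof. by rewrite /path_cat_fun ival1 ifF ?path_clamp1//; lra. Qed.

Definition path_cat x y z (p : {path I from x to y})
    (q : {path I from y to z}) : {path I from x to z} :=
  mk_path (@path_cat_continuous _ _ _ p q) (path_cat_zero p q)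
    (path_cat_one p q).

Definition path_rev_fun x y (p : {path I from x to y}) (t : I) : X :=
  p (clamp (1 - ival t)).

Lemma path_rev_continuous x y (p : {path I from x to y}) :
  continuous (path_rev_fun p).
Proof.
apply/continuous_path_clamp/continuous_flip; exact: ival_continuous.
Qed.

Lemma path_rev_zero x y (p : {path I from x to y}) : path_rev_fun p zero = y.
Proof. by rewrite /path_rev_fun ival0 path_clamp1//; lra. Qed.

Lemma path_rev_one x y (p : {path I from x to y}) : path_rev_fun p one = x.
Proof. by rewrite /path_rev_fun ival1 path_clamp0//; lra. Qed.

Definition path_rev x y (p : {path I from x to y}) : {path I from y to x} :=
  mk_path (@path_rev_continuous _ _ p) (path_rev_zero p) (path_rev_one p).

Lemma path_revK x y : cancel (@path_rev x y) (@path_rev y x).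
Proof.
move=> p; apply/path_eqP => t; rewrite /= /mk_path /path_rev_fun /=.
rewrite /mk_path /path_rev_fun clampK; first by rewrite subKr ivalK.
by have := ival_ge0 t; have := ival_le1 t; lra.
Qed.

Lemma ival_fst_continuous : continuous (fun u : I * I => ival u.1).
Proof.
move=> u; apply: (@continuous_comp _ _ _ fst (@ival R)); first exact: cvg_fst.
exact: ival_continuous.
Qed.

Lemma ival_snd_continuous : continuous (fun u : I * I => ival u.2).
Proof.
move=> u; apply: (@continuous_comp _ _ _ snd (@ival R)); first exact: cvg_snd.
exact: ival_continuous.
Qed.

Lemma path_homotopic_reparam (G : R -> X) (phi psi : R -> R) x y
    (p q : {path I from x to y}) :
    continuous G -> continuous phi -> continuous psi ->
    phi 0 = psi 0 -> phi 1 = psi 1 ->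
    (forall t : I, p t = G (phi (ival t))) ->
    (forall t : I, q t = G (psi (ival t))) ->
  path_homotopic p q.
Proof.
move=> cG cphi cpsi e0 e1 pG qG.
exists (fun u : I * I => G ((1 - ival u.1) * phi (ival u.2) +
  ival u.1 * psi (ival u.2))); split => /=.
- move=> u; apply: (@continuous_comp _ _ _ (fun u : I * I =>
    (1 - ival u.1) * phi (ival u.2) + ival u.1 * psi (ival u.2)) G); last exact: cG.
  apply: continuous_convex; first exact: ival_fst_continuous.
    by apply: continuous_compose; [exact: ival_snd_continuous|].
  by apply: continuous_compose; [exact: ival_snd_continuous|].
- by move=> t; rewrite ival0 subr0 mul1r mul0r addr0.
- by move=> t; rewrite ival1 subrr mul1r mul0r add0r.
- move=> s; rewrite ival0 e0 -mulrDl subrK mul1r -ival0 -qG path_zero //.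
- move=> s; rewrite ival1 e1 -mulrDl subrK mul1r -ival1 -qG path_one //.
Qed.

Lemma path_homotopic_refl x y (p : {path I from x to y}) : path_homotopic p p.
Proof.
apply: (@path_homotopic_reparam (fun r => p (clamp r)) id id) => //.
- by apply: continuous_path_clamp; exact: continuous_id.
- exact: continuous_id.
- exact: continuous_id.
- by move=> t; rewrite ivalK.
- by move=> t; rewrite ivalK.
Qed.

Lemma continuous_clamp_pair (T : topologicalType) (H : I * I -> X)
    (h k : T -> R) : continuous H -> continuous h -> continuous k ->
  continuous (fun u => H (clamp (h u), clamp (k u))).
Proof.
move=> cH ch ck u.
apply: (@continuous_comp _ _ _ (fun u => (clamp (h u), clamp (k u))) H).
  exact: (@cvg_pair T I I (nbhs u) (nbhs (clamp (h u))) (nbhs (clamp (k u)))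
    _ _ _ _ _ (@continuous_comp_clamp R T h ch u)
    (@continuous_comp_clamp R T k ck u)).
exact: cH.
Qed.

Lemma path_homotopic_sym x y (p q : {path I from x to y}) :
  path_homotopic p q -> path_homotopic q p.
Proof.
move=> [H [cH H0 H1 Hx Hy]].
exists (fun u => H (clamp (-1 * ival u.1 + 1), clamp (1 * ival u.2 + 0))).
split => /=.
- by apply: continuous_clamp_pair => //; apply: continuous_affine;
    [exact: ival_fst_continuous|exact: ival_snd_continuous].
- by move=> t; rewrite ival0 mulr0 add0r clamp1 H1 mul1r addr0 ivalK.
- by move=> t; rewrite ival1 mulr1 addNr clamp0 H0 mul1r addr0 ivalK.
- by move=> s; rewrite ival0 mulr0 addr0 clamp0 Hx.
- by move=> s; rewrite ival1 mulr1 addr0 clamp1 Hy.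
Qed.

Lemma path_homotopic_trans x y (q p r : {path I from x to y}) :
  path_homotopic p q -> path_homotopic q r -> path_homotopic p r.
Proof.
move=> [H [cH H0 H1 Hx Hy]] [K [cK K0 K1 Kx Ky]].
exists (fun u => if ival u.1 <= 2^-1
  then H (clamp (2 * ival u.1 + 0), clamp (1 * ival u.2 + 0))
  else K (clamp (2 * ival u.1 + -1), clamp (1 * ival u.2 + 0))).
split => /=.
- apply: continuous_glue; first exact: ival_fst_continuous.
  + by apply: continuous_clamp_pair => //; apply: continuous_affine;
    [exact: ival_fst_continuous|exact: ival_snd_continuous].
  + by apply: continuous_clamp_pair => //; apply: continuous_affine;
    [exact: ival_fst_continuous|exact: ival_snd_continuous].
  + move=> u ->; rewrite [X in clamp X](_ : _ = 1); last by lra.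
    rewrite [X in K (clamp X, _)](_ : _ = 0); last by lra.
    by rewrite clamp1 clamp0 H1 K0.
- move=> t; rewrite ival0 ifT; last by lra.
  by rewrite mulr0 addr0 clamp0 H0 mul1r addr0 ivalK.
- move=> t; rewrite ival1 ifF; last by lra.
  rewrite [X in K (clamp X, _)](_ : _ = 1); last by lra.
  by rewrite clamp1 K1 mul1r addr0 ivalK.
- move=> s; rewrite ival0 mul1r !addr0 clamp0 Hx Kx; exact: if_same.
- move=> s; rewrite ival1 mul1r !addr0 clamp1 Hy Ky; exact: if_same.
Qed.

Lemma path_homotopic_cat x y z (p p' : {path I from x to y})
    (q q' : {path I from y to z}) :
  path_homotopic p p' -> path_homotopic q q' ->
  path_homotopic (path_cat p q) (path_cat p' q').
Proof.
move=> [H [cH H0 H1 Hx Hy]] [K [cK K0 K1 Kx Ky]].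
exists (fun u => if ival u.2 <= 2^-1
  then H (clamp (1 * ival u.1 + 0), clamp (2 * ival u.2 + 0))
  else K (clamp (1 * ival u.1 + 0), clamp (2 * ival u.2 + -1))).
split => /=.
- apply: continuous_glue; first exact: ival_snd_continuous.
  + by apply: continuous_clamp_pair => //; apply: continuous_affine;
    [exact: ival_fst_continuous|exact: ival_snd_continuous].
  + by apply: continuous_clamp_pair => //; apply: continuous_affine;
    [exact: ival_fst_continuous|exact: ival_snd_continuous].
  + move=> u ->; rewrite [X in H (_, clamp X)](_ : _ = 1); last by lra.
    rewrite [X in K (_, clamp X)](_ : _ = 0); last by lra.
    by rewrite clamp1 clamp0 Hy Kx.
- move=> t; rewrite ival0 mul1r !addr0 clamp0 H0 K0.
  by [].
- move=> t; rewrite ival1 mul1r !addr0 clamp1 H1 K1.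
  by [].
- move=> s; rewrite ival0 ifT; last by lra.
  by rewrite mulr0 !addr0 clamp0 Hx.
- move=> s; rewrite ival1 ifF; last by lra.
  rewrite [X in K (_, clamp X)](_ : _ = 1); last by lra.
  by rewrite clamp1 Ky.
Qed.

Lemma path_homotopic_rev x y (p q : {path I from x to y}) :
  path_homotopic p q -> path_homotopic (path_rev p) (path_rev q).
Proof.
move=> [H [cH H0 H1 Hx Hy]].
exists (fun u => H (clamp (1 * ival u.1 + 0), clamp (-1 * ival u.2 + 1))).
split => /=.
- by apply: continuous_clamp_pair => //; apply: continuous_affine;
    [exact: ival_fst_continuous|exact: ival_snd_continuous].
- move=> t; rewrite ival0 mul1r !addr0 clamp0 H0 mulN1r addrC //.
- move=> t; rewrite ival1 mul1r !addr0 clamp1 H1 mulN1r addrC //.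
- by move=> s; rewrite ival0 mulr0 add0r clamp1 Hy.
- by move=> s; rewrite ival1 mulr1 addNr clamp0 Hx.
Qed.

Lemma path_catA x y z w (p : {path I from x to y}) (q : {path I from y to z})
    (r : {path I from z to w}) :
  path_homotopic (path_cat p (path_cat q r)) (path_cat (path_cat p q) r).
Proof.
pose G (u : R) : X := if u <= 1 then p (clamp u) else
  if u <= 2 then q (clamp (1 * u + -1)) else r (clamp (1 * u + -2)).
apply: (@path_homotopic_reparam G
  (fun t => Num.max (2 * t + 0) (4 * t + -1))
  (fun t => Num.min (4 * t + 0) (2 * t + 1))).
- apply: continuous_glue; first exact: continuous_id.
  + by apply: continuous_path_clamp; exact: continuous_id.
  + apply: continuous_glue; first exact: continuous_id.
    * by apply/continuous_path_clamp/continuous_affine; exact: continuous_id.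
    * by apply/continuous_path_clamp/continuous_affine; exact: continuous_id.
    * by move=> u ->; rewrite path_clamp1 ?path_clamp0//; lra.
  + move=> u ->; rewrite ifT; last by lra.
    by rewrite path_clamp1 ?path_clamp0//; lra.
- by apply: continuous_maxr; apply: continuous_affine; exact: continuous_id.
- by apply: continuous_minr; apply: continuous_affine; exact: continuous_id.
- by rewrite /Num.max /Num.min /=; do 2 case: ifPn; lra.
- by rewrite /Num.max /Num.min /=; do 2 case: ifPn; lra.
- move=> t; have t0 := ival_ge0 t; have t1 := ival_le1 t.
  rewrite /= /mk_path /path_cat_fun /= /mk_path /path_cat_fun /G.
  case: (leP (ival t) 2^-1) => th.
    rewrite (max_idPl _); last by lra.
    by rewrite addr0 ifT//; lra.
  rewrite (max_idPr _); last by lra.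
  rewrite clampK; last by lra.
  have -> : (4 * ival t + -1 <= 1) = false by apply/negbTE; rewrite -ltNge; lra.
  case: (leP (2 * ival t - 1) 2^-1) => tq.
    by rewrite ifT; [congr (q (clamp _)); lra|lra].
  rewrite ifF; last by apply/negbTE; rewrite -ltNge; lra.
  by congr (r (clamp _)); lra.
- move=> t; have t0 := ival_ge0 t; have t1 := ival_le1 t.
  rewrite /= /mk_path /path_cat_fun /= /mk_path /path_cat_fun /G.
  case: (leP (ival t) 2^-1) => th.
    rewrite (min_idPl _); last by lra.
    rewrite clampK; last by lra.
    case: (leP (2 * ival t) 2^-1) => tq.
      by rewrite ifT; [congr (p (clamp _)); lra|lra].
    rewrite ifF; last by apply/negbTE; rewrite -ltNge; lra.
    by rewrite ifT; [congr (q (clamp _)); lra|lra].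
  rewrite (min_idPr _); last by lra.
  rewrite ifF; last by apply/negbTE; rewrite -ltNge; lra.
  rewrite ifF; last by apply/negbTE; rewrite -ltNge; lra.
  by congr (r (clamp _)); lra.
Qed.

Lemma path_cat1p x y (p : {path I from x to y}) :
  path_homotopic (path_cat (cst x) p) p.
Proof.
apply: (@path_homotopic_reparam (fun r => p (clamp r))
  (fun t => Num.max 0 (2 * t + -1)) id).
- by apply: continuous_path_clamp; exact: continuous_id.
- apply: continuous_maxr; first by move=> t; exact: cst_continuous.
  by apply: continuous_affine; exact: continuous_id.
- exact: continuous_id.
- by rewrite (max_idPl _)//; lra.
- by rewrite (max_idPr _); lra.
- move=> t; rewrite /= /mk_path /path_cat_fun /=.
  case: (leP (ival t) 2^-1) => th.
    by rewrite (max_idPl _) ?clamp0 ?path_zero//; lra.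
  by rewrite (max_idPr _)//; lra.
- by move=> t; rewrite ivalK.
Qed.

Lemma path_catp1 x y (p : {path I from x to y}) :
  path_homotopic (path_cat p (cst y)) p.
Proof.
apply: (@path_homotopic_reparam (fun r => p (clamp r))
  (fun t => Num.min (2 * t + 0) 1) id).
- by apply: continuous_path_clamp; exact: continuous_id.
- apply: continuous_minr; last by move=> t; exact: cst_continuous.
  by apply: continuous_affine; exact: continuous_id.
- exact: continuous_id.
- by rewrite (min_idPl _); lra.
- by rewrite (min_idPr _)//; lra.
- move=> t; rewrite /= /mk_path /path_cat_fun /= addr0.
  case: (leP (ival t) 2^-1) => th.
    by rewrite (min_idPl _)//; lra.
  by rewrite (min_idPr _) ?clamp1 ?path_one//; lra.
- by move=> t; rewrite ivalK.
Qed.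

Lemma path_catpV x y (p : {path I from x to y}) :
  path_homotopic (path_cat p (path_rev p)) (cst x).
Proof.
apply: (@path_homotopic_reparam (fun r => p (clamp r))
  (fun t => Num.min (2 * t + 0) (-2 * t + 2)) (fun=> 0)).
- by apply: continuous_path_clamp; exact: continuous_id.
- by apply: continuous_minr; apply: continuous_affine; exact: continuous_id.
- by move=> t; exact: cst_continuous.
- by rewrite (min_idPl _); lra.
- by rewrite (min_idPr _); lra.
- move=> t; have t0 := ival_ge0 t; have t1 := ival_le1 t.
  rewrite /= /mk_path /path_cat_fun /= /mk_path /path_rev_fun addr0.
  case: (leP (ival t) 2^-1) => th.
    by rewrite (min_idPl _)//; lra.
  rewrite (min_idPr _); last by lra.
  by rewrite clampK; [congr (p (clamp _)); lra|lra].
- by move=> t; rewrite clamp0 path_zero.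
Qed.

Lemma path_catVp x y (p : {path I from x to y}) :
  path_homotopic (path_cat (path_rev p) p) (cst y).
Proof. by have := path_catpV (path_rev p); rewrite path_revK. Qed.

Variable x0 : X.

Definition homotopic_rel (p q : {path I from x0 to x0}) : bool :=
  `[< path_homotopic p q >].

Lemma homotopic_rel_refl : reflexive homotopic_rel.
Proof. by move=> p; apply/asboolP; exact: path_homotopic_refl. Qed.

Lemma homotopic_rel_sym : symmetric homotopic_rel.
Proof.
by move=> p q; apply/asboolP/asboolP; exact: path_homotopic_sym.
Qed.

Lemma homotopic_rel_trans : transitive homotopic_rel.
Proof.
move=> q p r /asboolP pq /asboolP qr; apply/asboolP.
exact: path_homotopic_trans pq qr.
Qed.

Definition loop_homotopy :=
  EquivRel _ homotopic_rel_refl homotopic_rel_sym homotopic_rel_trans.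

Definition pi1 : Type := {eq_quot loop_homotopy}.

HB.instance Definition _ := Choice.on pi1.
HB.instance Definition _ := Quotient.on pi1.

Lemma pi1_eqP (p q : {path I from x0 to x0}) :
  \pi_pi1 p = \pi_pi1 q <-> path_homotopic p q.
Proof. by split=> [/eqmodP/asboolP|?]//; apply/eqmodP/asboolP. Qed.

Definition pi1_one : pi1 := \pi_pi1 (cst x0 : {path I from x0 to x0}).
Definition pi1_mul (a b : pi1) : pi1 := \pi_pi1 (path_cat (repr a) (repr b)).
Definition pi1_inv (a : pi1) : pi1 := \pi_pi1 (path_rev (repr a)).

Lemma homotopic_repr (p : {path I from x0 to x0}) :
  path_homotopic (repr (\pi_pi1 p)) p.
Proof. by apply/pi1_eqP; rewrite reprK. Qed.

Lemma pi1_mulE p q : pi1_mul (\pi_pi1 p) (\pi_pi1 q) = \pi_pi1 (path_cat p q).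
Proof. by apply/pi1_eqP; apply: path_homotopic_cat; exact: homotopic_repr. Qed.

Lemma pi1_invE p : pi1_inv (\pi_pi1 p) = \pi_pi1 (path_rev p).
Proof. by apply/pi1_eqP; apply: path_homotopic_rev; exact: homotopic_repr. Qed.

Lemma pi1_mulA : associative pi1_mul.
Proof.
move=> a b c; rewrite -[a]reprK -[b]reprK -[c]reprK.
rewrite (pi1_mulE (repr b) (repr c)) (pi1_mulE (repr a) (repr b)) !pi1_mulE.
by apply/pi1_eqP; exact: path_catA.
Qed.

Lemma pi1_mul1 : left_id pi1_one pi1_mul.
Proof.
by move=> a; rewrite -[a]reprK pi1_mulE; apply/pi1_eqP; exact: path_cat1p.
Qed.

Lemma pi1_mulr1 : right_id pi1_one pi1_mul.
Proof.
by move=> a; rewrite -[a]reprK pi1_mulE; apply/pi1_eqP; exact: path_catp1.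
Qed.

Lemma pi1_mulV : left_inverse pi1_one pi1_inv pi1_mul.
Proof.
move=> a; rewrite -[a]reprK pi1_invE pi1_mulE.
by apply/pi1_eqP; exact: path_catVp.
Qed.

Lemma pi1_mulrV : right_inverse pi1_one pi1_inv pi1_mul.
Proof.
move=> a; rewrite -[a]reprK pi1_invE pi1_mulE.
by apply/pi1_eqP; exact: path_catpV.
Qed.

HB.instance Definition _ :=
  isGroup.Build pi1 pi1_mulA pi1_mul1 pi1_mulr1 pi1_mulV pi1_mulrV.

End FundamentalGroup.

Section Hirzebruch.
Variables (R : realType) (d : nat).
Local Notation C := (R[i]^o).

(* ((x0, x1), (s, t)): Cox coordinates on Sigma_d, where [x0 : x1] are the
   homogeneous coordinates of the base of the ruling. *)
Definition cox_space : topologicalType := ((C * C) * (C * C))%type.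

Definition cox_domain : set cox_space := [set z | z.1 <> 0 /\ z.2 <> 0].

(* (l, m) in (C^* )^2 acts with weights x0, x1 : (1, 0), s : (0, 1) and
   t : (d, 1); equivalently, the divisor classes of x0, x1, s, t are F, F, E
   and E + dF. *)
Definition cox_act (l m : C) (z : cox_space) : cox_space :=
  ((l * z.1.1, l * z.1.2), (m * z.2.1, m * l ^+ d * z.2.2)).

Definition cox_rel (z w : set_type cox_domain) : bool :=
  `[< exists l m : C, [/\ l != 0, m != 0 & val w = cox_act l m (val z)] >].

Lemma cox_rel_refl : reflexive cox_rel.
Proof.
move=> [[[a b] [s t]] z]; apply/asboolP; exists 1, 1; rewrite oner_eq0.
by split=> //; rewrite /cox_act/= expr1n !mul1r.
Qed.

Lemma cox_rel_imp z w : cox_rel z w -> cox_rel w z.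
Proof.
move=> /asboolP[l [m [l0 m0 wE]]]; apply/asboolP; exists l^-1, m^-1.
rewrite !invr_eq0; split=> //; rewrite wE /cox_act/=.
rewrite !mulKf// exprVn mulrA mulrACA (mulVf m0) mulVf ?expf_neq0// !mul1r.
by case: (val z) => [[a b] [s t]].
Qed.

Lemma cox_rel_sym : symmetric cox_rel.
Proof. by move=> z w; apply/idP/idP; exact: cox_rel_imp. Qed.

Lemma cox_rel_trans : transitive cox_rel.
Proof.
move=> w z v /asboolP[l [m [l0 m0 wE]]] /asboolP[k [n [k0 n0 vE]]].
apply/asboolP; exists (k * l), (n * m); rewrite !mulf_neq0//; split=> //.
by rewrite vE wE /cox_act/= exprMn !mulrA (mulrAC n (k ^+ d) m).
Qed.

Definition cox_equiv := EquivRel _ cox_rel_refl cox_rel_sym cox_rel_trans.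

Definition hirzebruch : Type := quotient_topology {eq_quot cox_equiv}.

HB.instance Definition _ := Topological.on hirzebruch.
HB.instance Definition _ := Quotient.on hirzebruch.

Implicit Types (z : hirzebruch) (A B : set hirzebruch).

(* Coordinates of a representative. The conditions imposed on them below are
   invariant under cox_act (for zero_locus f, when f is bihomogeneous, i.e. in
   some class), hence do not depend on this choice. *)
Definition cox z : cox_space := val (repr z).

Definition exceptional_section : set hirzebruch := [set z | (cox z).2.1 = 0].

(* The fiber over [u0 : u1] of the ruling [x0 : x1; s : t] |-> [x0 : x1]. *)
Definition fiber (u : C * C) : set hirzebruch :=
  [set z | (cox z).1.1 * u.2 = (cox z).1.2 * u.1].

Definition is_fiber (F : set hirzebruch) : Prop :=
  exists2 u : C * C, u <> 0 & F = fiber u.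

(* The Cox ring C[x0, x1, s, t], in this order of the variables. *)
Definition cox_ring := mpoly 4 R[i].

Definition cox_eval (f : cox_ring) z : R[i] :=
  meval (tnth [tuple (cox z).1.1; (cox z).1.2; (cox z).2.1; (cox z).2.2]) f.

(* f is a section of O(aE + bF). *)
Definition in_class (a b : nat) (f : cox_ring) : Prop :=
  forall m : multinom 4, m \in msupp f ->
    (m (inord 2) + m (inord 3) = a /\
     m (inord 0) + m (inord 1) + d * m (inord 3) = b)%N.

Definition zero_locus (f : cox_ring) : set hirzebruch :=
  [set z | cox_eval f z = 0].

Definition zariski_closed A : Prop :=
  exists S : set cox_ring,
    (forall f, S f -> exists a b, in_class a b f) /\
    A = \bigcap_(f in S) zero_locus f.

Definition zariski_irreducible A : Prop :=
  A !=set0 /\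
  forall B1 B2, zariski_closed B1 -> zariski_closed B2 ->
    A `<=` B1 `|` B2 -> A `<=` B1 \/ A `<=` B2.

Definition reducible A : Prop := A !=set0 /\ ~ zariski_irreducible A.

Definition irreducible_component A B : Prop :=
  [/\ B `<=` A, zariski_irreducible B &
      forall B', B `<=` B' -> B' `<=` A -> zariski_irreducible B' -> B' = B].

Definition has_components (n : nat) A : Prop :=
  ([set B | irreducible_component A B] #= `I_n)%card.

Definition square_free (f : cox_ring) : Prop :=
  forall g h : cox_ring, f = g ^+ 2 * h -> g \is a GRing.unit.

(* A reduced curve is identified with its set of points; it is the zero locus
   of a square-free section (which is then nonzero). *)
Definition trigonal_curve (A : set hirzebruch) : Prop :=
  A `&` exceptional_section = set0 /\
  exists f : cox_ring,
    [/\ in_class 3 (3 * d)%N f, square_free f & A = zero_locus f].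

Definition nonsingular_fiber (A F : set hirzebruch) : Prop :=
  is_fiber F /\ (`I_3 #<= F `&` A)%card.

Definition affine_complement (A F : set hirzebruch) : set hirzebruch :=
  ~` (A `|` exceptional_section `|` F).

Definition pi1_afn (A F : set hirzebruch)
    (x0 : set_type (affine_complement A F)) : groupType :=
  pi1 R x0.

End Hirzebruch.

(* Main.v *)
From HB Require Import structures.
From mathcomp Require Import -(notations) mpoly.
Require Import Defs.
From mathcomp Require Import all_boot all_order all_algebra.
From mathcomp Require Import ring lra zify.
From mathcomp Require Import generic_quotient complex all_classical reals topology normedtype realfun derive homotopy.

(** Choose coordinates [(x, y)] on the complement of the fibre [F] and of the exceptional
    section, [x] on the base and [y] along the fibres.  The curve becomes the zero set of a
    monic cubic [f x y] in [y] whose coefficients are polynomials in [x], and its affine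
    complement is homeomorphic to the set where [f] does not vanish ([line_point_complement],
    [continuous_chart_map], [continuous_of_chart]).  As [F] is nonsingular, the discriminant
    of [f] is not the zero polynomial ([disc_nonsingular]).

    A polynomial [L] with [f x L.[x] = 0] for all [x] is the same as a component of the curve
    that is a section of the ruling.  Since the curve has degree three over the base, it is
    reducible when there is such an [L], and it has three components when there are three of
    them ([reducible_poly_root], [components_poly_roots]).  What has to be shown is that a
    curve whose equation has no such factor is irreducible ([irreducible_zero_locus]): two
    forms whose product vanishes on it are eliminated against its equation by resultants.

    On the side of the group, both dihedral groups have exponent two, so that the quotients
    in question are given by two, respectively three, independent characters of the
    fundamental group with values in Z/2 ([elementary_quotient]).  It remains to compare
    characters with polynomial roots.

    From roots to characters.  A factor of [f] is a nowhere vanishing function on the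
    complement, and the sign by which its square root changes along a loop is a character
    ([sign_characterP]).  A small loop around a point of the curve changes exactly the signs
    of the factors that vanish at this point ([meridian_signs]), which makes the characters of
    different factors independent.

    From characters to roots.  A character assigns a value to each segment in the complement,
    in such a way that the values around a triangle add up to zero ([chord_cocycle]).  It has a
    meridian at each simple root [p] of [f x], the sum of the values on a small quadrilateral
    around [p] in the fibre ([mer]).
    - A character without nontrivial meridians is trivial ([character_no_mer]): it has a
      potential on each fibre, and these fit together ([exact_no_mer]).  This replaces a
      presentation of the group by generators and relations.
    - If one of the three meridians over some [x] differs from the two others, then the root
      where this happens is distinguished from them over all [x] off the discriminant.  It is
      therefore a continuous function of [x] ([distinguished_root]), and a continuous root of
      a cubic with polynomial coefficients is a polynomial ([continuous_root_poly], from the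
      Liouville theorem [liouville_vanish]).

    Meridians are additive.  So if no root is a polynomial, the three meridians of each
    nontrivial character agree and are nontrivial, and the sum of two such characters has no
    meridians; hence there are no two independent characters ([two_cocycles_root]).  Three
    independent characters provide all the patterns of meridians over a given [x], so that
    each of the three roots is distinguished by one of them ([three_cocycles_roots]). *)

Set Implicit Arguments. Unset Strict Implicit. Unset Printing Implicit Defensive.
Import Order.TTheory GRing.Theory Num.Theory.
Import numFieldNormedType.Exports.
Local Open Scope classical_set_scope.
Local Open Scope ring_scope.
Local Open Scope quotient_scope.
Local Notation Re := (@complex.Re _).
Local Notation Im := (@complex.Im _).

(** * The modulus, neighbourhoods and segments *)

Section Modulus.
Variables (R : realType) (V : normedModType R[i]).
Implicit Types (u v w : V) (P : set V).

(** The norm of a complex normed space takes its values in [R[i]]; this is the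
    same norm with values in [R], where the order is total. *)
Definition nm v : R := Re `|v|.

Lemma nmE v : (nm v)%:C%C = `|v|.
Proof. by rewrite /nm RRe_real// normr_real. Qed.

Lemma nm_ge0 v : 0 <= nm v.
Proof. by rewrite -lecR nmE normr_ge0. Qed.

Lemma nm0 : nm 0 = 0.
Proof. by rewrite /nm normr0. Qed.

Lemma nm_eq0 v : (nm v == 0) = (v == 0).
Proof. by rewrite -(inj_eq (@complexI R)) nmE normr_eq0. Qed.

Lemma nm_gt0 v : (0 < nm v) = (v != 0).
Proof. by rewrite lt_neqAle nm_ge0 andbT eq_sym nm_eq0. Qed.

Lemma nmN v : nm (- v) = nm v.
Proof. by rewrite /nm normrN. Qed.

Lemma nmBC u v : nm (u - v) = nm (v - u).
Proof. by rewrite -nmN opprB. Qed.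

Lemma nmD u v : nm (u + v) <= nm u + nm v.
Proof. by rewrite -lecR rmorphD /= !nmE ler_normD. Qed.

Lemma nmB u v : nm (u - v) <= nm u + nm v.
Proof. by rewrite -(nmN v) nmD. Qed.

Lemma nm_tri u v w : nm (u - w) <= nm (u - v) + nm (v - w).
Proof. by rewrite -[u - w](subrKA v) nmD. Qed.

Lemma nmZr (t : R) v : nm (t%:C%C *: v) = `|t| * nm v.
Proof.
apply: (@complexI R); rewrite nmE normrZ rmorphM /= nmE; congr (_ * _).
by rewrite normc_def /= expr0n /= addr0 sqrtr_sqr.
Qed.

Lemma nbhs_nmP (a : V) P :
  nbhs a P <-> exists2 e : R, 0 < e & forall z, nm (z - a) < e -> P z.
Proof.
split=> [/nbhs_normP[e /= e0 eP]|[e e0 eP]].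
  move: e0 eP; rewrite ltcE /= => /andP[/eqP ie re] eP.
  exists (Re e) => // z za; apply: eP; rewrite /= distrC -nmE.
  by rewrite ltcE /= eq_sym ie eqxx.
apply/nbhs_normP; exists e%:C%C => /=; first by rewrite ltcR.
by move=> z /=; rewrite distrC -nmE ltcR; exact: eP.
Qed.

Definition nball (a : V) (e : R) : set V := [set z | nm (z - a) < e].

Lemma nball_center a e : 0 < e -> nball a e a.
Proof. by rewrite /nball /= subrr nm0. Qed.

Lemma nbhs_nball a e : 0 < e -> nbhs a (nball a e).
Proof. by move=> e0; apply/nbhs_nmP; exists e. Qed.

Lemma open_nball a e : open (nball a e).
Proof.
rewrite openE => z za; apply/nbhs_nmP; exists (e - nm (z - a)); first by rewrite subr_gt0.
move=> w wz; apply: le_lt_trans (nm_tri w z a) _.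
by rewrite -ltrBrDr.
Qed.

Definition seg (a b : V) (t : R) : V := a + t%:C%C *: (b - a).

Lemma seg0 a b : seg a b 0 = a.
Proof. by rewrite /seg scale0r addr0. Qed.

Lemma seg1 a b : seg a b 1 = b.
Proof. by rewrite /seg scale1r addrC subrK. Qed.

Lemma segxx a t : seg a a t = a.
Proof. by rewrite /seg subrr scaler0 addr0. Qed.

Lemma segE a b t : seg a b t = (1 - t)%:C%C *: a + t%:C%C *: b.
Proof.
by rewrite /seg scalerBr rmorphB /= scalerBl scale1r addrA addrAC.
Qed.

Lemma seg_rev a b t : seg a b t = seg b a (1 - t).
Proof. by rewrite !segE opprB addrC addrCA subrr addr0. Qed.

Lemma segB a b c t : seg a b t - c = (1 - t)%:C%C *: (a - c) + t%:C%C *: (b - c).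
Proof.
rewrite segE !scalerBr addrACA -opprD -scalerDl -rmorphD /= subrK scale1r //.
Qed.

Lemma seg_continuous a b : continuous (seg a b).
Proof.
move=> t; apply/cvg_ballP => e e0.
have /nbhs_nmP[d d0 dP] := nbhsx_ballx (seg a b t) e e0.
have M0 : 0 < nm (b - a) + 1 by rewrite ltr_wpDl ?nm_ge0.
have : \forall s \near t, `|t - s| < d / (nm (b - a) + 1).
  exact: nbhsx_ballx (divr_gt0 d0 M0).
apply: filterS => s; rewrite ltr_pdivlMr // => ts; apply: dP.
rewrite /seg opprD addrACA subrr add0r -scalerBl -rmorphB /= nmZr distrC.
by apply: le_lt_trans ts; rewrite ler_wpM2l // lerDl.
Qed.

Definition convex (S : set V) :=
  forall a b t, S a -> S b -> 0 <= t <= 1 -> S (seg a b t).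

Lemma convexI S S' : convex S -> convex S' -> convex (S `&` S').
Proof. by move=> c c' a b t [? ?] [? ?] t01; split; [apply: c|apply: c']. Qed.

Lemma convex_nball a e : convex (nball a e).
Proof.
move=> b c t; rewrite /nball /= => ba ca /andP[t0 t1]; rewrite segB.
apply: le_lt_trans (nmD _ _) _; rewrite !nmZr !ger0_norm ?subr_ge0//.
have [->|tn0] := eqVneq t 0; first by rewrite subr0 mul1r mul0r addr0.
have -> : e = (1 - t) * e + t * e by rewrite -mulrDl subrK mul1r.
apply: ler_ltD; first by rewrite ler_wpM2l ?subr_ge0// ltW.
by rewrite ltr_pM2l// lt_neqAle eq_sym tn0.
Qed.

Lemma nbhs_convex (a : V) P : nbhs a P ->
  exists N, [/\ convex N, open N, N a & N `<=` P].
Proof.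
move=> /nbhs_nmP[e e0 eP]; exists (nball a e).
by split; [exact: convex_nball|exact: open_nball|exact: nball_center|].
Qed.

End Modulus.
Arguments nm {R V} v.
Arguments nball {R V} a e.

Section ComplexModulus.
Variable R : realType.
Local Notation cx := (R[i]^o).
Implicit Types x y z : cx.

Lemma nmM x y : nm (x * y : cx) = nm x * nm y.
Proof. by apply: (@complexI R); rewrite rmorphM /= !nmE normrM. Qed.

Lemma nm1 : nm (1 : cx) = 1.
Proof. by apply: (@complexI R); rewrite !nmE normr1. Qed.

Lemma nmX x n : nm (x ^+ n : cx) = nm x ^+ n.
Proof. by apply: (@complexI R); rewrite rmorphXn /= !nmE normrX. Qed.

Lemma nmV x : nm (x^-1 : cx) = (nm x)^-1.
Proof. by apply: (@complexI R); rewrite fmorphV /= !nmE normfV. Qed.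

Lemma nm_sqr x : nm x ^+ 2 = Re x ^+ 2 + Im x ^+ 2.
Proof. by apply: (@complexI R); rewrite rmorphXn /= !nmE add_Re2_Im2. Qed.

Lemma nm_real (t : R) : nm (t%:C%C : cx) = `|t|.
Proof. by have := nmZr t (1 : cx); rewrite nm1 mulr1 => <-; rewrite /GRing.scale/= mulr1. Qed.

Lemma nm_Re x : `|Re x| <= nm x.
Proof.
by rewrite -[leRHS]ger0_norm ?nm_ge0// -ler_sqr ?nnegrE// !real_normK ?num_real// nm_sqr lerDl sqr_ge0.
Qed.

Lemma nm_Im x : `|Im x| <= nm x.
Proof.
by rewrite -[leRHS]ger0_norm ?nm_ge0// -ler_sqr ?nnegrE// !real_normK ?num_real// nm_sqr lerDr sqr_ge0.
Qed.

Lemma nm_ReIm x : nm x <= `|Re x| + `|Im x|.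
Proof.
rewrite -ler_sqr ?nnegrE ?nm_ge0 ?addr_ge0// nm_sqr sqrrD !real_normK ?num_real//.
by rewrite addrAC lerDl mulrn_wge0 ?mulr_ge0.
Qed.

Lemma ReD x y : Re (x + y) = Re x + Re y. Proof. by case: x y => a b [c d]. Qed.
Lemma ImD x y : Im (x + y) = Im x + Im y. Proof. by case: x y => a b [c d]. Qed.
Lemma ReN x : Re (- x) = - Re x. Proof. by case: x. Qed.
Lemma ImN x : Im (- x) = - Im x. Proof. by case: x. Qed.
Lemma Re_seg x y t : Re (seg x y t) = (1 - t) * Re x + t * Re y.
Proof. by rewrite segE ReD; case: x y => a b [c d] /=; rewrite !mul0r !subr0. Qed.
Lemma Im_seg x y t : Im (seg x y t) = (1 - t) * Im x + t * Im y.
Proof. by rewrite segE ImD; case: x y => a b [c d] /=; rewrite !mul0r !addr0. Qed.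

Lemma nbhs_prodP (a : cx * cx) (P : set (cx * cx)) :
  nbhs a P <-> exists2 e : R, 0 < e &
    forall x y, nm (x - a.1) < e -> nm (y - a.2) < e -> P (x, y).
Proof.
split=> [[[A B]] /= [/nbhs_nmP[e e0 eA] /nbhs_nmP[f f0 fB]] ABP|[e e0 eP]].
  exists (Num.min e f) => [|x y]; first by rewrite lt_min e0.
  by rewrite !lt_min => /andP[xe _] /andP[_ yf]; apply: ABP; split => /=; [apply: eA|apply: fB].
exists (nball a.1 e, nball a.2 e) => /=; first by split; exact: nbhs_nball.
by move=> [x y] [/= ? ?]; apply: eP.
Qed.

End ComplexModulus.

(** * Local potentials of a cocycle on segments *)

(* Decides an identity between sums of booleans: the summands are first replaced
   by variables, on which it then reasons by cases. *)
Ltac xor_abstract a :=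
  lazymatch a with
  | true => fail | false => fail | addb _ _ => fail | negb _ => fail
  | _ => tryif is_var a then fail else (let v := fresh "v" in generalize a; intro v)
  end.
Ltac xor_case a := is_var a; case: (a).
Ltac xor_loop tac := repeat (match goal with
  | |- context [addb ?a ?b] => first [tac a | tac b]
  | |- context [negb ?a] => tac a
  | |- context [@eq bool ?a ?b] => first [tac a | tac b]
  end).
Ltac xor := cbv beta; xor_loop xor_abstract; xor_loop xor_case;
  intros; (reflexivity || discriminate).

Section LocallyConstant.
Variable R : realType.

(** The intermediate value theorem for the indicator function of [P]. *)
Lemma constant_on_unit_interval (P : R -> bool) :
    (forall t : R, 0 <= t <= 1 -> \forall s \near t, 0 <= s <= 1 -> P s = P t) ->
  P 0 = P 1.
Proof.
move=> lP; pose f t : R := (P (ival (clamp t)))%:R.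
have fc : continuous f.
  move=> t; apply: (@cvg_near_cst _ _ _ _ (nbhs t)).
  have c01 (s : R) : 0 <= ival (clamp s) <= 1 by rewrite ival_ge0 ival_le1.
  have := lP _ (c01 t); rewrite /prop_near1 => nP.
  have cc : {for t, continuous (fun s => ival (clamp s))}.
    by apply: continuous_comp; [exact: clamp_continuous|exact: ival_continuous].
  change (\forall x \near t, f x = f t).
  have h : \forall s \near t, 0 <= ival (clamp s) <= 1 ->
    P (ival (clamp s)) = P (ival (clamp t)) := cc _ nP.
  by apply: filterS h => s sP; rewrite /f sP.
have f0 : f 0 = (P 0)%:R by rewrite /f clampK// lexx ler01.
have f1 : f 1 = (P 1)%:R by rewrite /f clampK// lexx ler01.
apply/eqP/negP => /negP P01.
have [||c _] := @IVT R f 0 1 2^-1 ler01.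
- exact: continuous_subspaceT.
- rewrite f0 f1; move: P01; case: (P 0); case: (P 1) => //= _;
    rewrite /Num.min /Num.max; case: ifP; lra.
- by rewrite /f; case: (P _) => /= /eqP; lra.
Qed.

Variable V : normedModType R[i].
Implicit Types (S : set V) (phi : V -> bool).

Definition locally_constant S phi :=
  forall a, S a -> \forall z \near a, S z -> phi z = phi a.

(** Connectedness tested on boolean functions, which is all that the gluing of
    potentials needs. *)
Definition bool_connected S := forall phi, locally_constant S phi ->
  forall a b, S a -> S b -> phi a = phi b.

Lemma locally_constant_seg S phi a b : locally_constant S phi ->
  (forall t, 0 <= t <= 1 -> S (seg a b t)) -> phi a = phi b.
Proof.
move=> lS abS; rewrite -[in LHS](seg0 a b) -[in RHS](seg1 a b).
apply: (@constant_on_unit_interval (fun t => phi (seg a b t))) => t t01.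
have := lS _ (abS t t01); rewrite /prop_near1 => h.
have {}h : \forall s \near t, S (seg a b s) -> phi (seg a b s) = phi (seg a b t).
  exact: (@seg_continuous R V a b t _ h).
by apply: filterS h => s sS s01; apply/sS/abS.
Qed.

Lemma bool_connected_convex S : convex S -> bool_connected S.
Proof.
by move=> cS phi lS a b Sa Sb; apply: locally_constant_seg lS _ => t; exact: cS.
Qed.

End LocallyConstant.

Section Potential.
Variables (R : realType) (V : normedModType R[i]).
Implicit Types (S : set V) (W : V -> V -> bool) (Phi : V -> bool).

(** A [bool]-valued cochain on the segments of [O] that is closed on the
    triangles of [O]: the edge values of a class in the first cohomology with
    coefficients in Z/2. *)
Definition cocycle (O : set V) W := forall a b c,
  (forall s t, 0 <= s <= 1 -> 0 <= t <= 1 -> O (seg a (seg b c t) s)) ->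
  W a c = W a b (+) W b c.

(** Only nearby values are compared: on a set that is not simply connected, [W] on a
    long segment need not be the difference of the end values. *)
Definition potential W S Phi :=
  forall a, S a -> \forall z \near a, W z a = Phi z (+) Phi a.

Definition exact_on W S := exists Phi, potential W S Phi.

Lemma sub_potential W S S' Phi : S' `<=` S -> potential W S Phi -> potential W S' Phi.
Proof. by move=> sS p a /sS/p. Qed.

Lemma sub_exact W S S' : S' `<=` S -> exact_on W S -> exact_on W S'.
Proof. by move=> sS [Phi p]; exists Phi; apply: sub_potential p. Qed.

Lemma potential_diff W S Phi Psi : potential W S Phi -> potential W S Psi ->
  locally_constant S (fun z => Phi z (+) Psi z).
Proof.
move=> p q a Sa; near=> z => _.
have : W z a = Phi z (+) Phi a by near: z; exact: p.
have : W z a = Psi z (+) Psi a by near: z; exact: q.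
by xor.
Unshelve. all: by end_near. Qed.

Lemma potential_shift W S Phi k :
  potential W S Phi -> potential W S (fun z => Phi z (+) k).
Proof. by move=> p a /p; apply: filterS => z ->; xor. Qed.

Lemma exact_glue W S1 S2 Phi1 Phi2 k : open S1 -> open S2 ->
    potential W S1 Phi1 -> potential W S2 Phi2 ->
    (forall z, S1 z -> S2 z -> Phi1 z = Phi2 z (+) k) ->
  exact_on W (S1 `|` S2).
Proof.
move=> o1 o2 p1 p2 e12.
exists (fun z => if `[< S1 z >] then Phi1 z else Phi2 z (+) k) => a.
have [S1a _|S1a [//|S2a]] := pselect (S1 a).
  rewrite (asboolT S1a); near=> z; rewrite asboolT; first by near: z; exact: p1.
  by near: z; apply: open_nbhs_nbhs.
rewrite (asboolF S1a); near=> z.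
have -> : W z a = Phi2 z (+) Phi2 a by near: z; exact: p2.
have S2z : S2 z by near: z; apply: open_nbhs_nbhs.
have [S1z|S1z] := pselect (S1 z); last by rewrite (asboolF S1z); xor.
by rewrite (asboolT S1z) (e12 z S1z S2z); xor.
Unshelve. all: by end_near. Qed.

(** Two potentials differ by a locally constant function, hence by a constant on a
    connected overlap, and this constant can be absorbed. *)
Lemma exact_glue_connected W S1 S2 : open S1 -> open S2 ->
    exact_on W S1 -> exact_on W S2 -> bool_connected (S1 `&` S2) ->
  exact_on W (S1 `|` S2).
Proof.
move=> o1 o2 [Phi1 p1] [Phi2 p2] c12.
have [[c [S1c S2c]]|n] := pselect (exists c, S1 c /\ S2 c); last first.
  by apply: (exact_glue (k := false) o1 o2 p1 p2) => z S1z S2z; case: n; exists z.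
apply: (exact_glue (k := Phi1 c (+) Phi2 c) o1 o2 p1 p2) => z S1z S2z.
have l : locally_constant (S1 `&` S2) (fun z => Phi1 z (+) Phi2 z).
  by apply: potential_diff; [apply: sub_potential p1|apply: sub_potential p2];
     [exact: subIsetl|exact: subIsetr].
by have := c12 _ l z c (conj S1z S2z) (conj S1c S2c); xor.
Qed.

Section Closed.
Variables (O : set V) (W : V -> V -> bool).
Hypothesis cW : cocycle O W.

Lemma cocycle_convex S a b c : convex S -> S `<=` O -> S a -> S b -> S c ->
  W a c = W a b (+) W b c.
Proof.
move=> cS SO Sa Sb Sc; apply: cW => s t s01 t01.
by apply/SO; apply: (cS) => //; apply: (cS).
Qed.

(** Fix the far end point: the cocycle identity turns the local condition into the
    local constancy of a function on a convex set. *)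
Lemma potential_convex S Phi : convex S -> S `<=` O -> potential W S Phi ->
  forall a b, S a -> S b -> W a b = Phi a (+) Phi b.
Proof.
move=> cS SO p a b Sa Sb.
have tri := cocycle_convex cS SO.
have l : locally_constant S (fun z => W z b (+) Phi z).
  move=> c Sc; near=> z => Sz; rewrite (tri z c b)//.
  have -> : W z c = Phi z (+) Phi c by near: z; exact: p.
  by xor.
have /= := bool_connected_convex cS l Sa Sb.
have : W b b = W b b (+) W b b by apply: tri.
by xor.
Unshelve. all: by end_near. Qed.

(** The quadrilateral [z, z', w', w], cut along a diagonal. *)
Lemma cocycle_prism S z z' w w' : convex S -> S `<=` O ->
  S z -> S z' -> S w -> S w' -> W z w = W z z' (+) W z' w' (+) W w w'.
Proof.
move=> cS SO Sz Sz' Sw Sw'; have tri := cocycle_convex cS SO.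
have := tri _ _ _ Sz Sz' Sw; have := tri _ _ _ Sz' Sw' Sw.
by have := tri _ _ _ Sw Sw' Sw; have := tri _ _ _ Sw Sw Sw; xor.
Qed.

Lemma exact_convex S : convex S -> open S -> S `<=` O -> exact_on W S.
Proof.
move=> cS oS SO; have [[c Sc]|n] := pselect (exists c, S c); last first.
  by exists (fun=> false) => a Sa; case: n; exists a.
exists (fun z => W z c) => a Sa; near=> z.
have Sz : S z by near: z; apply: open_nbhs_nbhs.
by have := cocycle_convex cS SO Sz Sa Sc; xor.
Unshelve. all: by end_near. Qed.

End Closed.
End Potential.

(** * Exactness on punctured plane regions *)

Lemma small_avoiding (R : realType) (s : seq R) (e : R) : 0 < e ->
  exists m, [/\ 0 < m, m < e & m \notin s].
Proof.
move=> e0.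
have [m [m0 me ms]] : exists m, [/\ 0 < m, m < e & forall r, r \in s -> 0 < r -> m < r].
  elim: s => [|r s [m [m0 me ms]]]; first by exists (e / 2); split=> //; lra.
  have [r0|r0] := leP r 0.
    by exists m; split=> // r'; rewrite inE => /predU1P[->|/ms//]; lra.
  exists (Num.min m (r / 2)); split.
  - by rewrite lt_min m0; lra.
  - by rewrite gt_min me.
  - move=> r'; rewrite inE => /predU1P[->|/ms h /h mr]; rewrite gt_min ?mr//.
    by move=> _; apply/orP; right; lra.
by exists m; split=> //; apply/negP => /ms /(_ m0); rewrite ltxx.
Qed.

Section Plane.
Variable R : realType.
Local Notation cx := (R[i]^o).
Implicit Types (K : set cx) (p q : cx) (s : seq cx).

(** The real and the imaginary part and their opposites, treated alike. *)
Definition coordinate (l : cx -> R) :=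
  (forall a b t, l (seg a b t) = (1 - t) * l a + t * l b) /\
  (forall a b, `|l a - l b| <= nm (a - b : cx)).

Lemma coordinate_Re : coordinate Re.
Proof.
split=> [|a b]; first exact: Re_seg.
by rewrite -ReN -ReD nm_Re.
Qed.

Lemma coordinate_Im : coordinate Im.
Proof.
split=> [|a b]; first exact: Im_seg.
by rewrite -ImN -ImD nm_Im.
Qed.

Lemma coordinateN l : coordinate l -> coordinate (fun z => - l z).
Proof.
move=> [l1 l2]; split=> [a b t|a b]; first by rewrite l1 opprD !mulrN.
by rewrite -opprD normrN l2.
Qed.

Definition below (l : cx -> R) (c : R) : set cx := [set z | l z < c].
Definition above (l : cx -> R) (c : R) : set cx := [set z | c < l z].

Lemma convex_below l c : coordinate l -> convex (below l c).
Proof.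
move=> [l1 _] a b t; rewrite /below /= l1 => ac bc /andP[t0 t1].
have [t1'|t1'] := ltP t 1; nra.
Qed.

Lemma open_below l c : coordinate l -> open (below l c).
Proof.
move=> [_ l2]; rewrite openE => z zc; apply/nbhs_nmP; exists (c - l z).
  by rewrite subr_gt0.
move=> w /(le_lt_trans (l2 _ _)); rewrite /below /= ltr_norml => /andP[_]; lra.
Qed.

Lemma aboveN l c : above l c = below (fun z => - l z) (- c).
Proof. by apply/seteqP; split=> z; rewrite /above /below /= ltrN2. Qed.

Lemma convex_above l c : coordinate l -> convex (above l c).
Proof. by rewrite aboveN => /coordinateN; exact: convex_below. Qed.

Lemma open_above l c : coordinate l -> open (above l c).
Proof. by rewrite aboveN => /coordinateN; exact: open_below. Qed.

Definition puncture K s : set cx := [set z | K z /\ z \notin s].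

Lemma open_puncture K s : open K -> open (puncture K s).
Proof.
rewrite !openE => oK z [Kz zs].
have : nbhs z [set w | w \notin s].
  elim: s zs => [|p s IH]; first by move=> _; apply/nbhs_nmP; exists 1.
  rewrite inE negb_or => /andP[zp /IH].
  have : nbhs z (nball z (nm (p - z : cx))).
    by apply: nbhs_nball; rewrite nm_gt0 subr_eq0 eq_sym.
  apply: filterS2 => w wp ws; rewrite /= inE negb_or ws andbT; apply/eqP => wpE.
  by move: wp; rewrite /nball /= wpE ltxx.
by apply: filterS2 (oK _ Kz) => w.
Qed.

(** Two points of [K] off the finite set are joined by a broken line with one
    corner on their bisector: each puncture rules out at most one corner for each of the
    two segments. *)
Lemma puncture_connected K s : convex K -> open K -> bool_connected (puncture K s).
Proof.
move=> cK oK phi lphi a b [Ka a_s] [Kb bs].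
have [->//|ab] := eqVneq a b.
have ba0 : b - a != 0 by rewrite subr_eq0 eq_sym.
have ab0 : a - b != 0 by rewrite subr_eq0.
(* [c m] runs along the bisector of [a] and [b]. *)
pose c (m : R) : cx := a + (b - a) * (2^-1 +i* m)%C.
have cE m : c m = b + (a - b) * (2^-1 +i* (- m))%C.
  have -> : (2^-1 +i* (- m))%C = 1 - (2^-1 +i* m)%C :> R[i].
    by apply/eqP; rewrite eq_complex /=; apply/andP; split; apply/eqP; lra.
  by rewrite /c; ring.
have [e e0 eK] : exists2 e : R, 0 < e & forall m, 0 < m < e -> K (c m).
  have Kc : K (c 0).
    have -> : c 0 = seg a b 2^-1 by rewrite /c /seg mulrC.
    by apply: cK => //; lra.
  move: oK; rewrite openE => /(_ _ Kc)/nbhs_nmP[e e0 eK].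
  exists (e / nm (b - a : cx)); first by rewrite divr_gt0 ?nm_gt0.
  move=> m /andP[m0]; rewrite ltr_pdivlMr ?nm_gt0// => me; apply: eK.
  rewrite /c opprD addrACA subrr add0r -mulrBr nmM mulrC.
  have -> : (2^-1 +i* m)%C - (2^-1 +i* 0)%C = m%:C%C * 'i%C :> R[i].
    by apply/eqP; rewrite eq_complex /=; apply/andP; split; apply/eqP; lra.
  rewrite (nmM m%:C%C) nm_real (gtr0_norm m0).
  suff -> : nm ('i%C : cx) = 1 by rewrite mulr1.
  by apply/eqP; rewrite -sqrp_eq1 ?nm_ge0// nm_sqr /= expr0n expr1n add0r.
(* Seen from [a] in the frame [b - a], the direction of [c m] has slope [2 m]; a puncture
   lies in this direction for one value of [m] only.  The same holds seen from [b]. *)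
pose bad1 p := Im ((p - a) / (b - a)) / (2 * Re ((p - a) / (b - a))).
pose bad2 p := - Im ((p - b) / (a - b)) / (2 * Re ((p - b) / (a - b))).
have [m [m0 me ms]] := small_avoiding (map bad1 s ++ map bad2 s) e0.
have Kc : K (c m) by apply: eK; rewrite m0.
move: ms; rewrite mem_cat negb_or => /andP[ms1 ms2].
have ac t : 0 <= t <= 1 -> puncture K s (seg a (c m) t).
  move=> t01; split; first exact: cK.
  apply/negP => ps; move/negP: ms1; apply; apply/mapP; exists (seg a (c m) t) => //.
  have t0 : t != 0 by apply: contraNneq a_s => t0; move: ps; rewrite t0 seg0.
  rewrite /bad1 /seg /c (addrC a (_ * _)) addrK (addrC a) addrK /GRing.scale /=.
  rewrite (mulrC (b - a)) mulrA mulfK//= !mul0r subr0 addr0.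
  by field.
have bc t : 0 <= t <= 1 -> puncture K s (seg b (c m) t).
  move=> t01; split; first exact: cK.
  apply/negP => ps; move/negP: ms2; apply; apply/mapP; exists (seg b (c m) t) => //.
  have t0 : t != 0 by apply: contraNneq bs => t0; move: ps; rewrite t0 seg0.
  rewrite /bad2 /seg cE (addrC b (_ * _)) addrK (addrC b) addrK /GRing.scale /=.
  rewrite (mulrC (a - b)) mulrA mulfK//= !mul0r subr0 addr0.
  by field.
by rewrite (locally_constant_seg lphi ac) (locally_constant_seg lphi bc).
Qed.

Definition punctured_ball p (e : R) : set cx := puncture (nball p e) [:: p].

Section Exactness.
Variables (O : set cx) (W : cx -> cx -> bool).
Hypothesis cW : cocycle O W.

(** The sum around a quadrilateral with one vertex in each quadrant at [p] is the
    only obstruction: left, upper and right half planes glue along quadrants, and the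
    lower half plane meets their union in two quadrants, over which the two
    potentials differ by constants whose sum is that obstruction. *)
Lemma exact_puncture1 K p (q1 q2 q3 q4 : cx) : convex K -> open K ->
    puncture K [:: p] `<=` O ->
    (K `&` (above Re (Re p) `&` above Im (Im p))) q1 ->
    (K `&` (below Re (Re p) `&` above Im (Im p))) q2 ->
    (K `&` (below Re (Re p) `&` below Im (Im p))) q3 ->
    (K `&` (above Re (Re p) `&` below Im (Im p))) q4 ->
  W q1 q2 (+) W q2 q3 (+) W q3 q4 (+) W q4 q1 = false <->
  exact_on W (puncture K [:: p]).
Proof.
move=> cK oK KO [Kq1 [q1r q1i]] [Kq2 [q2r q2i]] [Kq3 [q3r q3i]] [Kq4 [q4r q4i]].
have [cr ci] := (coordinate_Re, coordinate_Im).
pose L := K `&` below Re (Re p); pose T := K `&` above Im (Im p).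
pose G := K `&` above Re (Re p); pose D := K `&` below Im (Im p).
have cL : convex L by apply: convexI => //; exact: convex_below.
have cT : convex T by apply: convexI => //; exact: convex_above.
have cG : convex G by apply: convexI => //; exact: convex_above.
have cD : convex D by apply: convexI => //; exact: convex_below.
have oL : open L by apply: openI => //; exact: open_below.
have oT : open T by apply: openI => //; exact: open_above.
have oG : open G by apply: openI => //; exact: open_above.
have oD : open D by apply: openI => //; exact: open_below.
have neq z : z <> p -> z \notin [:: p] by rewrite inE => /eqP.
have PL : L `<=` puncture K [:: p].
  by move=> z [Kz zp]; split=> //; apply: neq => e; move: zp; rewrite /below /= e ltxx.
have PT : T `<=` puncture K [:: p].
  by move=> z [Kz zp]; split=> //; apply: neq => e; move: zp; rewrite /above /= e ltxx.
have PG : G `<=` puncture K [:: p].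
  by move=> z [Kz zp]; split=> //; apply: neq => e; move: zp; rewrite /above /= e ltxx.
have PD : D `<=` puncture K [:: p].
  by move=> z [Kz zp]; split=> //; apply: neq => e; move: zp; rewrite /below /= e ltxx.
have sumE S Phi a b : convex S -> S `<=` puncture K [:: p] -> potential W S Phi ->
    S a -> S b -> W a b = Phi a (+) Phi b.
  by move=> cS SP pS; apply: (potential_convex cW cS _ pS) => z /SP/KO.
split=> [sum0|[Phi pPhi]]; last first.
  have h S a b : convex S -> S `<=` puncture K [:: p] -> S a -> S b ->
      W a b = Phi a (+) Phi b.
    by move=> cS SP; apply: (sumE S Phi) => //; exact: sub_potential pPhi.
  rewrite (h T q1 q2)// (h L q2 q3)// (h D q3 q4)// (h G q4 q1)//.
  by xor.
have ex S : convex S -> open S -> S `<=` puncture K [:: p] -> exact_on W S.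
  by move=> cS oS SP; apply: (exact_convex cW) => // z /SP/KO.
have e1 : exact_on W (T `|` L).
  apply: exact_glue_connected => //; [exact: ex|exact: ex|].
  by apply: bool_connected_convex; exact: convexI.
have [Phi pPhi] : exact_on W (T `|` L `|` G).
  apply: exact_glue_connected => //; [exact: openU|exact: ex|].
  have -> : (T `|` L) `&` G = T `&` G.
    apply/seteqP; split=> z [zTL zG]; last by split=> //; left.
    split=> //; case: zTL => // -[_ zL]; case: zG => _ zG.
    by move: (lt_trans zL zG); rewrite ltxx.
  by apply: bool_connected_convex; exact: convexI.
have [Psi pPsi] := ex D cD oD PD.
have pT : potential W T Phi by apply: sub_potential pPhi => z; left; left.
have pL : potential W L Phi by apply: sub_potential pPhi => z; left; right.
have pG : potential W G Phi by apply: sub_potential pPhi => z; right.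
have e : exact_on W ((T `|` L `|` G) `|` D).
  apply: (exact_glue (k := Phi q3 (+) Psi q3) _ oD pPhi pPsi).
    by apply: openU => //; exact: openU.
  have cst S a b : convex S -> potential W S Phi -> potential W S Psi ->
      S a -> S b -> Phi a (+) Psi a = Phi b (+) Psi b.
    by move=> cS p1 p2; exact: (bool_connected_convex cS (potential_diff p1 p2)).
  have DL z : L z -> D z -> Phi z (+) Psi z = Phi q3 (+) Psi q3.
    move=> Lz Dz; apply: (cst (L `&` D)) => //; first exact: convexI.
      by apply: sub_potential pL; exact: subIsetl.
    by apply: sub_potential pPsi; exact: subIsetr.
  have DG z : G z -> D z -> Phi z (+) Psi z = Phi q4 (+) Psi q4.
    move=> Gz Dz; apply: (cst (G `&` D)) => //; first exact: convexI.
      by apply: sub_potential pG; exact: subIsetl.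
    by apply: sub_potential pPsi; exact: subIsetr.
  move=> z [[Tz Dz|Lz Dz]|Gz Dz].
  - by case: Tz => _ zT; case: Dz => _ zD; move: (lt_trans zT zD); rewrite ltxx.
  - by have := DL z Lz Dz; xor.
  - have := DG z Gz Dz; move: sum0.
    rewrite (sumE T Phi q1 q2)// (sumE L Phi q2 q3)// (sumE D Psi q3 q4)//.
    by rewrite (sumE G Phi q4 q1)//; xor.
apply: sub_exact e => z [Kz]; rewrite inE => zp.
have [|zr|zr] := ltgtP (Re z) (Re p); [by left; left; right|by left; right|].
have [|zi|zi] := ltgtP (Im z) (Im p); [by right|by left; left; left|].
by move: zp; rewrite eq_complex zr zi !eqxx.
Qed.

(** Induction on the number of punctures: cut along a strip between two of them, which
    contains no puncture and over which the two pieces overlap in a convex set. *)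
Lemma exact_puncture K s : convex K -> open K -> puncture K s `<=` O ->
    (forall p, p \in s -> K p ->
      exists2 e : R, 0 < e & exact_on W (punctured_ball p e)) ->
  exact_on W (puncture K s).
Proof.
have [n] := ubnP (size s); elim: n => // n IH in K s * => sn cK oK KO loc.
have [[p [ps Kp]]|none] := pselect (exists p, p \in s /\ K p); last first.
  apply: (sub_exact (S := K)) => [z []//|]; apply: (exact_convex cW) => // z Kz.
  by apply: KO; split=> //; apply/negP => zs; case: none; exists z.
have [[q [qs Kq qp]]|one] := pselect (exists q, [/\ q \in s, K q & q <> p]); last first.
  have -> : puncture K s = puncture K [:: p].
    apply/seteqP; split=> z [Kz zs]; split=> //.
      by rewrite inE; apply: contraNneq zs => ->.
    apply/negP => zs'; move: zs; rewrite inE => /eqP zp.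
    by apply: one; exists z.
  have KO1 : puncture K [:: p] `<=` O.
    move=> z [Kz zp]; apply: KO; split=> //; apply/negP => zs'.
    by move: zp; rewrite inE => /eqP zp; apply: one; exists z.
  have [e e0 [Phi pPhi]] := loc p ps Kp.
  have /nbhs_nmP[f f0 fK] : nbhs p (K `&` nball p e).
    by apply: filterI; [apply: open_nbhs_nbhs|exact: nbhs_nball].
  have bK : nball p f `<=` K by move=> z /fK[].
  (* The same quadrilateral decides exactness in [K] and in a small disc. *)
  pose c (x y : R) : cx := p + (x +i* y)%C.
  have cB x y : `|x| = f / 4 -> `|y| = f / 4 -> nball p f (c x y).
    move=> xf yf; rewrite /nball /c /= (addrC p) addrK.
    by apply: le_lt_trans (nm_ReIm _) _; rewrite /= xf yf; lra.
  have f4 : `|f / 4| = f / 4 by rewrite ger0_norm; lra.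
  have f4N : `|- (f / 4)| = f / 4 by rewrite normrN.
  have := (cB _ _ f4 f4, cB _ _ f4N f4, cB _ _ f4N f4N, cB _ _ f4 f4N).
  move=> [[[b1 b2] b3] b4].
  have side (S : set cx) x y : nball p f `<=` S -> nball p f (c x y) -> S (c x y) by move=> h /h.
  apply/(@exact_puncture1 K p (c (f / 4) (f / 4)) (c (- (f / 4)) (f / 4))
    (c (- (f / 4)) (- (f / 4))) (c (f / 4) (- (f / 4)))) => //; rewrite ?/setI /=;
    do ?(by split; [exact: (side K)|rewrite /above /below /= /c ?ReD ?ImD /=; split; lra]).
  have O1 : puncture (nball p f) [:: p] `<=` O by move=> z [/bK Kz zp]; apply: KO1.
  apply/(exact_puncture1 (@convex_nball _ _ _ _) (@open_nball _ _ _ _) O1) => //;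
    rewrite ?/setI /=;
    do ?(by split; [|rewrite /above /below /= /c ?ReD ?ImD /=; split; lra]).
  exists Phi; apply: sub_potential pPhi => z [zf zp]; split=> //.
  by have [] := fK z zf.
(* Two distinct punctures differ in one of the two coordinates. *)
have [l [cl [p' [q' [p's q's Kp' Kq' pq]]]]] : exists l, coordinate l /\
    exists p' q', [/\ p' \in s, q' \in s, K p', K q' & l p' < l q'].
  have [pq|pq|rpq] := ltgtP (Re p) (Re q).
  - by exists Re; split; [exact: coordinate_Re|exists p, q].
  - by exists Re; split; [exact: coordinate_Re|exists q, p].
  exists Im; split; first exact: coordinate_Im.
  have [pq|pq|ipq] := ltgtP (Im p) (Im q); [by exists p, q|by exists q, p|].
  by case: qp; apply/eqP; rewrite eq_complex rpq ipq !eqxx.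
(* [r] is next to [p'] in this coordinate, so the strip between them has no puncture. *)
have [r [rs pr rmin]] : exists r, [/\ r \in s, l p' < l r &
    forall r', r' \in s -> l p' < l r' -> l r <= l r'].
  have : has (fun r => l p' < l r) s by apply/hasP; exists q'.
  elim: (s) => [//|x t IHt] /=.
  case: (boolP (has (fun r => l p' < l r) t)) => [/IHt[r [rt pr rmin]] _|none].
    have [px|px] := ltP (l p') (l x); last first.
      exists r; split=> //; first by rewrite inE rt orbT.
      by move=> r'; rewrite inE => /predU1P[->|/rmin//]; rewrite ltNge px.
    have [xr|rx] := leP (l x) (l r).
      exists x; split=> //; first by rewrite inE eqxx.
      by move=> r'; rewrite inE => /predU1P[->//|/rmin h /h]; exact: le_trans.
    exists r; split=> //; first by rewrite inE rt orbT.
    by move=> r'; rewrite inE => /predU1P[->|/rmin//]; rewrite ltW.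
  rewrite orbF => px; exists x; split=> //; first by rewrite inE eqxx.
  move=> r'; rewrite inE => /predU1P[->//|r't pr'].
  by case/hasP: none; exists r'.
pose s1 := seq.filter (fun z => l z < l r) s; pose s2 := seq.filter (fun z => l p' < l z) s.
pose K1 := K `&` below l (l r); pose K2 := K `&` above l (l p').
have filt (a : pred cx) x : x \in s -> ~~ a x -> (size (seq.filter a s) < n)%N.
  move=> xs ax; apply: leq_trans (_ : (size s <= n)%N) => //.
  rewrite size_filter -(count_predC a s) -[X in (X < _)%N]addn0 ltn_add2l -has_count.
  by apply/hasP; exists x.
have P1 : puncture K1 s1 = K1 `&` puncture K s.
  apply/seteqP; split=> z [].
    move=> [Kz zr] zs; do 2?split=> //.
    by move: zs; rewrite mem_filter negb_and zr.
  by move=> [Kz zr] [_ zs]; do 2?split=> //; rewrite mem_filter negb_and zs orbT.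
have P2 : puncture K2 s2 = K2 `&` puncture K s.
  apply/seteqP; split=> z [].
    move=> [Kz zr] zs; do 2?split=> //.
    by move: zs; rewrite mem_filter negb_and zr.
  by move=> [Kz zr] [_ zs]; do 2?split=> //; rewrite mem_filter negb_and zs orbT.
have cK1 : convex K1 by apply: convexI => //; exact: convex_below.
have cK2 : convex K2 by apply: convexI => //; exact: convex_above.
have oK1 : open K1 by apply: openI => //; exact: open_below.
have oK2 : open K2 by apply: openI => //; exact: open_above.
have e1 : exact_on W (puncture K1 s1).
  apply: IH => //; first by apply: (filt _ r) => //; rewrite ltxx.
    by rewrite P1 => z [_ /KO].
  by move=> x; rewrite mem_filter => /andP[_ xs] [Kx _]; exact: loc.
have e2 : exact_on W (puncture K2 s2).
  apply: IH => //; first by apply: (filt _ p') => //; rewrite ltxx.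
    by rewrite P2 => z [_ /KO].
  by move=> x; rewrite mem_filter => /andP[_ xs] [Kx _]; exact: loc.
have : exact_on W (puncture K1 s1 `|` puncture K2 s2).
  apply: exact_glue_connected => //; [exact: open_puncture|exact: open_puncture|].
  have -> : puncture K1 s1 `&` puncture K2 s2 = K1 `&` K2.
    rewrite P1 P2; apply/seteqP; split=> z; first by case=> -[? _] [? _].
    move=> [K1z K2z]; have zs : puncture K s z; last by split.
    split; first by case: K1z.
    apply/negP => zs; case: K1z K2z => _ zr [_ /(rmin _ zs)].
    by rewrite leNgt zr.
  by apply: bool_connected_convex; exact: convexI.
apply: sub_exact => z [Kz zs].
have [zr|rz] := ltP (l z) (l r); first by left; rewrite P1.
by right; rewrite P2; split=> //; split=> //; exact: lt_le_trans pr rz.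
Qed.

End Exactness.
End Plane.

(** * Families of monic cubics and their roots *)

(* Evaluation of a polynomial expression, leaving the products as they are. *)
Ltac horner_eval := rewrite ?(hornerD, hornerN, hornerM, hornerZ, horner_exp,
  hornerC, hornerX, hornerXn).

Section PolynomialEstimates.
Variable R : realType.
Local Notation cx := (R[i]^o).
Implicit Types (p : {poly R[i]}) (x : cx).

Lemma poly_growth p : exists2 A : R, 0 < A &
  exists n : nat, forall x, nm (p.[x] : cx) <= A * (1 + nm x) ^+ n.
Proof.
elim/poly_ind: p => [|p c [A A0 [n pA]]].
  by exists 1 => //; exists 0 => x; rewrite horner0 nm0 mulr1 ler01.
exists (A + nm (c : cx)); first by rewrite ltr_wpDr ?nm_ge0.
exists n.+1 => x; rewrite hornerMXaddC; apply: le_trans (nmD _ _) _.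
have x1 : 1 <= 1 + nm x by rewrite lerDl nm_ge0.
rewrite mulrDl lerD//; last by rewrite ler_peMr ?nm_ge0 ?exprn_ege1.
rewrite nmM exprSr mulrA ler_pM ?nm_ge0// lerDr ler01 //.
Qed.

Lemma poly_local p x0 (e : R) : 0 < e -> exists2 d : R, 0 < d &
  forall x, nm (x - x0) < d -> nm (p.[x] - p.[x0] : cx) < e.
Proof.
move=> e0; have [q pq] : exists q : {poly R[i]}, p - p.[x0]%:P = q * ('X - x0%:P).
  by apply/factor_theorem; rewrite /root !hornerE subrr.
have [A A0 [n qA]] := poly_growth q.
have M0 : 0 < A * (1 + (nm x0 + 1)) ^+ n.
  by rewrite mulr_gt0// exprn_gt0// ltr_wpDr// addr_ge0 ?nm_ge0.
exists (Num.min 1 (e / (A * (1 + (nm x0 + 1)) ^+ n))).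
  by rewrite lt_min ltr01 divr_gt0.
move=> x; rewrite lt_min => /andP[x1]; rewrite ltr_pdivlMr// => xe.
have -> : p.[x] - p.[x0] = q.[x] * (x - x0).
  by have := congr1 (horner^~ x) pq; rewrite !hornerE.
rewrite nmM mulrC; apply: le_lt_trans xe; rewrite ler_wpM2l ?nm_ge0//.
apply: le_trans (qA x) _; rewrite (ler_wpM2l (ltW A0))// lerXn2r ?nnegrE ?addr_ge0 ?nm_ge0//.
rewrite lerD2l -[x](subrK x0); apply: le_trans (nmD _ _) _.
by rewrite addrC lerD2l ltW.
Qed.

End PolynomialEstimates.

Section Cubic.
Variable R : realType.
Local Notation cx := (R[i]^o).
Variables a b c : {poly R[i]}.
Implicit Types x y p q : cx.

Definition cubic x y : cx := y ^+ 3 + a.[x] * y ^+ 2 + b.[x] * y + c.[x].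

Definition roots3 x p1 p2 p3 :=
  forall y, cubic x y = (y - p1) * (y - p2) * (y - p3).

Definition distinct3 p1 p2 p3 := [&& p1 != p2, p2 != p3 & p1 != p3].

Lemma roots3_exists x : exists p1 p2 p3, roots3 x p1 p2 p3.
Proof.
pose P : {poly R[i]} := 'X^3 + a.[x] *: 'X^2 + b.[x] *: 'X + c.[x]%:P.
have sl : (size (a.[x] *: 'X^2 + b.[x] *: 'X + c.[x]%:P)%R <= 3)%N.
  apply: leq_trans (size_polyD _ _) _; rewrite geq_max.
  rewrite (leq_trans (size_polyC_leq1 _))// andbT.
  apply: leq_trans (size_polyD _ _) _; rewrite geq_max.
  by rewrite !(leq_trans (size_scale_leq _ _)) ?size_polyXn ?size_polyX.
have PE : P = 'X^3 + (a.[x] *: 'X^2 + b.[x] *: 'X + c.[x]%:P) by rewrite /P !addrA.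
have sP : size P = 4 by rewrite PE size_polyDl size_polyXn.
have lP : lead_coef P = 1 by rewrite PE lead_coefDl ?size_polyXn// lead_coefXn.
have [r] := closed_field_poly_normal P; rewrite lP scale1r => Pr.
have := sP; rewrite Pr size_prod_XsubC => -[].
case: r Pr => [|p1 [|p2 [|p3 [|]]]]//= Pr _; exists p1, p2, p3 => y.
have := congr1 (horner^~ y) Pr; rewrite !big_cons big_nil /P; horner_eval; rewrite /cubic => ->; by ring.
Qed.

Lemma roots3_rot x p1 p2 p3 : roots3 x p1 p2 p3 -> roots3 x p2 p3 p1.
Proof. by move=> h y; rewrite h; ring. Qed.

Lemma distinct3_rot p1 p2 p3 : distinct3 p1 p2 p3 -> distinct3 p2 p3 p1.
Proof. by move=> /and3P[h1 h2 h3]; rewrite /distinct3 h2 eq_sym h3 eq_sym h1. Qed.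

Lemma roots3_eq0 x p1 p2 p3 p : roots3 x p1 p2 p3 ->
  cubic x p = 0 <-> [\/ p = p1, p = p2 | p = p3].
Proof.
move=> ->; split=> [/eqP|]; last by case=> ->; rewrite subrr ?(mulr0, mul0r).
rewrite !mulf_eq0 -orbA !subr_eq0 => /or3P[]/eqP; by constructor.
Qed.

Lemma roots3_coef x p1 p2 p3 : roots3 x p1 p2 p3 ->
  [/\ a.[x] = - (p1 + p2 + p3), b.[x] = p1 * p2 + p2 * p3 + p1 * p3 &
      c.[x] = - (p1 * p2 * p3)].
Proof.
move=> h; move: (h 0) (h 1) (h (-1)); rewrite /cubic => h0 h1 h2.
have cE : c.[x] = - (p1 * p2 * p3).
  by transitivity ((0 : cx) ^+ 3 + a.[x] * 0 ^+ 2 + b.[x] * 0 + c.[x]); [ring|rewrite h0; ring].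
have two : (2 : R[i]) != 0 by rewrite pnatr_eq0.
have bE : b.[x] = p1 * p2 + p2 * p3 + p1 * p3.
  apply: (mulfI two).
  transitivity (((1 : cx) ^+ 3 + a.[x] * 1 ^+ 2 + b.[x] * 1 + c.[x]) -
    ((-1 : cx) ^+ 3 + a.[x] * (-1) ^+ 2 + b.[x] * (-1) + c.[x]) - 2); first by ring.
  by rewrite h1 h2; ring.
split=> //.
transitivity (((1 : cx) ^+ 3 + a.[x] * 1 ^+ 2 + b.[x] * 1 + c.[x]) - 1 - b.[x] - c.[x]).
  by ring.
by rewrite h1 bE cE; ring.
Qed.

Lemma roots3_of_roots x q1 q2 q3 : distinct3 q1 q2 q3 ->
  cubic x q1 = 0 -> cubic x q2 = 0 -> cubic x q3 = 0 -> roots3 x q1 q2 q3.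
Proof.
move=> /and3P[/eqP d1 /eqP d2 /eqP d3] + + + y.
have [p1 [p2 [p3 h]]] := roots3_exists x.
move=> /(roots3_eq0 _ h) z1 /(roots3_eq0 _ h) z2 /(roots3_eq0 _ h) z3; rewrite h.
case: z1 => e1; case: z2 => e2; case: z3 => e3; subst => //; by ring.
Qed.

Lemma roots3_sum (g : cx -> nat) x p1 p2 p3 q1 q2 q3 :
  roots3 x p1 p2 p3 -> roots3 x q1 q2 q3 -> distinct3 q1 q2 q3 ->
  (g p1 + g p2 + g p3 = g q1 + g q2 + g q3)%N.
Proof.
move=> hp hq /and3P[/eqP d1 /eqP d2 /eqP d3].
have mem q : [\/ q = q1, q = q2 | q = q3] -> [\/ q = p1, q = p2 | q = p3].
  by move=> /(roots3_eq0 _ hq)/(roots3_eq0 _ hp).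
have := mem q1 (Or31 _ _ erefl); have := mem q2 (Or32 _ _ erefl).
have := mem q3 (Or33 _ _ erefl).
by case=> e1; case=> e2; case=> e3; subst => //; lia.
Qed.

Definition disc : {poly R[i]} :=
  a ^+ 2 * b ^+ 2 - 4 *: b ^+ 3 - 4 *: (a ^+ 3 * c) - 27 *: c ^+ 2 + 18 *: (a * b * c).

Lemma discE x p1 p2 p3 : roots3 x p1 p2 p3 ->
  disc.[x] = ((p1 - p2) * (p2 - p3) * (p1 - p3)) ^+ 2.
Proof. move=> /roots3_coef[ha hb hc]; rewrite /disc; horner_eval.
by rewrite ha hb hc; ring. Qed.

Lemma disc_distinct3 x p1 p2 p3 : roots3 x p1 p2 p3 ->
  (disc.[x] != 0) = distinct3 p1 p2 p3.
Proof.
move=> /discE ->; rewrite expf_eq0 /= !mulf_eq0 !negb_or !subr_eq0 /distinct3.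
by rewrite andbA.
Qed.

Lemma cubic_root_bound x p : cubic x p = 0 ->
  nm p <= 1 + nm (a.[x] : cx) + nm (b.[x] : cx) + nm (c.[x] : cx).
Proof.
move=> p0; have [p1|p1] := leP (nm p) 1.
  by rewrite -!addrA; apply: le_trans p1 _; rewrite lerDl !addr_ge0 ?nm_ge0.
suff h : nm p <= nm (a.[x] : cx) + nm (b.[x] : cx) + nm (c.[x] : cx).
  by apply: le_trans h _; rewrite -!addrA lerDr.
have pp : 0 < nm p ^+ 2 by rewrite exprn_gt0// (lt_trans _ p1).
rewrite -(ler_pM2r pp) -exprS -!nmX.
have -> : (p ^+ 3 : cx) = - (a.[x] * p ^+ 2 + b.[x] * p + c.[x]).
  by apply/eqP; rewrite -addr_eq0 !addrA; apply/eqP.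
rewrite nmN; apply: le_trans (nmD _ _) _; rewrite mulrDl.
have p1' := ltW p1.
apply: lerD; last by rewrite nmX ler_peMr ?nm_ge0// exprn_ege1.
apply: le_trans (nmD _ _) _; rewrite mulrDl (nmM a.[x]) (nmM b.[x]) lerD2l.
by rewrite ler_wpM2l ?nm_ge0// nmX ler_eXnr.
Qed.

(** Roots depend continuously on the parameter: the value of the cubic at an old
    root is the product of its distances to the new ones. *)
Lemma root_near x0 p (d : R) : 0 < d -> cubic x0 p = 0 ->
  exists2 e : R, 0 < e &
    forall x, nm (x - x0) < e -> exists2 q, cubic x q = 0 & nm (q - p) < d.
Proof.
move=> d0 p0; pose g : {poly R[i]} := (p ^+ 3)%:P + p ^+ 2 *: a + p *: b + c.
have gE x : g.[x] = cubic x p by rewrite /g /cubic; horner_eval; ring.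
have [e e0 eP] := @poly_local R g x0 (d ^+ 3) (exprn_gt0 _ d0).
exists e => // x /eP; rewrite !gE p0 subr0 => small.
apply: contrapT => far.
have {}far q : cubic x q = 0 -> d <= nm (p - q).
  by move=> q0; rewrite leNgt; apply/negP => qp; apply: far; exists q; rewrite // nmBC.
have [q1 [q2 [q3 h]]] := roots3_exists x.
move: small; rewrite h !nmM ltNge => /negP; apply; rewrite !exprSr expr0 mul1r.
have r q : [\/ q = q1, q = q2 | q = q3] -> d <= nm (p - q).
  by move=> /(roots3_eq0 _ h)/far.
have d' := ltW d0.
rewrite !ler_pM ?mulr_ge0//; apply: r; by [constructor 1|constructor 2|constructor 3].
Qed.

Lemma roots3_near x0 p1 p2 p3 (d : R) : 0 < d -> roots3 x0 p1 p2 p3 ->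
    distinct3 p1 p2 p3 ->
  exists2 e : R, 0 < e & forall x, nm (x - x0) < e -> exists q1 q2 q3,
    [/\ roots3 x q1 q2 q3, distinct3 q1 q2 q3, nm (q1 - p1) < d, nm (q2 - p2) < d &
        nm (q3 - p3) < d].
Proof.
move=> d0 h /and3P[n12 n23 n13].
pose r := Num.min d (Num.min (nm (p1 - p2)) (Num.min (nm (p2 - p3)) (nm (p1 - p3))) / 2).
have r0 : 0 < r by rewrite lt_min d0 divr_gt0// !lt_min !nm_gt0 !subr_eq0 n12 n23.
have rd : r <= d by rewrite ge_min lexx.
have rm : 2 * r <= Num.min (nm (p1 - p2)) (Num.min (nm (p2 - p3)) (nm (p1 - p3))).
  by rewrite mulrC -ler_pdivlMr// /r ge_min lexx orbT.
move: rm; rewrite !le_min => /and3P[r12 r23 r13].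
have rt p : [\/ p = p1, p = p2 | p = p3] -> cubic x0 p = 0 by move/(roots3_eq0 _ h).
have [e1 e10 E1] := root_near r0 (rt p1 (Or31 _ _ erefl)).
have [e2 e20 E2] := root_near r0 (rt p2 (Or32 _ _ erefl)).
have [e3 e30 E3] := root_near r0 (rt p3 (Or33 _ _ erefl)).
exists (Num.min e1 (Num.min e2 e3)); first by rewrite !lt_min e10 e20.
move=> x; rewrite !lt_min => /and3P[/E1[q1 z1 c1] /E2[q2 z2 c2] /E3[q3 z3 c3]].
have neq p p' q q' : 2 * r <= nm (p - p') -> nm (q - p) < r -> nm (q' - p') < r -> q != q'.
  move=> pp qp; apply: contraTneq => <-; rewrite -leNgt.
  have := nm_tri p q p'; rewrite (nmBC p q); lra.
have D : distinct3 q1 q2 q3.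
  by rewrite /distinct3 (neq p1 p2)// (neq p2 p3)// (neq p1 p3).
exists q1, q2, q3; split=> //; [exact: roots3_of_roots|..];
  by [apply: lt_le_trans c1 rd|apply: lt_le_trans c2 rd|apply: lt_le_trans c3 rd].
Qed.

End Cubic.

(** * Meridians of a cocycle on the complement of the curve *)

Section Products.
Variable R : realType.
Local Notation cx := (R[i]^o).
Implicit Types (A B : set cx).

Lemma seg_pair (x x' y y' : cx) t :
  seg ((x, y) : cx * cx) (x', y') t = (seg x x' t, seg y y' t).
Proof. by []. Qed.

Lemma convexX A B : convex A -> convex B -> convex (A `*` B).
Proof. by move=> cA cB z w t [? ?] [? ?] t01; split; [apply: cA|apply: cB]. Qed.

Lemma openX A B : open A -> open B -> open (A `*` B).
Proof.
rewrite !openE => oA oB [x y] [/= /oA nA /oB nB].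
by exists (A, B).
Qed.

Lemma nbhs_fst (z : cx * cx) A : nbhs z.1 A -> nbhs z [set w | A w.1].
Proof. by move=> nA; exact: (@cvg_fst _ _ (nbhs z.1) (nbhs z.2) _ A nA). Qed.

Lemma nbhs_pair (x y : cx) (P : set (cx * cx)) : nbhs (x, y) P ->
  (\forall y' \near y, P (x, y')) /\ (\forall x' \near x, P (x', y)).
Proof.
move=> /nbhs_prodP[e e0 eP]; split; apply/nbhs_nmP; exists e => // z ze; apply: eP => //=;
  by rewrite subrr nm0.
Qed.

Lemma nbhs_box (z : cx * cx) (P : set (cx * cx)) : nbhs z P ->
  exists2 e : R, 0 < e & nball z.1 e `*` nball z.2 e `<=` P.
Proof. by move=> /nbhs_prodP[e e0 eP]; exists e => // -[x y] [/= ? ?]; exact: eP. Qed.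

Lemma continuous_poly (p : {poly R[i]}) : continuous (fun x : cx => p.[x] : cx).
Proof.
move=> x0 A /nbhs_nmP[e e0 eA]; have [d d0 dP] := poly_local p x0 e0.
by apply/nbhs_nmP; exists d => // x /dP; exact: eA.
Qed.

End Products.

Section CurveComplement.
Variable R : realType.
Local Notation cx := (R[i]^o).
Variables a b c : {poly R[i]}.
Local Notation f := (cubic a b c).
Implicit Types (x y p q : cx) (W : cx * cx -> cx * cx -> bool).

Definition curve_complement : set (cx * cx) := [set z | f z.1 z.2 <> 0].
Local Notation O := curve_complement.
Definition fibre x : set cx := [set y | f x y <> 0].
Definition fibre_cochain W x : cx -> cx -> bool := fun y y' => W (x, y) (x, y').

Lemma continuous_cubic : continuous (fun z : cx * cx => f z.1 z.2 : cx).
Proof.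
have c2 : continuous (snd : cx * cx -> cx) by move=> z; exact: cvg_snd.
have cp (p : {poly R[i]}) : continuous (fun z : cx * cx => p.[z.1] : cx).
  move=> z; apply: (@continuous_comp _ _ _ fst (fun x : cx => p.[x] : cx)).
    exact: cvg_fst.
  exact: continuous_poly.
move=> z; rewrite /cubic /=; apply: cvgD; last exact: cp.
apply: cvgD; last by apply: cvgM; [exact: cp|exact: c2].
apply: cvgD; last by apply: cvgM; [exact: cp|apply: cvgM; exact: c2].
by apply: cvgM; [exact: c2|apply: cvgM; exact: c2].
Qed.

Lemma open_curve_complement : open O.
Proof.
rewrite openE => z fz; rewrite /interior.
have fz0 : 0 < nm (f z.1 z.2) by rewrite nm_gt0; apply/eqP.
have h : \forall w \near z, nball (f z.1 z.2) (nm (f z.1 z.2)) (f w.1 w.2).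
  exact: (continuous_cubic (nbhs_nball _ fz0)).
apply: filterS h => w + fw.
by rewrite /nball /= fw sub0r nmN ltxx.
Qed.

Lemma fibre_puncture x p1 p2 p3 : roots3 a b c x p1 p2 p3 ->
  fibre x = puncture setT [:: p1; p2; p3].
Proof.
move=> h; apply/seteqP; split=> y.
  move=> fy; split=> //; apply/negP; rewrite !inE => /or3P yp; apply: fy.
  by apply/(roots3_eq0 _ h); case: yp => /eqP; by constructor.
move=> [_]; rewrite !inE !negb_or => /and3P[/eqP y1 /eqP y2 /eqP y3].
by move=> /(roots3_eq0 _ h)[].
Qed.

Section Cochain.
Variable W : cx * cx -> cx * cx -> bool.
Hypothesis cW : cocycle O W.

Lemma cocycle_fibre x : cocycle (fibre x) (fibre_cochain W x).
Proof.
move=> y1 y2 y3 h; apply: cW => s t s01 t01.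
by rewrite !seg_pair !segxx; exact: h.
Qed.

(** The meridian of the curve at a root [p] of the fibre over [x]: whether the
    cocycle is nontrivial around [p]. *)
Definition mer x p : bool :=
  ~~ `[< exists2 e : R, 0 < e & exact_on (fibre_cochain W x) (punctured_ball p e) >].

(** Any quadrilateral around the only root in a convex set measures the meridian. *)
Lemma mer_quad x p (K : set cx) (q1 q2 q3 q4 : cx) : convex K -> open K -> K p ->
    puncture K [:: p] `<=` fibre x ->
    (K `&` (above Re (Re p) `&` above Im (Im p))) q1 ->
    (K `&` (below Re (Re p) `&` above Im (Im p))) q2 ->
    (K `&` (below Re (Re p) `&` below Im (Im p))) q3 ->
    (K `&` (above Re (Re p) `&` below Im (Im p))) q4 ->
  mer x p = W (x, q1) (x, q2) (+) W (x, q2) (x, q3) (+) W (x, q3) (x, q4)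
              (+) W (x, q4) (x, q1).
Proof.
move=> cK oK Kp KO h1 h2 h3 h4.
have E := exact_puncture1 (@cocycle_fibre x) cK oK KO h1 h2 h3 h4.
have /nbhs_nmP[e e0 eK] : nbhs p K by apply: open_nbhs_nbhs.
rewrite -[RHS]/(fibre_cochain W x q1 q2 (+) fibre_cochain W x q2 q3
  (+) fibre_cochain W x q3 q4 (+) fibre_cochain W x q4 q1).
case: (X in _ = X) / boolP => s; last first.
  apply/negbF/asboolP; exists e => //; move/negbTE: s => /E.
  by apply: sub_exact => z [ze zp]; split=> //; exact: eK.
apply/negP => /asboolP[d d0 ex]; have /E : exact_on (fibre_cochain W x) (puncture K [:: p]); last by rewrite s.
by apply: (exact_puncture (@cocycle_fibre x)) => // p'; rewrite inE => /eqP -> _; exists d.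
Qed.

End Cochain.

Lemma prism_sum (t1 t2 t3 t4 u1 u2 u3 u4 : bool) :
  (t1 (+) u1 (+) t2) (+) (t2 (+) u2 (+) t3) (+) (t3 (+) u3 (+) t4) (+) (t4 (+) u4 (+) t1)
  = u1 (+) u2 (+) u3 (+) u4.
Proof. by case: t1; case: t2; case: t3; case: t4; case: u1; case: u2; case: u3; case: u4. Qed.

Definition corner p (r s t : R) : cx := p + ((s * r) +i* (t * r))%C.

(** A disc around a simple root, which stays clear of the other roots when the
    parameter moves a little, computes all nearby meridians by one quadrilateral. *)
Lemma mer_local x0 p1 p2 p3 : roots3 a b c x0 p1 p2 p3 -> distinct3 p1 p2 p3 ->
  exists2 r : R, 0 < r & exists2 e : R, 0 < e &
    forall x q, nm (x - x0) < e -> f x q = 0 -> nm (q - p1) < r ->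
    forall W, cocycle O W -> mer W x q = mer W x0 p1 /\ mer W x0 p1 =
      W (x0, corner p1 r 1 1) (x0, corner p1 r (- 1) 1)
      (+) W (x0, corner p1 r (- 1) 1) (x0, corner p1 r (- 1) (- 1))
      (+) W (x0, corner p1 r (- 1) (- 1)) (x0, corner p1 r 1 (- 1))
      (+) W (x0, corner p1 r 1 (- 1)) (x0, corner p1 r 1 1).
Proof.
move=> h d; have /and3P[n12 n23 n13] := d.
(* The disc of radius [4 r] around [p1] contains exactly one root of each nearby fibre,
   at distance less than [r / 2] from [p1]; the corners of the square of half side [r]
   lie in this disc and have this root inside. *)
pose r : R := Num.min (nm (p1 - p2)) (nm (p1 - p3)) / 8.
have r0 : 0 < r by rewrite divr_gt0// lt_min !nm_gt0 !subr_eq0 n12.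
have : 8 * r <= Num.min (nm (p1 - p2)) (nm (p1 - p3)).
  by rewrite /r; lra.
rewrite le_min => /andP[r2 r3]; clearbody r.
have r20 : 0 < r / 2 by lra.
have [e e0 eP] := roots3_near r20 h d.
exists r => //; exists e => // x q xe q0 qp W cW.
pose K := nball p1 (4 * r).
have cK : convex K := @convex_nball _ _ _ _.
have oK : open K := @open_nball _ _ _ _.
have r40 : 0 < 4 * r by lra.
have Kroot x' q' : nm (x' - x0) < e -> f x' q' = 0 -> K q' -> nm (q' - p1) < r / 2.
  move=> /eP[q1 [q2 [q3 [hq _ c1 c2 c3]]]] /(roots3_eq0 _ hq)[] -> //.
    by rewrite /K /nball /=; have := nm_tri p1 q2 p2; rewrite (nmBC p1 q2); lra.
  by rewrite /K /nball /=; have := nm_tri p1 q3 p3; rewrite (nmBC p1 q3); lra.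
have Kuniq x' q' q'' : nm (x' - x0) < e -> f x' q' = 0 -> f x' q'' = 0 ->
    K q' -> K q'' -> q' = q''.
  move=> /eP[q1 [q2 [q3 [hq _ c1 c2 c3]]]] z' z'' K' K''.
  have far s p' : nm (s - p') < r / 2 -> 8 * r <= nm (p1 - p') -> ~ K s.
    by rewrite /K /nball /=; have := nm_tri p1 s p'; rewrite (nmBC p1 s); lra.
  have is1 s : f x' s = 0 -> K s -> s = q1.
    move=> /(roots3_eq0 _ hq)[] -> // Ks; exfalso; last exact: (far q3 p3).
    exact: (far q2 p2).
  by rewrite (is1 q')// (is1 q'').
have nr : `|r| = r by rewrite ger0_norm// ltW.
have side s t : `|s| = 1 -> `|t| = 1 -> K (corner p1 r s t).
  move=> s1 t1; rewrite /K /nball /corner /= (addrC p1) addrK.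
  by apply: le_lt_trans (nm_ReIm _) _; rewrite /= !normrM s1 t1 !mul1r nr; lra.
have n1 : `|1 : R| = 1 by rewrite normr1.
have nN1 : `|-1 : R| = 1 by rewrite normrN normr1.
have quad x' q' : nm (x' - x0) < e -> f x' q' = 0 -> K q' -> mer W x' q' =
      W (x', corner p1 r 1 1) (x', corner p1 r (- 1) 1)
      (+) W (x', corner p1 r (- 1) 1) (x', corner p1 r (- 1) (- 1))
      (+) W (x', corner p1 r (- 1) (- 1)) (x', corner p1 r 1 (- 1))
      (+) W (x', corner p1 r 1 (- 1)) (x', corner p1 r 1 1).
  move=> x'e z' K'; have q'p := Kroot x' q' x'e z' K'.
  have Rq := le_lt_trans (nm_Re (q' - p1)) q'p; have Iq := le_lt_trans (nm_Im (q' - p1)) q'p.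
  move: Rq Iq; rewrite ReD ImD ReN ImN !ltr_norml => /andP[R1 R2] /andP[I1 I2].
  apply: (mer_quad cW cK oK K').
    by move=> y [Ky]; rewrite inE => /eqP yq z; apply: yq; exact: (Kuniq x').
  1-4: by split; [exact: side|rewrite /above /below /corner /setI /= ReD ImD /=; clear -R1 R2 I1 I2 r0;
    split; lra].
have Kp1 : K p1 by exact: nball_center.
have x00 : nm (x0 - x0) < e by rewrite subrr nm0.
have z1 : f x0 p1 = 0 by apply/(roots3_eq0 _ h); constructor 1.
have E0 := quad x0 p1 x00 z1 Kp1.
split=> //; rewrite E0.
have Kq : K q by rewrite /K /nball /=; lra.
rewrite (quad x q)//.
(* Each side of the square stays in a half plane without roots, whose product with a
   disc of parameters is convex, so that the sides over [x] and [x0] can be compared. *)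
have prism (l : cx -> R) m s t s' t' : coordinate l ->
    (forall y, nm (y - p1) < r / 2 -> ~ above l m y) ->
    `|s| = 1 -> `|t| = 1 -> `|s'| = 1 -> `|t'| = 1 ->
    m < l (corner p1 r s t) -> m < l (corner p1 r s' t') ->
    W (x, corner p1 r s t) (x, corner p1 r s' t') =
    W (x, corner p1 r s t) (x0, corner p1 r s t)
    (+) W (x0, corner p1 r s t) (x0, corner p1 r s' t')
    (+) W (x, corner p1 r s' t') (x0, corner p1 r s' t').
  move=> cl lm s1 t1 s1' t1' ls ls'.
  pose S : set (cx * cx) := nball x0 e `*` (K `&` above l m).
  have cS : convex S.
    apply: convexX; first exact: convex_nball.
    by apply: convexI => //; exact: convex_above.
  have SO : S `<=` O.
    move=> [x' y] [/= x'e [Ky ly]] z; exact: (lm y (Kroot x' y x'e z Ky)).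
  by apply: (cocycle_prism cW cS SO); split=> //; split=> //; exact: side.
have cN (l : cx -> R) (s : R) : (l = Re \/ l = Im) -> (s = 1 \/ s = -1) ->
    coordinate (fun z => s * l z) /\
    forall y, nm (y - p1) < r / 2 -> ~ above (fun z => s * l z) (s * l p1 + r / 2) y.
  move=> le se; have cl : coordinate l by case: le => ->; [exact: coordinate_Re|exact: coordinate_Im].
  split.
    case: se => ->; first by split=> *; rewrite !mul1r; [rewrite cl.1|rewrite cl.2].
    have := coordinateN cl; congr coordinate; by apply/funext => z; rewrite mulN1r.
  move=> y /(le_lt_trans (cl.2 _ _)); rewrite ltr_norml /above /= => /andP[y1 y2].
  by case: se => ->; lra.
have [cI lI] := cN Im 1 (or_intror erefl) (or_introl erefl).
have [cI' lI'] := cN Im (-1) (or_intror erefl) (or_intror erefl).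
have [cR lR] := cN Re 1 (or_introl erefl) (or_introl erefl).
have [cR' lR'] := cN Re (-1) (or_introl erefl) (or_intror erefl).
have Rc s t : Re (corner p1 r s t) = Re p1 + s * r by rewrite /corner ReD.
have Ic s t : Im (corner p1 r s t) = Im p1 + t * r by rewrite /corner ImD.
rewrite (prism _ _ 1 1 (-1) 1 cI lI n1 n1 nN1 n1 ltac:(cbv beta; rewrite Ic; clear -r0; lra) ltac:(cbv beta; rewrite Ic; clear -r0; lra)).
rewrite (prism _ _ (-1) 1 (-1) (-1) cR' lR' nN1 n1 nN1 nN1
  ltac:(cbv beta; rewrite Rc; clear -r0; lra) ltac:(cbv beta; rewrite Rc; clear -r0; lra)).
rewrite (prism _ _ (-1) (-1) 1 (-1) cI' lI' nN1 nN1 n1 nN1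
  ltac:(cbv beta; rewrite Ic; clear -r0; lra) ltac:(cbv beta; rewrite Ic; clear -r0; lra)).
rewrite (prism _ _ 1 (-1) 1 1 cR lR n1 nN1 n1 n1 ltac:(cbv beta; rewrite Rc; clear -r0; lra) ltac:(cbv beta; rewrite Rc; clear -r0; lra)).
by apply: prism_sum.
Qed.

Lemma cocycleD W W' : cocycle O W -> cocycle O W' ->
  cocycle O (fun z w => W z w (+) W' z w).
Proof. by move=> h h' u v w k; rewrite (h u v w)// (h' u v w)//; xor. Qed.

Lemma merD W W' x p1 p2 p3 p : cocycle O W -> cocycle O W' ->
    roots3 a b c x p1 p2 p3 -> distinct3 p1 p2 p3 -> f x p = 0 ->
  mer (fun z w => W z w (+) W' z w) x p = mer W x p (+) mer W' x p.
Proof.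
move=> cW cW' h d.
have key q1 q2 q3 : roots3 a b c x q1 q2 q3 -> distinct3 q1 q2 q3 ->
    mer (fun z w => W z w (+) W' z w) x q1 = mer W x q1 (+) mer W' x q1.
  move=> hq dq; have [r r0 [e e0 eP]] := mer_local hq dq.
  have xe : nm (x - x) < e by rewrite subrr nm0.
  have qr : nm (q1 - q1) < r by rewrite subrr nm0.
  have z1 : f x q1 = 0 by apply/(roots3_eq0 _ hq); constructor 1.
  rewrite (eP x q1 xe z1 qr _ (cocycleD cW cW')).2 (eP x q1 xe z1 qr _ cW).2.
  by rewrite (eP x q1 xe z1 qr _ cW').2; xor.
move=> /(roots3_eq0 _ h)[] ->; first exact: key d.
  exact: (key _ _ _ (roots3_rot h) (distinct3_rot d)).
exact: (key _ _ _ (roots3_rot (roots3_rot h)) (distinct3_rot (distinct3_rot d))).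
Qed.

End CurveComplement.

(** * A cocycle without meridians is exact *)

Section VerticalLines.
Variable R : realType.
Local Notation cx := (R[i]^o).
Implicit Types (A : set cx) (B : seq cx).

Lemma bool_connectedX A A' : bool_connected A -> bool_connected A' ->
  bool_connected (A `*` A').
Proof.
move=> cA cA' phi lphi [x y] [x' y'] [/= Ax Ay] [/= Ax' Ay'].
have l1 : locally_constant A' (fun v => phi (x, v)).
  move=> v Av; have /nbhs_pair[h _] := lphi (x, v) (conj Ax Av).
  by apply: filterS h => w hw Aw; apply: hw.
have l2 : locally_constant A (fun u => phi (u, y')).
  move=> u Au; have /nbhs_pair[_ h] := lphi (u, y') (conj Au Ay').
  by apply: filterS h => w hw Aw; apply: hw.
by rewrite (cA' _ l1 y y' Ay Ay') (cA _ l2 x x' Ax Ax').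
Qed.

Lemma nbhs_off_lines B (z : cx * cx) (P : set (cx * cx)) : nbhs z P ->
  exists2 w, P w & w.1 \notin B.
Proof.
move=> /nbhs_box[e e0 eP].
have [m [m0 me mB]] := small_avoiding (map (fun p => Re (p - z.1)) B) e0.
exists (z.1 + m%:C%C, z.2).
  apply: eP; split; last exact: nball_center.
  by rewrite /nball /= (addrC z.1) addrK nm_real gtr0_norm.
apply: contra mB => zB; apply/mapP; exists (z.1 + m%:C%C) => //.
by rewrite (addrC z.1) addrK.
Qed.

Variables (O : set (cx * cx)) (W : cx * cx -> cx * cx -> bool).
Hypothesis cW : cocycle O W.

(** Finitely many vertical lines do not obstruct exactness: a small
    polydisc minus a vertical line is still connected. *)
Lemma exact_lines B (S : set (cx * cx)) Phi : open S -> S `<=` O ->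
    potential W (S `&` [set z | z.1 \notin B]) Phi ->
  exact_on W S.
Proof.
move=> oS SO pPhi.
have box z : S z -> exists2 e : R, 0 < e &
    nball z.1 e `*` nball z.2 e `<=` S `&` [set w | w.1 \in B -> w.1 = z.1].
  move=> Sz; apply: nbhs_box; apply: filterI; first exact: open_nbhs_nbhs.
  apply: (@nbhs_fst _ z [set x | x \in B -> x = z.1]).
  pose B' := [seq x <- B | x != z.1].
  have : nbhs z.1 (puncture setT B').
    apply: open_nbhs_nbhs; split; first exact: open_puncture openT.
    by split=> //; rewrite mem_filter eqxx.
  apply: filterS => x [_]; rewrite mem_filter /= => + xB; rewrite xB andbT negbK.
  by move/eqP.
(* The value at a point of a line is read off from nearby points outside the lines. *)
have ex z : exists k : bool, S z -> z.1 \in B ->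
    \forall w \near z, w.1 \notin B -> W w z = Phi w (+) k.
  have [[Sz zB]|n] := pselect (S z /\ z.1 \in B); last first.
    by exists false => Sz zB; case: n.
  have [e e0 eS] := box z Sz.
  have cN : convex (nball z.1 e `*` nball z.2 e) by apply: convexX; exact: convex_nball.
  have tri := cocycle_convex cW cN (fun w h => SO _ (eS w h).1).
  pose N := puncture (nball z.1 e) [:: z.1] `*` nball z.2 e.
  have Nz : (nball z.1 e `*` nball z.2 e) z by split; exact: nball_center.
  have conN : bool_connected N.
    apply: bool_connectedX; last exact/bool_connected_convex/convex_nball.
    by apply: puncture_connected; [exact: convex_nball|exact: open_nball].
  have NB w : N w -> (S `&` [set z | z.1 \notin B]) w.
    move=> [[w1 wz] w2]; have [Sw Bw] := eS w (conj w1 w2); split=> //=.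
    by apply/negP => /Bw wE; move: wz; rewrite inE wE eqxx.
  have lN : locally_constant N (fun w => W w z (+) Phi w).
    move=> w Nw; have := pPhi w (NB w Nw).
    apply: filterS => w' + Nw'; have := tri w' w z.
    case: Nw' Nw => -[w1' _] w2' [[w1 _] w2].
    by move=> /(_ (conj w1' w2') (conj w1 w2) Nz) -> ->; xor.
  have nN : \forall w \near z, w.1 \notin B -> N w.
    have : nbhs z (nball z.1 e `*` nball z.2 e).
      by apply: open_nbhs_nbhs; split=> //; apply: openX; exact: open_nball.
    apply: filterS => w [w1 w2] wB; split=> //; split=> //; rewrite inE.
    by apply: contraNneq wB => ->.
  have [[w0 Nw0]|none] := pselect (exists w, N w); last first.
    exists false => _ _; apply: filterS nN => w wN /wN Nw; case: none; by exists w.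
  exists (W w0 z (+) Phi w0) => _ _; apply: filterS nN => w wN /wN Nw.
  by have := conN _ lN w w0 Nw Nw0; xor.
have [k kP] := choice ex.
exists (fun z => if z.1 \in B then k z else Phi z) => a Sa.
case: (boolP (a.1 \in B)) => aB; last first.
  have h : \forall w \near a, w.1 \notin B.
    apply: (@nbhs_fst _ a [set x | x \notin B]).
    have : nbhs a.1 (puncture setT B).
      by apply: open_nbhs_nbhs; split=> //; exact: open_puncture openT.
    by apply: filterS => x [].
  apply: filterS2 h (pPhi a (conj Sa aB)) => w wB ->.
  by rewrite (negbTE wB).
have [e e0 eS] := box a Sa.
have /nbhs_box[d d0 dP] : nbhs a ((nball a.1 e `*` nball a.2 e) `&`
    [set w | w.1 \notin B -> W w a = Phi w (+) k a]).
  apply: filterI; last exact: kP.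
  apply: open_nbhs_nbhs; split; last by split; exact: nball_center.
  by apply: openX; exact: open_nball.
have cN : convex (nball a.1 d `*` nball a.2 d) by apply: convexX; exact: convex_nball.
have NO : nball a.1 d `*` nball a.2 d `<=` O by move=> w /dP[/eS[/SO]].
have oN : open (nball a.1 d `*` nball a.2 d) by apply: openX; exact: open_nball.
have Na : (nball a.1 d `*` nball a.2 d) a by split; exact: nball_center.
have : nbhs a (nball a.1 d `*` nball a.2 d) by apply: open_nbhs_nbhs.
apply: filterS => w Nw; have [/eS[Sw wa] wP] := dP w Nw.
case: (boolP (w.1 \in B)) => wB; last exact: wP.
have : nbhs w ((nball a.1 d `*` nball a.2 d) `&`
    [set u | u.1 \notin B -> W u w = Phi u (+) k w]).
  by apply: filterI; [exact: open_nbhs_nbhs|exact: kP].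
move=> /(nbhs_off_lines B)[u [Nu uP] uB].
have := cocycle_convex cW cN NO Nu Nw Na.
by rewrite (uP uB) ((dP u Nu).2 uB); xor.
Qed.

End VerticalLines.

Section NoMeridians.
Variable R : realType.
Local Notation cx := (R[i]^o).
Variables a b c : {poly R[i]}.
Local Notation f := (cubic a b c).
Local Notation O := (curve_complement a b c).
Implicit Types (x y p q : cx) (W : cx * cx -> cx * cx -> bool).

Lemma poly_bounded (p : {poly R[i]}) (r : R) :
  exists A : R, forall x, nm x < r -> nm (p.[x] : cx) <= A.
Proof.
have [A A0 [n pA]] := poly_growth p; exists (A * (1 + r) ^+ n) => x xr.
apply: le_trans (pA x) _; rewrite (ler_wpM2l (ltW A0))//.
have r0 : 0 <= r by apply: ltW; apply: le_lt_trans xr; exact: nm_ge0.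
by rewrite lerXn2r ?nnegrE ?addr_ge0 ?nm_ge0// lerD2l ltW.
Qed.

Lemma cubic_roots_bounded (r : R) :
  exists M : R, forall x p, nm x < r -> f x p = 0 -> nm p < M.
Proof.
have [A AP] := poly_bounded a r; have [B BP] := poly_bounded b r.
have [C CP] := poly_bounded c r; exists (2 + A + B + C) => x p xr /cubic_root_bound.
by move: (AP x xr) (BP x xr) (CP x xr); lra.
Qed.

Lemma poly_roots (p : {poly R[i]}) : p != 0 ->
  exists s : seq cx, forall x, (p.[x] == 0) = (x \in s).
Proof.
move=> p0; have [s ps] := closed_field_poly_normal p; exists s => x.
by rewrite -[LHS]/(root p x) ps rootZ ?lead_coef_eq0// root_prod_XsubC.
Qed.

Lemma disc_nonzero_exists x : (disc a b c).[x] != 0 ->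
  exists p1 p2 p3, roots3 a b c x p1 p2 p3 /\ distinct3 p1 p2 p3.
Proof.
move=> gx; have [p1 [p2 [p3 h]]] := roots3_exists a b c x; exists p1, p2, p3.
by split=> //; rewrite -(disc_distinct3 h).
Qed.

Variable W : cx * cx -> cx * cx -> bool.
Hypotheses (cW : cocycle O W) (disc0 : disc a b c != 0).

(** Normalize a potential on each good fibre by a potential on a half space
    that lies above the curve; the fibrewise potentials then fit together, since the
    points near which they do form an open and closed subset of each fibre. *)
Lemma exact_no_mer (r : R) :
    (forall x p, (disc a b c).[x] != 0 -> f x p = 0 -> mer W x p = false) ->
  exact_on W (O `&` (nball 0 r `*` setT)).
Proof.
move=> nomer; have [B BP] := poly_roots disc0.
have [M MP] := cubic_roots_bounded r.
set S := O `&` _; have oS : open S.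
  apply: openI; first exact: open_curve_complement.
  by apply: openX; [exact: open_nball|exact: openT].
have SO : S `<=` O by move=> z [].
pose T : set (cx * cx) := nball 0 r `*` above Re M.
have cT : convex T.
  by apply: convexX; [exact: convex_nball|apply: convex_above; exact: coordinate_Re].
have oT : open T.
  by apply: openX; [exact: open_nball|apply: open_above; exact: coordinate_Re].
have TO : T `<=` O.
  move=> z [zr zM] /(MP _ _ _) h; move: zr; rewrite /nball /= subr0 => /h zM'.
  have := le_lt_trans (ler_norm (Re z.2)) (le_lt_trans (nm_Re z.2) zM').
  by move: zM; rewrite /above /=; lra.
have [Psi pPsi] := exact_convex cW cT oT TO.
(* A potential on each good fibre, agreeing with [Psi] high above the curve. *)
have exfib x : exists phi, nball 0 r x -> x \notin B ->
    potential (fibre_cochain W x) (fibre a b c x) phi /\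
    forall y, M < Re y -> phi y = Psi (x, y).
  have [[xr xB]|n] := pselect (nball 0 r x /\ x \notin B); last first.
    by exists (fun=> false) => xr xB; case: n.
  have gx : (disc a b c).[x] != 0 by rewrite BP.
  have [p1 [p2 [p3 [h d]]]] := disc_nonzero_exists gx.
  have [phi pphi] : exact_on (fibre_cochain W x) (fibre a b c x).
    rewrite (fibre_puncture h).
    have eqO := fibre_puncture h.
    apply: (@exact_puncture R (fibre a b c x)).
    - exact: cocycle_fibre.
    - by [].
    - exact: openT.
    - by rewrite eqO.
    - move=> p ps _; have : f x p = 0.
        by apply/(roots3_eq0 _ h); move: ps; rewrite !inE => /or3P[]/eqP; by constructor.
      by move=> /(nomer x p gx)/negbFE/asboolP.
  have up y : M < Re y -> T (x, y) by move=> yM; split.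
  pose y0 : cx := (M + 1)%:C%C.
  have y0M : M < Re y0 by rewrite /= ltrDl.
  exists (fun y => phi y (+) (phi y0 (+) Psi (x, y0))) => _ _; split.
    exact: potential_shift.
  move=> y yM.
  have l : locally_constant (above Re M) (fun y => phi y (+) Psi (x, y)).
    apply: (@potential_diff _ _ (fibre_cochain W x)).
      by apply: sub_potential pphi => y' /up/TO.
    by move=> y' /up/pPsi/nbhs_pair[].
  have := bool_connected_convex (convex_above (coordinate_Re R)) l yM y0M.
  by xor.
have [phi phiP] := choice exfib.
apply: (exact_lines cW (B := B) (Phi := fun z => phi z.1 z.2) oS SO).
move=> [x0 y0] [[fz [/= x0r _]] /= x0B].
have [pphi0 phi0] := phiP x0 x0r x0B.
(* [Q y] says that the fibrewise potentials fit together near [(x0, y)]. *)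
pose Q y := `[< \forall z \near ((x0, y) : cx * cx),
  W z (x0, y) = phi z.1 z.2 (+) phi x0 y >].
suff : Q y0 by move/asboolP.
have oG : open (nball 0 r `&` [set x | x \notin B]).
  by have := @open_puncture R (nball 0 r) B (open_nball _ _).
have lQ : locally_constant (fibre a b c x0) Q.
  move=> y fy.
  have : nbhs ((x0, y) : cx * cx) (O `&` ((nball 0 r `&` [set x | x \notin B]) `*` setT)).
    apply: filterI; first by apply: open_nbhs_nbhs; split=> //; exact: open_curve_complement.
    by apply: open_nbhs_nbhs; split=> //; apply: openX => //; exact: openT.
  move=> /nbhs_box[e e0 eS].
  have cN : convex (nball x0 e `*` nball y e) by apply: convexX; exact: convex_nball.
  have NO : nball x0 e `*` nball y e `<=` O by move=> z /eS[].
  have tri := cocycle_convex cW cN NO.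
  have x0e : nball x0 e x0 by exact: nball_center.
  have fibE x y1 y2 : nball x0 e x -> nball y e y1 -> nball y e y2 ->
      W (x, y1) (x, y2) = phi x y1 (+) phi x y2.
    move=> xe y1e y2e; have [_ [[/= xr xB] _]] := eS (x, y1) (conj xe y1e).
    have [px _] := phiP x xr xB.
    have nf : nball y e `<=` fibre a b c x by move=> y' y'e; exact: (NO (x, y')).
    exact: (potential_convex (@cocycle_fibre _ _ _ _ _ cW x) (@convex_nball _ _ y e) nf
      (sub_potential nf px)).
  have imp y1 y2 : nball y e y1 -> nball y e y2 -> Q y1 -> Q y2.
    move=> y1e y2e /asboolP/nbhs_pair[_ h]; apply/asboolP.
    have near2 : nbhs ((x0, y2) : cx * cx) (nball x0 e `*` nball y e).
      by apply: open_nbhs_nbhs; split=> //; apply: openX; exact: open_nball.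
    have {}h := @nbhs_fst _ ((x0, y2) : cx * cx) _ h.
    apply: filterS2 near2 h => -[x y'] [/= xe y'e] hx.
    rewrite (tri _ (x, y1) _)// (tri (x, y1) (x0, y1) (x0, y2))// hx !fibE//.
    by xor.
  have : nbhs y (nball y e) by exact: nbhs_nball.
  apply: filterS => y' y'e _; have ye : nball y e y by exact: nball_center.
  by apply/idP/idP; exact: imp.
have gx : (disc a b c).[x0] != 0 by rewrite BP.
have [p1 [p2 [p3 [h d]]]] := disc_nonzero_exists gx.
have cf : bool_connected (fibre a b c x0).
  by rewrite (fibre_puncture h); apply: puncture_connected => //; exact: openT.
pose ys : cx := (M + 1)%:C%C.
have ysM : M < Re ys by rewrite /= ltrDl.
have Tys : T (x0, ys) by split.
have fys : fibre a b c x0 ys := TO _ Tys.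
rewrite (cf Q lQ y0 ys fz fys); apply/asboolP.
have n1 : nbhs ((x0, ys) : cx * cx) (T `&` ((nball 0 r `&` [set x | x \notin B]) `*` setT)).
  apply: filterI; first by apply: open_nbhs_nbhs.
  by apply: open_nbhs_nbhs; split=> //; apply: openX => //; exact: openT.
apply: filterS2 n1 (pPsi _ Tys) => -[x y] [[/= xr yM] [[/= _ xB] _]] ->.
by rewrite (phi0 ys ysM) ((phiP x xr xB).2 y yM).
Qed.

End NoMeridians.

(** * Roots singled out by their meridian *)

Section MeridianCount.
Variable R : realType.
Local Notation cx := (R[i]^o).
Variables a b c : {poly R[i]}.
Local Notation f := (cubic a b c).
Local Notation O := (curve_complement a b c).
Implicit Types (x y p q : cx) (W : cx * cx -> cx * cx -> bool).
Hypothesis disc0 : disc a b c != 0.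

Definition good x := (disc a b c).[x] != 0.

Lemma good_connected : bool_connected [set x : cx | good x].
Proof.
have [B BP] := poly_roots disc0.
have -> : [set x : cx | good x] = puncture setT B.
  by apply/seteqP; split=> x; rewrite /good /= BP; [move=> xB; split|case].
by apply: puncture_connected; [|exact: openT].
Qed.

Lemma open_good : open [set x : cx | good x].
Proof.
have [B BP] := poly_roots disc0.
have -> : [set x : cx | good x] = puncture setT B.
  by apply/seteqP; split=> x; rewrite /good /= BP; [move=> xB; split|case].
exact/open_puncture/openT.
Qed.

Lemma good_exists : exists x : cx, good x.
Proof.
have [B BP] := poly_roots disc0.
have [m [_ _ mB]] := small_avoiding (map (fun p : cx => Re p) B) ltr01.
exists m%:C%C; rewrite /good BP; apply: contra mB => h.
by apply/mapP; exists m%:C%C.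
Qed.

Definition mer_count W x (n : nat) := exists p1 p2 p3,
  roots3 a b c x p1 p2 p3 /\
  (mer W x p1 + mer W x p2 + mer W x p3)%N = n.

Lemma mer_countE W x n p1 p2 p3 : roots3 a b c x p1 p2 p3 -> distinct3 p1 p2 p3 ->
  mer_count W x n ->
  (mer W x p1 + mer W x p2 + mer W x p3)%N = n.
Proof.
move=> h d [q1 [q2 [q3 [hq <-]]]].
by rewrite (roots3_sum (fun p => mer W x p : nat) hq h d).
Qed.

Lemma mer_local3 x0 p1 p2 p3 : roots3 a b c x0 p1 p2 p3 -> distinct3 p1 p2 p3 ->
  exists2 d : R, 0 < d & exists2 e : R, 0 < e &
    forall W, cocycle O W -> forall x q p, nm (x - x0) < e -> f x q = 0 ->
      f x0 p = 0 -> nm (q - p) < d -> mer W x q = mer W x0 p.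
Proof.
move=> h d.
have [d1 d10 [e1 e10 E1]] := mer_local h d.
have [d2 d20 [e2 e20 E2]] := mer_local (roots3_rot h) (distinct3_rot d).
have [d3 d30 [e3 e30 E3]] := mer_local (roots3_rot (roots3_rot h)) (distinct3_rot (distinct3_rot d)).
exists (Num.min d1 (Num.min d2 d3)); first by rewrite !lt_min d10 d20.
exists (Num.min e1 (Num.min e2 e3)); first by rewrite !lt_min e10 e20.
move=> W cW x q p; rewrite !lt_min => /and3P[x1 x2 x3] fq /(roots3_eq0 _ h) + /and3P[].
case=> -> q1 q2 q3; [exact: (E1 x q x1 fq q1 W cW).1|exact: (E2 x q x2 fq q2 W cW).1|].
exact: (E3 x q x3 fq q3 W cW).1.
Qed.

Lemma good_roots x : good x ->
  exists p1 p2 p3, roots3 a b c x p1 p2 p3 /\ distinct3 p1 p2 p3.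
Proof. exact: disc_nonzero_exists. Qed.

(** The roots move continuously over the connected set of good points and carry their
    meridians along. *)
Lemma mer_count_const W x x' n : cocycle O W -> good x -> good x' ->
  mer_count W x n -> mer_count W x' n.
Proof.
move=> cW gx gx' hx; apply/asboolP.
suff <- : `[< mer_count W x n >] = `[< mer_count W x' n >] by apply/asboolP.
apply: (good_connected (phi := fun x => `[< mer_count W x n >])) => //.
move=> x0 /good_roots[p1 [p2 [p3 [h d]]]].
have [r r0 [e e0 E]] := mer_local3 h d.
have [e' e'0 E'] := roots3_near r0 h d.
apply/nbhs_nmP; exists (Num.min e e'); first by rewrite lt_min e0.
move=> y; rewrite lt_min => /andP[ye ye'] _.
have [q1 [q2 [q3 [hq dq c1 c2 c3]]]] := E' y ye'.
have m1 : mer W y q1 = mer W x0 p1.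
  by apply: (E W cW) => //; [apply/(roots3_eq0 _ hq)|apply/(roots3_eq0 _ h)]; constructor 1.
have m2 : mer W y q2 = mer W x0 p2.
  by apply: (E W cW) => //; [apply/(roots3_eq0 _ hq)|apply/(roots3_eq0 _ h)]; constructor 2.
have m3 : mer W y q3 = mer W x0 p3.
  by apply: (E W cW) => //; [apply/(roots3_eq0 _ hq)|apply/(roots3_eq0 _ h)]; constructor 3.
apply/asboolP/asboolP => [/(mer_countE hq dq)|/(mer_countE h d)] <-;
  [exists p1, p2, p3|exists q1, q2, q3]; by rewrite m1 m2 m3.
Qed.

(** A root singled out by its meridian among the roots of each good fibre varies
    continuously. *)
Lemma distinguished_root W x p1 p2 p3 : cocycle O W -> good x ->
    roots3 a b c x p1 p2 p3 ->
    mer W x p1 != mer W x p2 -> mer W x p2 = mer W x p3 ->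
  exists y : cx -> cx,
    [/\ y x = p1, forall x, good x -> f x (y x) = 0 &
        forall x0 (e : R), good x0 -> 0 < e ->
          \forall x \near x0, nm (y x - y x0) < e].
Proof.
move=> cW gx h m12 m23.
have d : distinct3 p1 p2 p3 by rewrite -(disc_distinct3 h).
(* The distinguished root is the one whose meridian is [m]; it is unique over each good
   point because the number of nontrivial meridians is [n] everywhere. *)
pose m := mer W x p1.
pose n := if m then 1%N else 2%N.
have cn : mer_count W x n.
  exists p1, p2, p3; split=> //; rewrite -m23 /n /m; move: m12.
  by case: (mer _ _ p1); case: (mer _ _ p2).
have uniq x' : good x' -> exists q, [/\ f x' q = 0, mer W x' q = m &
    forall q', f x' q' = 0 -> mer W x' q' = m -> q' = q].
  move=> gx'; have [q1 [q2 [q3 [hq dq]]]] := good_roots gx'.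
  have := mer_countE hq dq (mer_count_const cW gx gx' cn).
  have z q : [\/ q = q1, q = q2 | q = q3] -> f x' q = 0 by move/(roots3_eq0 _ hq).
  rewrite /n; clear cn n; case: (m); case E1: (mer _ _ q1); case E2: (mer _ _ q2);
    case E3: (mer _ _ q3) => // _;
    first [exists q1; split=> //; [by apply: z; constructor 1|]
          |exists q2; split=> //; [by apply: z; constructor 2|]
          |exists q3; split=> //; [by apply: z; constructor 3|]];
    by move=> q' /(roots3_eq0 _ hq)[] -> //; rewrite ?E1 ?E2 ?E3.
have ex x' : exists q, good x' -> [/\ f x' q = 0, mer W x' q = m &
    forall q', f x' q' = 0 -> mer W x' q' = m -> q' = q].
  have [/uniq[q qP]|/negP n'] := boolP (good x'); first by exists q.
  by exists 0 => gx'.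
have [y yP] := choice ex.
exists y; split=> [|x' /yP[]//|x0 e gx0 e0].
  have [_ _ u] := yP x gx; apply/esym/u => //.
  by apply/(roots3_eq0 _ h); constructor 1.
have [q1 [q2 [q3 [hq dq]]]] := good_roots gx0.
have [r r0 [e1 e10 E1]] := mer_local3 hq dq.
have [fy my _] := yP x0 gx0.
have [e2 e20 E2] : exists2 e2 : R, 0 < e2 & forall x, nm (x - x0) < e2 ->
    exists2 q, f x q = 0 & nm (q - y x0) < Num.min r e.
  by apply: root_near => //; rewrite lt_min r0.
have : nbhs x0 [set x : cx | good x] by apply: open_nbhs_nbhs; split=> //; exact: open_good.
have n1 : nbhs x0 (nball x0 (Num.min e1 e2)) by apply: nbhs_nball; rewrite lt_min e10.
apply: filterS2 n1 => x'; rewrite /nball /= lt_min => /andP[x1 x2] gx'.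
have [q fq] := E2 x' x2; rewrite lt_min => /andP[qr qe].
have [_ _ u] := yP x' gx'; rewrite -(u q)//.
by rewrite (E1 W cW x' q (y x0)).
Qed.

End MeridianCount.

(** * A Liouville theorem *)

Section SecondOrderExpansions.
Variable R : realType.
Local Notation cx := (R[i]^o).
Implicit Types (F G K : cx -> cx) (x h : cx).

(** A second order expansion in the complex direction, which is what the maximum
    principle below needs in place of holomorphy. *)
Definition expands F x := exists (k0 k1 k2 : cx) (A e : R),
  [/\ 0 <= A, 0 < e, e <= 1 & forall h, nm h < e ->
    nm (F (x + h) - (k0 + k1 * h + k2 * h ^+ 2) : cx) <= A * nm h ^+ 3].

Lemma expands_near F G x (e : R) : 0 < e ->
  (forall h, nm h < e -> F (x + h) = G (x + h)) -> expands F x -> expands G x.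
Proof.
move=> e0 FG [k0 [k1 [k2 [A [d [A0 d0 d1 dP]]]]]]; exists k0, k1, k2, A, (Num.min d e).
split=> //; [by rewrite lt_min d0|by rewrite ge_min d1|].
by move=> h; rewrite lt_min => /andP[hd he]; rewrite -FG //; exact: dP.
Qed.

Lemma expands_cst (k : cx) x : expands (fun=> k) x.
Proof.
exists k, 0, 0, 0, 1; split=> // h _.
by rewrite !mul0r !addr0 subrr nm0.
Qed.

Lemma expands_id x : expands id x.
Proof.
exists x, 1, 0, 0, 1; split=> // h _.
by rewrite !mul0r !addr0 mul1r subrr nm0.
Qed.

Lemma expandsD F G x : expands F x -> expands G x -> expands (fun z => F z + G z) x.
Proof.
move=> [f0 [f1 [f2 [A [d [A0 d0 d1 dP]]]]]] [g0 [g1 [g2 [B [e [B0 e0 e1 eP]]]]]].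
exists (f0 + g0), (f1 + g1), (f2 + g2), (A + B), (Num.min d e).
split; [exact: addr_ge0|by rewrite lt_min d0|by rewrite ge_min d1|].
move=> h; rewrite lt_min => /andP[/dP hd /eP he].
have -> : F (x + h) + G (x + h) - (f0 + g0 + (f1 + g1) * h + (f2 + g2) * h ^+ 2) =
  (F (x + h) - (f0 + f1 * h + f2 * h ^+ 2)) + (G (x + h) - (g0 + g1 * h + g2 * h ^+ 2)).
  by ring.
by apply: le_trans (nmD _ _) _; rewrite mulrDl lerD.
Qed.

Lemma quadratic_bound (k0 k1 k2 h : cx) : nm h <= 1 ->
  nm (k0 + k1 * h + k2 * h ^+ 2 : cx) <= nm k0 + nm k1 + nm k2.
Proof.
move=> h1; have h0 := nm_ge0 h.
apply: le_trans (nmD _ _) _; apply: lerD.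
  apply: le_trans (nmD _ _) _; apply: lerD => //.
  by rewrite nmM ler_piMr ?nm_ge0.
by rewrite nmM nmX ler_piMr ?nm_ge0// exprn_ile1.
Qed.

Lemma expandsM F G x : expands F x -> expands G x -> expands (fun z => F z * G z) x.
Proof.
move=> [f0 [f1 [f2 [A [d [A0 d0 d1 dP]]]]]] [g0 [g1 [g2 [B [e [B0 e0 e1 eP]]]]]].
pose M := nm f0 + nm f1 + nm f2; pose N := nm g0 + nm g1 + nm g2.
have M0 : 0 <= M by rewrite !addr_ge0 ?nm_ge0.
have N0 : 0 <= N by rewrite !addr_ge0 ?nm_ge0.
exists (f0 * g0), (f0 * g1 + f1 * g0), (f0 * g2 + f1 * g1 + f2 * g0),
  (A * (B + N) + M * B + (nm (f1 * g2 + f2 * g1 : cx) + nm (f2 * g2 : cx))), (Num.min d e).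
split; [by rewrite !addr_ge0 ?mulr_ge0 ?addr_ge0 ?nm_ge0|by rewrite lt_min d0|by rewrite ge_min d1|].
move=> h; rewrite lt_min => /andP[hd he].
have h1 : nm h <= 1 by apply: le_trans (ltW hd) d1.
have h0 := nm_ge0 h.
have h3 : nm h ^+ 3 <= 1 by rewrite exprn_ile1.
set TF := f0 + f1 * h + f2 * h ^+ 2; set TG := g0 + g1 * h + g2 * h ^+ 2.
have -> : F (x + h) * G (x + h) - (f0 * g0 + (f0 * g1 + f1 * g0) * h +
    (f0 * g2 + f1 * g1 + f2 * g0) * h ^+ 2) =
  (F (x + h) - TF) * G (x + h) + TF * (G (x + h) - TG) +
  h ^+ 3 * ((f1 * g2 + f2 * g1) + (f2 * g2) * h).
  by rewrite /TF /TG; ring.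
have bT : nm TF <= M by exact: quadratic_bound.
have bG : nm (G (x + h)) <= B + N.
  rewrite -[G _](subrK TG); apply: le_trans (nmD _ _) _; apply: lerD.
    by apply: le_trans (eP h he) _; rewrite ler_piMr.
  exact: quadratic_bound.
apply: le_trans (nmD _ _) _; rewrite [leRHS]mulrDl; apply: lerD.
  apply: le_trans (nmD _ _) _; rewrite [leRHS]mulrDl; apply: lerD.
    rewrite nmM [leRHS]mulrAC; apply: ler_pM; rewrite ?nm_ge0//; exact: dP.
  by rewrite nmM -mulrA; apply: ler_pM; rewrite ?nm_ge0//; exact: eP.
rewrite nmM nmX mulrC; apply: ler_wpM2r; first by rewrite exprn_ge0.
by apply: le_trans (nmD _ _) _; rewrite lerD2l nmM ler_piMr ?nm_ge0.
Qed.

Lemma expandsX F x n : expands F x -> expands (fun z => F z ^+ n) x.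
Proof.
move=> eF; elim: n => [|n IH]; first exact: (@expands_cst 1).
apply: (@expands_near (fun z => F z * F z ^+ n) _ _ 1) => // [h _|]; first by rewrite exprS.
exact: expandsM.
Qed.

Lemma expands_poly (p : {poly R[i]}) x : expands (fun z => p.[z] : cx) x.
Proof.
elim/poly_ind: p => [|p c IH].
  by apply: (@expands_near (fun=> 0) _ _ 1) => // [h _|]; [rewrite horner0|exact: expands_cst].
apply: (@expands_near (fun z => p.[z] * z + c) _ _ 1) => // [h _|].
  by rewrite hornerMXaddC.
by apply: expandsD; [apply: expandsM => //; exact: expands_id|exact: expands_cst].
Qed.

Lemma expands_inv_sub (p x : cx) : x != p -> expands (fun z => (z - p)^-1) x.
Proof.
rewrite -subr_eq0; set k := x - p => k0; have nk : 0 < nm k by rewrite nm_gt0.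
exists k^-1, (- k^-1 ^+ 2), (k^-1 ^+ 3), (2 / nm k ^+ 4), (Num.min 1 (nm k / 2)).
split; [by rewrite divr_ge0 ?exprn_ge0 ?nm_ge0|by rewrite lt_min ltr01 divr_gt0|by rewrite ge_min lexx|].
move=> h; rewrite lt_min => /andP[_ hk].
have -> : x + h - p = k + h by rewrite /k; ring.
have nkh : nm k / 2 <= nm (k + h : cx).
  by have := nm_tri k (- h) 0; rewrite !subr0 opprK nmN; lra.
have kh0 : k + h != 0 by rewrite -nm_gt0; apply: lt_le_trans nkh; rewrite divr_gt0.
have -> : (k + h)^-1 - (k^-1 + - k^-1 ^+ 2 * h + k^-1 ^+ 3 * h ^+ 2) =
  - (h ^+ 3 * (k^-1 ^+ 3 * (k + h)^-1)) by field; rewrite k0 kh0.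
rewrite nmN nmM nmX mulrC; apply: ler_wpM2r; first by rewrite exprn_ge0 ?nm_ge0.
rewrite nmM nmX !nmV exprVn.
have -> : 2 / nm k ^+ 4 = (nm k ^+ 3)^-1 * (nm k / 2)^-1 by field; rewrite gt_eqF.
apply: ler_wpM2l; first by rewrite invr_ge0 exprn_ge0 ?nm_ge0.
by rewrite lef_pV2 ?posrE ?divr_gt0// (lt_le_trans _ nkh)// divr_gt0.
Qed.

(** At a point where [F] expands, the mean of [|F|^2] over a small square centred
    there is at least its value at the centre up to third order, whereas adding
    [eps |x|^2] gains a term of second order. *)
Lemma expands_not_max F x (eps d : R) : expands F x -> 0 < eps -> 0 < d ->
  ~ (forall h, nm h < d ->
       nm (F (x + h)) ^+ 2 + eps * nm (x + h : cx) ^+ 2 <= nm (F x) ^+ 2 + eps * nm x ^+ 2).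
Proof.
move=> [k0 [k1 [k2 [A [e [A0 e0 e1 eP]]]]]] eps0 d0 hmax.
have Fx : F x = k0.
  have := eP 0; rewrite nm0 => /(_ e0).
  rewrite addr0 mulr0 expr0n /= mulr0 !addr0 expr0n /= mulr0 => h.
  by apply/eqP; rewrite -subr_eq0 -nm_eq0 eq_le h nm_ge0.
pose M := nm k0 + nm k1 + nm k2; have M0 : 0 <= M by rewrite !addr_ge0 ?nm_ge0.
have MA0 : 0 < 2 * M * A + 1 by rewrite ltr_wpDl// !mulr_ge0.
have m0 : 0 < Num.min (Num.min e d) (eps / (2 * M * A + 1)).
  by rewrite !lt_min e0 d0 divr_gt0.
(* So small that the gain [eps * s ^+ 2] exceeds the total of the error terms. *)
pose s := Num.min (Num.min e d) (eps / (2 * M * A + 1)) / 2.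
have s0 : 0 < s by rewrite divr_gt0.
have : s < Num.min (Num.min e d) (eps / (2 * M * A + 1)) by rewrite /s; lra.
rewrite !lt_min ltr_pdivlMr// => /andP[/andP[se sd] sM].
clearbody s.
have s1 : s <= 1 by apply: le_trans (ltW se) e1.
pose T h : cx := k0 + k1 * h + k2 * h ^+ 2.
have low h : nm h = s ->
    nm (T h) ^+ 2 - 2 * M * (A * s ^+ 3) + eps * nm (x + h : cx) ^+ 2 <=
    nm k0 ^+ 2 + eps * nm x ^+ 2.
  move=> hs; have he : nm h < e by rewrite hs.
  have hd : nm h < d by rewrite hs.
  have := hmax h hd; rewrite Fx; apply: le_trans; rewrite lerD2r.
  have TM : nm (T h) <= M by apply: quadratic_bound; rewrite hs.
  have r0 : 0 <= A * s ^+ 3 by apply: mulr_ge0 => //; apply: exprn_ge0; exact: ltW.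
  have FT : nm (T h) <= nm (F (x + h)) + A * s ^+ 3.
    have := eP h he; rewrite hs; have := nm_tri (T h) (F (x + h)) 0.
    by rewrite !subr0 (nmBC (T h)); lra.
  move: (nm_ge0 (T h)) (nm_ge0 (F (x + h))) TM r0 FT.
  move: (nm (T h)) (nm (F (x + h))) (A * s ^+ 3) (M) => t g r m t0 g0 tm r0 tg.
  have [tg'|gt'] := leP t g; first by nra.
  have : (t - g) * (t + g) <= r * (2 * m) by apply: ler_pM; lra.
  by nra.
(* The four vertices of the square: the cross terms of the squared moduli cancel in the
   sum over them. *)
pose S : cx := s%:C%C; pose iS : cx := (0 +i* s)%C.
have nS : nm S = s by rewrite /S nm_real gtr0_norm.
have niS : nm iS = s.
  by apply/eqP; rewrite -(@eqrXn2 _ 2) ?nm_ge0 ?ltW// nm_sqr /= expr0n add0r.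
have := low S nS; have := low (- S); rewrite nmN => /(_ nS).
have := low iS niS; have := low (- iS); rewrite nmN => /(_ niS).
have sumT : nm (T S) ^+ 2 + nm (T (- S)) ^+ 2 + nm (T iS) ^+ 2 + nm (T (- iS)) ^+ 2 =
    4 * (nm k0 ^+ 2 + nm k1 ^+ 2 * s ^+ 2 + nm k2 ^+ 2 * s ^+ 4).
  rewrite /T /S /iS !nm_sqr; case: (k0) (k1) (k2) => [? ?] [? ?] [? ?] /=; ring.
have sumX : nm (x + S : cx) ^+ 2 + nm (x - S : cx) ^+ 2 + nm (x + iS : cx) ^+ 2
    + nm (x - iS : cx) ^+ 2 = 4 * (nm x ^+ 2 + s ^+ 2).
  by rewrite /S /iS !nm_sqr; case: (x) => ? ? /=; ring.
have p1 : 0 <= nm k1 ^+ 2 * s ^+ 2 by rewrite mulr_ge0 ?sqr_ge0.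
have p2 : 0 <= nm k2 ^+ 2 * s ^+ 4 by rewrite mulr_ge0 ?exprn_ge0 ?nm_ge0 ?ltW.
have s2 : 0 < s ^+ 2 by rewrite exprn_gt0.
have fin : 2 * M * (A * s ^+ 3) < eps * s ^+ 2.
  have -> : 2 * M * (A * s ^+ 3) = (s * (2 * M * A)) * s ^+ 2 by ring.
  by rewrite ltr_pM2r//; apply: le_lt_trans sM; rewrite (ler_wpM2l (ltW s0))// lerDl.
move: sumT sumX fin p1 p2.
move: (nm (T S) ^+ 2) (nm (T (- S)) ^+ 2) (nm (T iS) ^+ 2) (nm (T (- iS)) ^+ 2).
move: (nm (x + S : cx) ^+ 2) (nm (x - S : cx) ^+ 2) (nm (x + iS : cx) ^+ 2).
move: (nm (x - iS : cx) ^+ 2) (nm k0 ^+ 2) (nm k1 ^+ 2 * s ^+ 2) (nm k2 ^+ 2 * s ^+ 4).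
move: (2 * M * _) (nm x ^+ 2) (s ^+ 2) => q X s' a1 a2 a3 a4 a5 a6 a7 a8 a9 a10 a11.
clear -eps0; move=> e1 e2 e3 p3 p4 l1 l2 l3 l4.
have : eps * (a5 + a6 + a7 + a1) = eps * (4 * (X + s')) by congr (_ * _); lra.
by rewrite !mulrDr; nra.
Qed.

Lemma continuous_nm (V : normedModType R[i]) : continuous (nm : V -> R).
Proof.
move=> v A /nbhs_ballP[e /= e0 eA]; apply/nbhs_nmP; exists e => // w wv; apply: eA.
rewrite /ball /= ltr_norml; have := nm_tri v w 0; have := nm_tri w v 0.
by rewrite !subr0 (nmBC v w); move: wv; lra.
Qed.

Lemma continuous_add (T : topologicalType) (u v : T -> R) :
  continuous u -> continuous v -> continuous (fun t => u t + v t).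
Proof. by move=> cu cv t; apply: cvgD; [exact: cu|exact: cv]. Qed.

Lemma continuous_mul (T : topologicalType) (u v : T -> R) :
  continuous u -> continuous v -> continuous (fun t => u t * v t).
Proof. by move=> cu cv t; apply: cvgM; [exact: cu|exact: cv]. Qed.

Lemma compact_square_max (G : cx -> R) (r : R) : 0 <= r -> continuous G ->
  exists x, [/\ `|Re x| <= r, `|Im x| <= r &
    forall z, `|Re z| <= r -> `|Im z| <= r -> G z <= G x].
Proof.
move=> r0 cG; pose j (u : R * R) : cx := (u.1 +i* u.2)%C.
have cj : continuous j.
  move=> u A /nbhs_nmP[e e0 eA]; have e2 : 0 < e / 2 by rewrite divr_gt0.
  exists (ball u.1 (e / 2), ball u.2 (e / 2)) => /=.
    by split; exact: nbhsx_ballx.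
  move=> w [/= w1 w2]; apply: eA; apply: le_lt_trans (nm_ReIm _) _.
  rewrite /j ReD ImD ReN ImN /=; move: w1 w2; rewrite /ball /= (distrC u.1) (distrC u.2).
  lra.
pose Q : set (R * R) := `[- r, r]%classic `*` `[- r, r]%classic.
have Q0 : Q !=set0 by exists (0, 0); split; rewrite /= in_itv /= lerNl oppr0 r0.
have cQ : compact Q by apply: compact_setX; exact: segment_compact.
have cGj : continuous (G \o j) by move=> u; apply: continuous_comp; [exact: cj|exact: cG].
have [u uQ uP] := compact_EVT_max Q0 cQ (continuous_subspaceT cGj).
move: uQ; rewrite inE => -[/=]; rewrite !in_itv /= => u1 u2.
exists (j u); split; rewrite ?ler_norml // => z; rewrite !ler_norml => z1 z2.
have -> : z = j (Re z, Im z) by case: z {z1 z2}.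
by apply: uP; rewrite inE; split; rewrite /= in_itv.
Qed.

(** If [|K|] were positive somewhere, [|K|^2 + eps |x|^2] with a small [eps] would
    have a maximum over a large square, at an interior point outside [B]. *)
Lemma liouville_vanish K (B : seq cx) : continuous K ->
    (forall x, x \in B -> K x = 0) -> (forall x, x \notin B -> expands K x) ->
    (forall e : R, 0 < e -> exists r : R, forall x, r <= nm x -> nm (K x) <= e) ->
  forall x, K x = 0.
Proof.
move=> cK KB Kex Kinf x1; apply/eqP; rewrite -nm_eq0 eq_le nm_ge0 andbT leNgt.
apply/negP; set k := nm (K x1) => k0.
have [r0 r0P] := Kinf (k / 2) (divr_gt0 k0 (ltr0n _ 2)).
pose r := Num.max r0 (nm x1 + 1).
have r1 : nm x1 + 1 <= r by rewrite le_max lexx orbT.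
have rp : 0 < r by apply: lt_le_trans r1; rewrite ltr_wpDl ?nm_ge0.
have rP x : r <= nm x -> nm (K x) <= k / 2.
  by move=> rx; apply: r0P; apply: le_trans rx; rewrite le_max lexx.
clearbody r.
(* On the square of half side [r] the added term is at most [k ^+ 2 / 4], which keeps
   the maximum away from the region where [|K| <= k / 2]. *)
pose eps := k ^+ 2 / (8 * r ^+ 2).
have eps0 : 0 < eps by rewrite divr_gt0 ?mulr_gt0 ?exprn_gt0.
pose G (x : cx) : R := nm (K x) ^+ 2 + eps * nm x ^+ 2.
have cG : continuous G.
  have cn : continuous (nm : cx -> R) by exact: continuous_nm.
  have cnK : continuous (fun x : cx => nm (K x)).
    by move=> x; apply: (@continuous_comp _ _ _ K nm); [exact: cK|exact: cn].
  have -> : G = fun x => nm (K x) * nm (K x) + eps * (nm x * nm x).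
    by apply/funext => x; rewrite /G !expr2.
  apply: continuous_add; apply: continuous_mul => //.
    exact: cst_continuous.
  exact: continuous_mul.
have [x [xR xI xmax]] := compact_square_max (ltW rp) cG.
have inS (z : cx) : nm z <= r -> `|Re z| <= r /\ `|Im z| <= r.
  by move=> zr; split; apply: le_trans zr; [exact: nm_Re|exact: nm_Im].
have Gx : k ^+ 2 <= G x.
  have [h1 h2] : `|Re x1| <= r /\ `|Im x1| <= r by apply: inS; lra.
  by apply: le_trans (xmax x1 h1 h2); rewrite /G lerDl; apply: mulr_ge0; [exact: ltW|exact: sqr_ge0].
have x2 : eps * nm x ^+ 2 <= k ^+ 2 / 4.
  have : nm x ^+ 2 <= 2 * r ^+ 2.
    rewrite nm_sqr -(real_normK (num_real (Re x))) -(real_normK (num_real (Im x))).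
    have : `|Re x| ^+ 2 <= r ^+ 2 by rewrite lerXn2r ?nnegrE// ltW.
    have : `|Im x| ^+ 2 <= r ^+ 2 by rewrite lerXn2r ?nnegrE// ltW.
    by lra.
  move=> h; have -> : k ^+ 2 / 4 = eps * (2 * r ^+ 2).
    by rewrite /eps; field; rewrite gt_eqF.
  by rewrite (ler_wpM2l (ltW eps0)).
have k20 : 0 < k ^+ 2 by rewrite exprn_gt0.
have big : k / 2 < nm (K x).
  rewrite ltNge; apply/negP => h.
  have : nm (K x) ^+ 2 <= (k / 2) ^+ 2 by rewrite lerXn2r ?nnegrE ?nm_ge0// ltW// divr_gt0.
  by move: Gx; rewrite /G expr_div_n; lra.
have xr : nm x < r by rewrite ltNge; apply/negP => /rP; rewrite leNgt big.
have xB : x \notin B.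
  by apply/negP => /KB h; move: big; rewrite h nm0; lra.
have d0 : 0 < r - nm x by rewrite subr_gt0.
apply: (expands_not_max (Kex x xB) eps0 d0) => h hd.
have xhr : nm (x + h : cx) <= r by have := nmD x h; lra.
by have [h1 h2] := inS _ xhr; exact: xmax.
Qed.

End SecondOrderExpansions.

(** * Continuous roots are polynomials *)

Section ContinuousRoots.
Variable R : realType.
Local Notation cx := (R[i]^o).
Implicit Types (x p q h : cx) (s : seq cx).

Lemma poly_growth_size (p : {poly R[i]}) n : (size p <= n.+1)%N ->
  exists2 A : R, 0 < A & forall x, nm (p.[x] : cx) <= A * (1 + nm x) ^+ n.
Proof.
move=> pn; exists (1 + \sum_(i < n.+1) nm (p`_i : cx)).
  by rewrite ltr_pwDl// sumr_ge0// => i _; exact: nm_ge0.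
move=> x; rewrite (horner_coef_wide _ pn) mulrDl mul1r mulr_suml.
have x0 : 0 <= nm x := nm_ge0 x.
apply: le_trans (_ : \sum_(i < n.+1) nm (p`_i : cx) * (1 + nm x) ^+ n <= _); last first.
  by rewrite lerDr exprn_ge0// addr_ge0.
have nm_sum (I : Type) (r : seq I) (F : I -> cx) :
    nm (\sum_(i <- r) F i : cx) <= \sum_(i <- r) nm (F i).
  elim: r => [|i r IH]; first by rewrite !big_nil nm0.
  by rewrite !big_cons; apply: le_trans (nmD _ _) _; rewrite lerD2l.
apply: le_trans (nm_sum _ _ _) _; apply: ler_sum => i _.
rewrite nmM nmX ler_wpM2l ?nm_ge0//.
apply: le_trans (_ : (1 + nm x) ^+ i <= _).
  by rewrite lerXn2r ?nnegrE ?addr_ge0// lerDr.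
by rewrite ler_weXn2l ?lerDl// -ltnS.
Qed.

Lemma interpolation s (v : cx -> cx) : uniq s ->
  exists2 L : {poly R[i]}, (size L <= size s)%N & forall x, x \in s -> L.[x] = v x.
Proof.
elim: s => [_|x s IH /= /andP[xs /IH[L sL LP]]]; first by exists 0; rewrite ?size_poly0.
pose Q : {poly R[i]} := \prod_(p <- s) ('X - (p : R[i])%:P).
have Qx : Q.[x] != 0 by rewrite -[_ == _]/(root Q x) root_prod_XsubC.
exists (L + ((v x - L.[x]) / Q.[x]) *: Q).
  rewrite (leq_trans (size_polyD _ _))// geq_max leqW//=.
  by rewrite (leq_trans (size_scale_leq _ _))// size_prod_XsubC.
move=> z; rewrite inE hornerD hornerZ => /predU1P[->|zs].
  by rewrite divfK// addrC subrK.
have /eqP -> : root Q z by rewrite root_prod_XsubC.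
by rewrite mulr0 addr0 LP.
Qed.

Lemma expands_lipschitz (F : cx -> cx) x : expands F x -> exists C d : R,
  [/\ 0 <= C, 0 < d & forall z, nm (z - x) < d -> nm (F z - F x : cx) <= C * nm (z - x)].
Proof.
move=> [k0 [k1 [k2 [A [e [A0 e0 e1 eP]]]]]].
have Fx : F x = k0.
  have := eP 0; rewrite nm0 => /(_ e0).
  rewrite addr0 mulr0 expr0n /= mulr0 !addr0 expr0n /= mulr0 => h.
  by apply/eqP; rewrite -subr_eq0 -nm_eq0 eq_le h nm_ge0.
exists (A + (nm k1 + nm k2)), e; split=> //; first by rewrite !addr_ge0 ?nm_ge0.
move=> z ze; set h := z - x; have -> : z = x + h by rewrite /h addrC subrK.
have h0 := nm_ge0 h; have h1 : nm h <= 1 by apply: le_trans (ltW ze) e1.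
have -> : F (x + h) - F x = (F (x + h) - (k0 + k1 * h + k2 * h ^+ 2)) + (k1 + k2 * h) * h.
  by rewrite Fx; ring.
apply: le_trans (nmD _ _) _; rewrite [leRHS]mulrDl; apply: lerD.
  apply: le_trans (eP h ze) _; rewrite ler_wpM2l// exprS ler_piMr// exprn_ile1//.
rewrite nmM ler_wpM2r//; apply: le_trans (nmD _ _) _; rewrite lerD2l nmM.
by rewrite ler_piMr ?nm_ge0.
Qed.

Lemma expands_bounded (F : cx -> cx) x : expands F x -> exists M d : R,
  [/\ 0 <= M, 0 < d & forall z, nm (z - x) < d -> nm (F z : cx) <= M].
Proof.
move=> /expands_lipschitz[C [d [C0 d0 dP]]].
exists (C * d + nm (F x)), d; split=> //; first by rewrite addr_ge0 ?mulr_ge0 ?nm_ge0// ltW.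
move=> z zd; rewrite -[F z](subrK (F x)); apply: le_trans (nmD _ _) _; rewrite lerD2r.
by apply: le_trans (dP z zd) _; rewrite ler_wpM2l// ltW.
Qed.

Lemma expands_prod (F : cx -> cx -> cx) s x : (forall p, p \in s -> expands (F p) x) ->
  expands (fun z => \prod_(p <- s) F p z) x.
Proof.
elim: s => [_|p s IH sP].
  apply: (@expands_near _ (fun=> 1) _ _ 1) => // [h _|]; first by rewrite big_nil.
  exact: expands_cst.
apply: (@expands_near _ (fun z => F p z * \prod_(p <- s) F p z) _ _ 1) => // [h _|].
  by rewrite big_cons.
apply: expandsM; first by apply: sP; rewrite inE eqxx.
by apply: IH => q qs; apply: sP; rewrite inE qs orbT.
Qed.

Section Cubic.
Variables a b c : {poly R[i]}.
Local Notation f := (cubic a b c).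

(** An approximate solution [Y] with error divisible by [m] is corrected by a multiple
    of [m] to one with error divisible by [m * 'X]. *)
Lemma newton_step (a' b' c' Y Q m : {poly R[i]}) : m.[0] = 0 ->
    Y ^+ 3 + a' * Y ^+ 2 + b' * Y + c' = m * Q ->
    (3 * Y ^+ 2 + 2 * a' * Y + b').[0] != 0 ->
  exists (k : R[i]) (Q' : {poly R[i]}), let Y' := Y + k%:P * m in
    Y' ^+ 3 + a' * Y' ^+ 2 + b' * Y' + c' = m * 'X * Q'.
Proof.
move=> m0 YQ; have [D DE] : exists D, D = 3 * Y ^+ 2 + 2 * a' * Y + b' by eexists.
rewrite -DE => D0; pose k := - Q.[0] / D.[0].
have /factor_theorem[Q' EQ] :
    root (Q + k%:P * D + k%:P ^+ 2 * m * (3 * Y + a' + k%:P * m)) 0.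
  rewrite /root; horner_eval; rewrite m0 !(mulr0, mul0r) addr0.
  by rewrite /k !mulNr divfK// subrr.
exists k, Q' => /=; rewrite -mulrA.
have -> : 'X * Q' = Q + k%:P * D + k%:P ^+ 2 * m * (3 * Y + a' + k%:P * m).
  by rewrite EQ polyC0 subr0 mulrC.
have -> : (Y + k%:P * m) ^+ 3 + a' * (Y + k%:P * m) ^+ 2 + b' * (Y + k%:P * m) + c' =
  (Y ^+ 3 + a' * Y ^+ 2 + b' * Y + c') + m * (k%:P * D + k%:P ^+ 2 * m * (3 * Y + a' + k%:P * m)).
  by rewrite DE; ring.
by rewrite YQ; ring.
Qed.

(** Two Newton steps give a quadratic polynomial that solves the cubic up to third
    order, and the cubic is the product of the distances to its roots, all but one of
    which stay away. *)
Lemma expands_root (y : cx -> cx) x0 : (disc a b c).[x0] != 0 ->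
    (\forall x \near x0, f x (y x) = 0) ->
    (forall e : R, 0 < e -> \forall x \near x0, nm (y x - y x0) < e) ->
  expands y x0.
Proof.
move=> d0 yroot ycont.
have y0 : f x0 (y x0) = 0 by exact: nbhs_singleton yroot.
have [p2 [p3 [h d]]] : exists p2 p3, roots3 a b c x0 (y x0) p2 p3 /\ distinct3 (y x0) p2 p3.
  have [p1 [p2 [p3 h]]] := roots3_exists a b c x0.
  have d : distinct3 p1 p2 p3 by rewrite -(disc_distinct3 h).
  move: (y0) => /(roots3_eq0 _ h)[] ->; [by exists p2, p3|exists p3, p1|exists p1, p2].
    by split; [exact: roots3_rot|exact: distinct3_rot].
  by split; [exact/roots3_rot/roots3_rot|exact/distinct3_rot/distinct3_rot].
have /and3P[n12 n23 n13] := d.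
have [ha hb hc] := roots3_coef h.
pose sh (p : {poly R[i]}) : {poly R[i]} := p \Po ('X + (x0 : R[i])%:P).
have shE (p : {poly R[i]}) (z : R[i]) : (sh p).[z] = p.[x0 + z] by rewrite /sh horner_comp !hornerE addrC.
(* The constant [y x0] solves the cubic up to first order. *)
have [Q0 Q0E] : exists Q, (y x0)%:P ^+ 3 + sh a * (y x0)%:P ^+ 2 + sh b * (y x0)%:P + sh c
    = 'X * Q.
  have /factor_theorem[Q QE] : root ((y x0)%:P ^+ 3 + sh a * (y x0)%:P ^+ 2
      + sh b * (y x0)%:P + sh c) 0.
    by rewrite /root; horner_eval; rewrite !shE addr0; apply/eqP.
  by exists Q; rewrite QE polyC0 subr0 mulrC.
have D0 Y : Y.[0] = y x0 -> (3 * Y ^+ 2 + 2 * sh a * Y + sh b).[0] != 0.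
  move=> Y0; horner_eval; rewrite !shE addr0 Y0 ha hb.
  rewrite [X in X != 0](_ : _ = (y x0 - p2) * (y x0 - p3)); last by ring.
  by rewrite mulf_neq0// subr_eq0.
have [k1 [Q1 /= Q1E]] := newton_step (hornerX 0) Q0E (D0 _ (hornerC _ _)).
have [||k2 [Q2 /= Q2E]] := newton_step _ Q1E.
- by rewrite hornerM hornerX mulr0.
- by apply: D0; horner_eval; rewrite mulr0 addr0.
pose T (z : cx) : cx := y x0 + k1 * z + k2 * z ^+ 2.
have TE (z : cx) : f (x0 + z) (T z) = z ^+ 3 * Q2.[z].
  have := congr1 (horner^~ z) Q2E; horner_eval; rewrite !shE => h'.
  have -> : z ^+ 3 = z * z * z :> R[i] by ring.
  rewrite -h' /cubic /T; congr (_ + _ + _ + _); ring.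
pose r : R := Num.min (nm (y x0 - p2)) (nm (y x0 - p3)) / 4.
have r0 : 0 < r by rewrite divr_gt0// lt_min !nm_gt0 !subr_eq0 n12.
have : 4 * r <= Num.min (nm (y x0 - p2)) (nm (y x0 - p3)) by rewrite /r; lra.
rewrite le_min => /andP[r2 r3]; clearbody r.
have [e1 e10 E1] := roots3_near r0 h d.
have /nbhs_nmP[e2 e20 E2] : \forall x \near x0, nm (y x - y x0) < r /\ f x (y x) = 0.
  by apply: filterI; [exact: ycont|].
have [C [e3 [C0 e30 E3]]] : exists C d : R, [/\ 0 <= C, 0 < d &
    forall z : cx, nm (z - 0) < d -> nm (T z - T 0 : cx) <= C * nm (z - 0)].
  apply: expands_lipschitz.
  apply: (@expands_near _ (fun z => (((y x0)%:P + k1 *: 'X + k2 *: 'X^2) : {poly R[i]}).[z])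
    _ _ 1 ltr01) => [z _|]; last exact: expands_poly.
  by horner_eval.
have T0 : T 0 = y x0 by rewrite /T expr0n /= !mulr0 !addr0.
have [A AP] := poly_bounded Q2 1.
have A0 : 0 <= A by apply: le_trans (AP 0 _); rewrite ?nm_ge0// nm0.
have C1 : 0 < C + 1 by rewrite ltr_wpDl.
exists (y x0), k1, k2, (A / (r * r)), (Num.min (Num.min 1 e1) (Num.min (Num.min e2 e3) (r / (C + 1)))).
split.
- by rewrite divr_ge0 ?mulr_ge0// ltW.
- by rewrite !lt_min ltr01 e10 e20 e30 divr_gt0.
- by rewrite !ge_min lexx.
move=> z; rewrite !lt_min => /andP[/andP[z1 ze1] /andP[/andP[ze2 ze3] zr]].
have xz : nm (x0 + z - x0 : cx) = nm z by rewrite addrC addKr.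
have [|q1 [q2 [q3 [hq _ c1 c2 c3]]]] := E1 (x0 + z); first by rewrite xz.
have [|yz fz] := E2 (x0 + z); first by rewrite xz.
have Tz : nm (T z - y x0) < r.
  rewrite -T0; apply: le_lt_trans (E3 z _) _; rewrite subr0 //.
  move: zr; rewrite ltr_pdivlMr// mulrC; apply: le_lt_trans.
  by rewrite ler_wpM2r ?nm_ge0// lerDl.
have far q p : nm (q - p) < r -> 4 * r <= nm (y x0 - p) -> r <= nm (T z - q) /\ q <> y (x0 + z).
  move=> qp pr; split; last first.
    by move=> qE; move: yz; rewrite -qE; have := nm_tri (y x0) q p; rewrite (nmBC (y x0) q); lra.
  have := nm_tri (y x0) (T z) p; have := nm_tri (T z) q p.
  by rewrite (nmBC (y x0) (T z)); lra.
have [f2 g2] := far q2 p2 c2 r2; have [f3 g3] := far q3 p3 c3 r3.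
have q1E : y (x0 + z) = q1 by have /(roots3_eq0 _ hq)[//|e|e] := fz; [case: g2|case: g3].
rewrite q1E nmBC -/(T z) mulrAC ler_pdivlMr ?mulr_gt0//.
apply: le_trans (_ : nm (T z - q1) * (nm (T z - q2) * nm (T z - q3)) <= _).
  by rewrite ler_wpM2l ?nm_ge0// ler_pM// ltW.
rewrite mulrA -!nmM -hq TE nmM nmX mulrC ler_wpM2r ?exprn_ge0 ?nm_ge0//.
exact: AP.
Qed.

Lemma good_points_exist s n : exists xs : seq cx,
  [/\ size xs = n, uniq xs & forall x, x \in xs -> x \notin s].
Proof.
elim: n => [|n [xs [sxs uxs xsP]]]; first by exists [::].
have [m [_ _ mB]] := small_avoiding (map (fun p : cx => Re p) (s ++ xs)) ltr01.
have : (m%:C%C : cx) \notin s ++ xs.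
  by apply: contra mB => h; apply/mapP; exists m%:C%C.
rewrite mem_cat negb_or => /andP[ms mxs].
exists (m%:C%C :: xs); split; rewrite /= ?sxs ?mxs// => x.
by rewrite inE => /predU1P[->//|/xsP].
Qed.

Lemma prod_sub_neq0 s x : x \notin s -> \prod_(p <- s) (x - p) != 0 :> R[i].
Proof.
move=> xs; rewrite prodf_seq_neq0; apply/allP => p ps /=; rewrite subr_eq0.
by apply: contraNneq xs => ->.
Qed.

Lemma prod_sub_bound s : exists2 D : R, 0 < D &
  forall x, nm (\prod_(p <- s) (x - p) : cx) <= D * (1 + nm x) ^+ size s.
Proof.
have [|D D0 DP] := @poly_growth_size (\prod_(p <- s) ('X - (p : R[i])%:P)) (size s).
  by rewrite size_prod_XsubC.
exists D => // x; apply: le_trans (DP x); rewrite horner_prod.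
by under eq_bigr do rewrite -hornerXsubC.
Qed.

Lemma prod_inv_bound s : exists r : R, forall x, r <= nm x ->
  nm (\prod_(p <- s) (x - p)^-1 : cx) <= (4 / (1 + nm x)) ^+ size s.
Proof.
elim: s => [|p s [r rP]]; first by exists 0 => x _; rewrite big_nil nm1.
exists (Num.max r (1 + 2 * nm p)) => x; rewrite ge_max => /andP[/rP IH xp].
have p0 := nm_ge0 p; have x0 := nm_ge0 x.
rewrite big_cons nmM exprS; apply: ler_pM; rewrite ?nm_ge0// nmV.
have xp' : (1 + nm x) / 4 <= nm (x - p : cx).
  by have := nm_tri x p 0; rewrite !subr0; lra.
rewrite -[4 / _]invf_div lef_pV2 ?posrE//; last by rewrite divr_gt0//; lra.
by apply: lt_le_trans xp'; rewrite divr_gt0//; lra.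
Qed.

Hypothesis disc0 : disc a b c != 0.

Lemma root_growth : exists2 A : R, 0 < A & exists n : nat,
  forall x p, f x p = 0 -> nm p <= A * (1 + nm x) ^+ n.
Proof.
have [A A0 [n1 AP]] := poly_growth a; have [B B0 [n2 BP]] := poly_growth b.
have [C C0 [n3 CP]] := poly_growth c.
exists (1 + A + B + C); first by rewrite !addr_gt0.
exists (n1 + n2 + n3)%N => x p /cubic_root_bound h; apply: le_trans h _.
have x1 : 1 <= 1 + nm x by rewrite lerDl nm_ge0.
have up D m q : 0 < D -> (m <= n1 + n2 + n3)%N -> nm (q : cx) <= D * (1 + nm x) ^+ m ->
    nm q <= D * (1 + nm x) ^+ (n1 + n2 + n3).
  move=> D0 mn h; apply: le_trans h _; rewrite (ler_wpM2l (ltW D0))//.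
  by rewrite ler_weXn2l.
rewrite !mulrDl mul1r !lerD ?exprn_ege1//.
- by apply: up (AP x); rewrite // -addnA leq_addr.
- by apply: up (BP x); rewrite // addnAC leq_addl.
- by apply: up (CP x); rewrite // leq_addl.
Qed.

(** Interpolate the root by a polynomial [L] at more good points than its growth
    exponent, so that the quotient [g] of the difference by the polynomial vanishing
    at these points tends to 0 at infinity and stays bounded near the bad points.  A
    power of [g] times the product over all exceptional points still tends to 0 at
    infinity, and vanishes at these points. *)
Lemma continuous_root_poly (y : cx -> cx) :
    (forall x, (disc a b c).[x] != 0 -> f x (y x) = 0) ->
    (forall x0 (e : R), (disc a b c).[x0] != 0 -> 0 < e ->
       \forall x \near x0, nm (y x - y x0) < e) ->
  exists L : {poly R[i]}, (forall x, f x L.[x] = 0) /\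
    forall x, (disc a b c).[x] != 0 -> y x = L.[x].
Proof.
move=> yroot ycont; have [B BP] := poly_roots disc0.
have gB x : x \notin B -> (disc a b c).[x] != 0 by rewrite BP.
have [A A0 [N AP]] := root_growth.
have [xs [sxs uxs xsB]] := good_points_exist B N.+1.
have [L sL LP] := interpolation y uxs.
have [AL AL0 ALP] := poly_growth_size (leq_trans sL (eq_leq sxs)).
(* [n] exceeds the degree of [Z], so that [g ^+ n * Z] still tends to 0 at infinity. *)
pose B' := B ++ xs; pose n := (size B').+1.
pose g x : cx := (y x - L.[x]) * \prod_(p <- xs) (x - p)^-1.
pose Z x : cx := \prod_(p <- B') (x - p).
pose K x : cx := if x \in B' then 0 else g x ^+ n * Z x.
have yex x : x \notin B -> expands y x.
  move=> xB; apply: expands_root; [exact: gB| |by move=> e; apply: ycont; exact: gB].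
  have : nbhs x (puncture setT B).
    by apply: open_nbhs_nbhs; split=> //; exact/open_puncture/openT.
  by apply: filterS => z [_ /gB/yroot].
have dex x : x \notin B -> expands (fun z => y z - L.[z]) x.
  move=> xB; apply: (@expands_near _ (fun z => y z + (- L).[z]) _ _ 1) => // [h _|].
    by rewrite hornerN.
  by apply: expandsD; [exact: yex|exact: expands_poly].
have vex s x : x \notin s -> expands (fun z => \prod_(p <- s) (z - p)^-1) x.
  move=> xs'; apply: (@expands_prod (fun p z => (z - p)^-1)) => p ps.
  by apply: expands_inv_sub; apply: contraNneq xs' => ->.
have ZE x : Z x = (\prod_(p <- B') ('X - (p : R[i])%:P)).[x].
  by rewrite horner_prod; apply: eq_bigr => p _; rewrite hornerXsubC.
have Kex x : x \notin B' -> expands K x.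
  move=> xB'; have : nbhs x (puncture setT B').
    by apply: open_nbhs_nbhs; split=> //; exact/open_puncture/openT.
  move=> /nbhs_nmP[e e0 eP].
  apply: (@expands_near _ (fun z => g z ^+ n * Z z) _ _ e e0) => [h he|].
    have [|_ /negbTE] := eP (x + h); first by rewrite (addrC x) addrK.
    by rewrite /K => ->.
  move: xB'; rewrite mem_cat negb_or => /andP[xB xxs].
  apply: expandsM; first by apply: expandsX; apply: expandsM; [exact: dex|exact: vex].
  apply: (@expands_near _ (fun z => (\prod_(p <- B') ('X - (p : R[i])%:P)).[z]) _ _ 1) => //.
  exact: expands_poly.
have ybound x : x \notin B -> nm (y x - L.[x]) <= (A + AL) * (1 + nm x) ^+ N.
  move=> /gB/yroot/AP h; apply: le_trans (nmB _ _) _; rewrite mulrDl.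
  by apply: lerD => //; exact: ALP.
have gbound x0 : x0 \in B' -> exists M d : R, [/\ 0 <= M, 0 < d &
    forall x, nm (x - x0) < d -> x \notin B' -> nm (g x) <= M].
  have [x0B _|x0B] := boolP (x0 \in B).
    have x0xs : x0 \notin xs by apply/negP => /xsB; rewrite x0B.
    have [M [d [M0 d0 dP]]] := expands_bounded (vex xs x0 x0xs).
    pose M1 := (A + AL) * (1 + (nm x0 + d)) ^+ N.
    have A1 : 0 <= A + AL by rewrite addr_ge0 ?ltW.
    have s0 : 0 <= 1 + (nm x0 + d) by rewrite !addr_ge0 ?nm_ge0 ?ltW.
    have M10 : 0 <= M1 by rewrite mulr_ge0 ?exprn_ge0.
    exists (M1 * M), d; split=> //; first exact: mulr_ge0.
    move=> x xd; rewrite mem_cat negb_or => /andP[xB _].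
    rewrite nmM ler_pM ?nm_ge0//; last exact: dP.
    apply: le_trans (ybound x xB) _; rewrite ler_wpM2l//.
    rewrite lerXn2r ?nnegrE ?addr_ge0 ?nm_ge0 ?ltW//.
    by have := nm_tri x x0 0; rewrite !subr0; lra.
  rewrite mem_cat (negbTE x0B) /= => x0xs.
  have x0r : x0 \notin rem x0 xs by rewrite mem_rem_uniq// inE eqxx.
  have [M [d [M0 d0 dP]]] := expands_bounded (vex _ x0 x0r).
  have [C [e [C0 e0 eP]]] := expands_lipschitz (dex x0 x0B).
  exists (C * M), (Num.min d e); split; [exact: mulr_ge0|by rewrite lt_min d0|].
  move=> x; rewrite lt_min => /andP[xd xe]; rewrite mem_cat negb_or => /andP[_ xxs].
  have xx0 : x - x0 != 0 by rewrite subr_eq0; apply: contraNneq xxs => ->.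
  rewrite /g (big_rem x0)//= mulrA nmM ler_pM ?nm_ge0//; last exact: dP.
  rewrite nmM nmV ler_pdivrMr ?nm_gt0//.
  by have := eP x xe; rewrite (LP x0 x0xs) subrr subr0.
have KB x : x \in B' -> K x = 0 by rewrite /K => ->.
have cK : continuous K.
  move=> x0; have [x0B|x0B] := boolP (x0 \in B'); last first.
    have [C [d [C0 d0 dP]]] := expands_lipschitz (Kex x0 x0B).
    move=> U /nbhs_nmP[e e0 eU]; apply/nbhs_nmP.
    have C1 : 0 < C + 1 by rewrite ltr_wpDl.
    exists (Num.min d (e / (C + 1))); first by rewrite lt_min d0 divr_gt0.
    move=> z; rewrite lt_min ltr_pdivlMr// => /andP[zd ze]; apply: eU.
    apply: le_lt_trans (dP z zd) _; apply: le_lt_trans ze.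
    by rewrite mulrC ler_wpM2l ?nm_ge0// lerDl.
  have [M [d [M0 d0 dP]]] := gbound x0 x0B.
  move=> U /nbhs_nmP[e e0 eU]; apply/nbhs_nmP.
  have M1 : 0 < M ^+ n + 1 by rewrite ltr_wpDl ?exprn_ge0.
  have [d' d'0 d'P] := poly_local (\prod_(p <- B') ('X - (p : R[i])%:P)) x0
    (divr_gt0 e0 M1).
  exists (Num.min d d'); first by rewrite lt_min d0.
  move=> z; rewrite lt_min => /andP[zd /d'P]; rewrite -!ZE.
  have -> : Z x0 = 0 by rewrite /Z (big_rem x0)//= subrr mul0r.
  rewrite subr0 ltr_pdivlMr// => Zz; apply: eU; rewrite (KB x0)// subr0.
  rewrite /K; case: ifPn => zB; first by rewrite nm0.
  apply: le_lt_trans Zz; rewrite nmM mulrC ler_wpM2l ?nm_ge0// nmX.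
  apply: le_trans (_ : M ^+ n <= _); last by rewrite lerDl.
  by rewrite lerXn2r ?nnegrE ?nm_ge0//; exact: dP.
have Kinf (e : R) : 0 < e -> exists r : R, forall x, r <= nm x -> nm (K x) <= e.
  move=> e0; have [D D0 DP] := prod_sub_bound B'.
  have [r rP] := prod_inv_bound xs.
  pose C := (A + AL) * 4 ^+ N.+1.
  have C0 : 0 < C by rewrite mulr_gt0 ?exprn_gt0// addr_gt0.
  pose E := C ^+ n * D / e.
  exists (Num.max r E) => x; rewrite ge_max => /andP[/rP xr xE].
  rewrite /K; case: ifPn => [_|]; first by rewrite nm0 ltW.
  rewrite mem_cat negb_or => /andP[xB _].
  have x1 : 0 < 1 + nm x by rewrite ltr_pwDl ?nm_ge0.
  have gx : nm (g x) <= C / (1 + nm x).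
    rewrite nmM; apply: le_trans (ler_pM (nm_ge0 _) (nm_ge0 _) (ybound x xB) xr) _.
    rewrite sxs expr_div_n [X in _ / X]exprS le_eqVlt; apply/orP; left; apply/eqP.
    by rewrite /C; field; rewrite !expf_neq0 ?gt_eqF.
  rewrite nmM nmX.
  have h1 : nm (g x) ^+ n <= (C / (1 + nm x)) ^+ n.
    by rewrite lerXn2r ?nnegrE ?nm_ge0// divr_ge0// ltW.
  apply: le_trans (ler_pM (exprn_ge0 _ (nm_ge0 _)) (nm_ge0 _) h1 (DP x)) _.
  have -> : (C / (1 + nm x)) ^+ n * (D * (1 + nm x) ^+ size B') = C ^+ n * D / (1 + nm x).
    by rewrite expr_div_n /n [X in _ / X]exprS; field; rewrite !expf_neq0 ?gt_eqF.
  rewrite ler_pdivrMr//; move: xE; rewrite /E ler_pdivrMr// => xE.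
  by apply: le_trans xE _; rewrite mulrC (ler_wpM2l (ltW e0))// lerDr.
have K0 := liouville_vanish cK KB Kex Kinf.
have yL x : (disc a b c).[x] != 0 -> y x = L.[x].
  move=> gx; have xB : x \notin B by rewrite -BP.
  have [xxs|xxs] := boolP (x \in xs); first by rewrite LP.
  have := K0 x; rewrite /K mem_cat (negbTE xB) (negbTE xxs) /= => /eqP.
  rewrite mulf_eq0 (negbTE (prod_sub_neq0 _)) ?orbF ?mem_cat ?negb_or ?xB//.
  rewrite expf_eq0 /= mulf_eq0 => /orP[|]; first by rewrite subr_eq0 => /eqP.
  rewrite prodfV invr_eq0 => /eqP h.
  by have := prod_sub_neq0 xxs; rewrite h eqxx.
exists L; split=> //.
pose F : {poly R[i]} := L ^+ 3 + a * L ^+ 2 + b * L + c.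
have FE x : F.[x] = f x L.[x] by rewrite /F; horner_eval.
suff F0 : F = 0 by move=> x; rewrite -FE F0 horner0.
apply/eqP/negPn/negP => /poly_roots[s sP].
have [zs [+ _ zP]] := good_points_exist (B ++ s) 1.
case: zs zP => [//|z zs] zP _.
have := zP z (mem_head _ _); rewrite mem_cat negb_or => /andP[/gB gz].
by rewrite -sP FE -(yL z gz) (yroot z gz) eqxx.
Qed.

End Cubic.
End ContinuousRoots.

(** * Independent cocycles and polynomial roots *)

Section IndependentCocycles.
Variable R : realType.
Local Notation cx := (R[i]^o).
Variables a b c : {poly R[i]}.
Local Notation f := (cubic a b c).
Local Notation O := (curve_complement a b c).
Local Notation good := (good a b c).
Implicit Types (x y p q : cx) (W : cx * cx -> cx * cx -> bool).
Hypothesis disc0 : disc a b c != 0.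

Definition no_mer W := forall x p, good x -> f x p = 0 -> mer W x p = false.

Definition poly_root (L : {poly R[i]}) := forall x, f x L.[x] = 0.

(** A root with a meridian unlike the two others cannot be permuted with them. *)
Lemma mer_poly_root W x p1 p2 p3 : cocycle O W -> good x -> roots3 a b c x p1 p2 p3 ->
    mer W x p1 != mer W x p2 -> mer W x p2 = mer W x p3 ->
  exists2 L, poly_root L & L.[x] = p1.
Proof.
move=> cW gx h m12 m23.
have [y [yx yroot ycont]] := distinguished_root disc0 cW gx h m12 m23.
have [L [rL LP]] := continuous_root_poly disc0 yroot ycont.
by exists L => //; rewrite -LP.
Qed.

Lemma no_merP W x p1 p2 p3 : cocycle O W -> good x -> roots3 a b c x p1 p2 p3 ->
  mer W x p1 = false -> mer W x p2 = false -> mer W x p3 = false -> no_mer W.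
Proof.
move=> cW gx h m1 m2 m3 x' p' gx' fp'.
have c0 : mer_count a b c W x 0 by exists p1, p2, p3; rewrite m1 m2 m3.
have [q1 [q2 [q3 [hq dq]]]] := good_roots gx'.
have := mer_countE hq dq (mer_count_const disc0 cW gx gx' c0).
move=> s0; move: fp' => /(roots3_eq0 _ hq)[] ->; move: s0;
  by case: (mer W x' q1); case: (mer W x' q2); case: (mer W x' q3).
Qed.

(** If no root is a polynomial then, by monodromy, the three meridians of a cocycle
    agree; for two independent cocycles they would all be nontrivial, and so cancel in
    the sum. *)
Lemma two_cocycles_root W W' : cocycle O W -> cocycle O W' ->
    ~ no_mer W -> ~ no_mer W' -> ~ no_mer (fun z w => W z w (+) W' z w) ->
  exists L, poly_root L.
Proof.
move=> cW cW' n1 n2 n3; apply: contrapT => noL.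
have [x gx] := good_exists disc0.
have [p1 [p2 [p3 [h d]]]] := good_roots gx.
have z1 : f x p1 = 0 by apply/(roots3_eq0 _ h); constructor 1.
have eqm V : cocycle O V -> mer V x p1 = mer V x p2 /\ mer V x p2 = mer V x p3.
  move=> cV; have h' := roots3_rot h; have h'' := roots3_rot h'.
  have bad q1 q2 q3 : roots3 a b c x q1 q2 q3 -> mer V x q1 != mer V x q2 ->
      mer V x q2 = mer V x q3 -> False.
    by move=> hq e1 e2; have [L rL _] := mer_poly_root cV gx hq e1 e2; case: noL; exists L.
  move: (bad _ _ _ h) (bad _ _ _ h') (bad _ _ _ h'').
  case: (mer V x p1); case: (mer V x p2); case: (mer V x p3) => //.
  - by move=> _ _ /(_ isT erefl).
  - by move=> _ /(_ isT erefl).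
  - by move=> /(_ isT erefl).
  - by move=> /(_ isT erefl).
  - by move=> _ /(_ isT erefl).
  - by move=> _ _ /(_ isT erefl).
have all1 V : cocycle O V -> ~ no_mer V -> mer V x p1 = true.
  move=> cV nV; have [e1 e2] := eqm V cV; apply: contraPT nV => /negbTE m1 nV.
  by apply: nV; apply: (no_merP cV gx h); rewrite // -?e2 -?e1.
have := all1 _ (cocycleD cW cW') n3.
by rewrite (merD cW cW' h d z1) (all1 W)// (all1 W').
Qed.

Section Three.
Variables W1 W2 W3 : cx * cx -> cx * cx -> bool.
Hypotheses (cW1 : cocycle O W1) (cW2 : cocycle O W2) (cW3 : cocycle O W3).

Definition combination (k1 k2 k3 : bool) (z w : cx * cx) :=
  (k1 && W1 z w) (+) (k2 && W2 z w) (+) (k3 && W3 z w).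

Lemma cocycle_scale (k : bool) W : cocycle O W -> cocycle O (fun z w => k && W z w).
Proof. by case: k => // _ u v w. Qed.

Lemma cocycle_combination k1 k2 k3 : cocycle O (combination k1 k2 k3).
Proof. by do 2?apply: cocycleD; apply: cocycle_scale. Qed.

Lemma mer_scale (k : bool) W x p : mer (fun z w => k && W z w) x p = k && mer W x p.
Proof.
case: k => //=; apply/negbF/asboolP; exists 1 => //.
by exists (fun=> false) => z _; exact: filterE.
Qed.

Lemma mer_combination k1 k2 k3 x p1 p2 p3 p : roots3 a b c x p1 p2 p3 ->
    distinct3 p1 p2 p3 -> f x p = 0 ->
  mer (combination k1 k2 k3) x p =
    (k1 && mer W1 x p) (+) (k2 && mer W2 x p) (+) (k3 && mer W3 x p).
Proof.
move=> h d fp; rewrite /combination.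
rewrite (merD (cocycleD (cocycle_scale k1 cW1) (cocycle_scale k2 cW2))
  (cocycle_scale k3 cW3) h d fp).
by rewrite (merD (cocycle_scale k1 cW1) (cocycle_scale k2 cW2) h d fp) !mer_scale.
Qed.

(** An injective endomorphism of [bool^3] hits the first basis vector. *)
Lemma injective_bool33 (u1 u2 u3 v1 v2 v3 w1 w2 w3 : bool) :
    (forall k1 k2 k3, k1 || k2 || k3 ->
       [|| (k1 && u1) (+) (k2 && u2) (+) (k3 && u3),
           (k1 && v1) (+) (k2 && v2) (+) (k3 && v3) |
           (k1 && w1) (+) (k2 && w2) (+) (k3 && w3)]) ->
  exists k1 k2 k3, [/\ (k1 && u1) (+) (k2 && u2) (+) (k3 && u3) = true,
    (k1 && v1) (+) (k2 && v2) (+) (k3 && v3) = false &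
    (k1 && w1) (+) (k2 && w2) (+) (k3 && w3) = false].
Proof.
move=> h.
have := (h true false false isT, h false true false isT, h false false true isT,
         h true true false isT, h true false true isT, h false true true isT, h true true true isT).
clear h.
case: u1; case: u2; case: u3; case: v1; case: v2; case: v3; case: w1; case: w2; case: w3 => //=;
  do ?[by case=> -[[[[[]]]]]];
  first [ by exists true, false, false | by exists false, true, false | by exists false, false, true
        | by exists true, true, false | by exists true, false, true | by exists false, true, true
        | by exists true, true, true ].
Qed.

(** The meridians over one good point embed the group spanned by the three cocycles
    in [bool^3], hence onto it, so that each of the three roots is singled out. *)
Lemma three_cocycles_roots :
    (forall k1 k2 k3, k1 || k2 || k3 -> ~ no_mer (combination k1 k2 k3)) ->
  exists L1 L2 L3, [/\ poly_root L1, poly_root L2, poly_root L3 &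
    [/\ L1 <> L2, L2 <> L3 & L1 <> L3]].
Proof.
move=> indep.
have [x gx] := good_exists disc0.
have [p1 [p2 [p3 [h d]]]] := good_roots gx.
have one q1 q2 q3 : roots3 a b c x q1 q2 q3 -> distinct3 q1 q2 q3 ->
    exists2 L, poly_root L & L.[x] = q1.
  move=> hq dq.
  have z1 : f x q1 = 0 by apply/(roots3_eq0 _ hq); constructor 1.
  have z2 : f x q2 = 0 by apply/(roots3_eq0 _ hq); constructor 2.
  have z3 : f x q3 = 0 by apply/(roots3_eq0 _ hq); constructor 3.
  have [|k1 [k2 [k3 [e1 e2 e3]]]] := @injective_bool33
      (mer W1 x q1) (mer W2 x q1) (mer W3 x q1) (mer W1 x q2) (mer W2 x q2) (mer W3 x q2)
      (mer W1 x q3) (mer W2 x q3) (mer W3 x q3).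
    move=> k1 k2 k3 /indep nk.
    rewrite -(mer_combination k1 k2 k3 hq dq z1) -(mer_combination k1 k2 k3 hq dq z2).
    rewrite -(mer_combination k1 k2 k3 hq dq z3).
    apply: contraPT nk; rewrite !negb_or => /and3P[/negbTE m1 /negbTE m2 /negbTE m3] nk.
    by apply: nk; apply: (no_merP (cocycle_combination k1 k2 k3) gx hq).
  apply: (mer_poly_root (cocycle_combination k1 k2 k3) gx hq);
    by rewrite (mer_combination k1 k2 k3 hq dq z2) e2
      ?(mer_combination k1 k2 k3 hq dq z1) ?(mer_combination k1 k2 k3 hq dq z3) ?e1 ?e3.
have [L1 r1 e1] := one _ _ _ h d.
have [L2 r2 e2] := one _ _ _ (roots3_rot h) (distinct3_rot d).
have [L3 r3 e3] := one _ _ _ (roots3_rot (roots3_rot h)) (distinct3_rot (distinct3_rot d)).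
have /and3P[/eqP n12 /eqP n23 /eqP n13] := d.
exists L1, L2, L3; split=> //; split=> e; [apply: n12|apply: n23|apply: n13];
  by rewrite -?e1 -?e2 -?e3 e.
Qed.

End Three.
End IndependentCocycles.

(** * Characters of the fundamental group and cocycles *)

Section Characters.
Variables (R : realType) (X : topologicalType) (x0 : X).
Local Notation I := (unit_interval R).
Local Notation path x y := {path I from x to y}.

Lemma path_homotopic_eq (x y : X) (p q : path x y) : p =1 q -> path_homotopic p q.
Proof.
move=> pq; apply: (@path_homotopic_reparam R X (fun r => p (clamp r)) id id) => //.
- by apply: continuous_path_clamp; exact: continuous_id.
- exact: continuous_id.
- exact: continuous_id.
- by move=> t; rewrite ivalK.
- by move=> t; rewrite ivalK pq.
Qed.

Definition character (chi : pi1 R x0 -> bool) :=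
  forall u v : pi1 R x0, chi (u * v)%g = chi u (+) chi v.

Variable chi : pi1 R x0 -> bool.
Variable gam : forall x : X, path x0 x.

Definition loop_value (p : path x0 x0) : bool := chi (\pi_(pi1 R x0) p).

Lemma loop_value_homotopic p q : path_homotopic p q -> loop_value p = loop_value q.
Proof. by rewrite /loop_value => /pi1_eqP ->. Qed.

(** The extension of a character to all paths, by means of the paths [gam] from the
    base point. *)
Definition path_value x y (p : path x y) : bool :=
  loop_value (path_cat (gam x) (path_cat p (path_rev (gam y)))).

Lemma path_value_homotopic x y (p q : path x y) :
  path_homotopic p q -> path_value p = path_value q.
Proof.
move=> pq; apply: loop_value_homotopic; apply: path_homotopic_cat.
  exact: path_homotopic_refl.
by apply: path_homotopic_cat => //; exact: path_homotopic_refl.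
Qed.

Lemma path_value_eq x y x' y' (p : path x y) (q : path x' y') :
  p =1 q -> path_value p = path_value q.
Proof.
move=> pq.
have ex : x = x' by have := pq zero; rewrite !path_zero.
have ey : y = y' by have := pq one; rewrite !path_one.
by subst x' y'; apply: path_value_homotopic; exact: path_homotopic_eq.
Qed.

Hypothesis chiM : character chi.

Lemma loop_value_cat p q : loop_value (path_cat p q) = loop_value p (+) loop_value q.
Proof. by rewrite /loop_value -pi1_mulE -chiM. Qed.

Lemma path_value_cat x y z (p : path x y) (q : path y z) :
  path_value (path_cat p q) = path_value p (+) path_value q.
Proof.
rewrite /path_value -loop_value_cat; apply: loop_value_homotopic.
set a := gam x; set b := gam y; set c := gam z.
have r u v (s : path u v) := path_homotopic_refl s.
have cat u v w (s s' : path u v) (t t' : path v w) := @path_homotopic_cat R X u v w s s' t t'.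
have tr u v (s t w : path u v) : path_homotopic s t -> path_homotopic t w ->
  path_homotopic s w := @path_homotopic_trans R X u v t s w.
apply: path_homotopic_sym.
apply: (tr _ _ _ (path_cat a (path_cat (path_cat p (path_rev b)) (path_cat b (path_cat q (path_rev c)))))).
  by apply: path_homotopic_sym; exact: path_catA.
apply: (cat); first exact: r.
apply: (tr _ _ _ (path_cat p (path_cat (path_rev b) (path_cat b (path_cat q (path_rev c)))))).
  by apply: path_homotopic_sym; exact: path_catA.
apply: (tr _ _ _ (path_cat p (path_cat q (path_rev c)))); last exact: path_catA.
apply: (cat); first exact: r.
apply: (tr _ _ _ (path_cat (path_cat (path_rev b) b) (path_cat q (path_rev c)))).
  exact: path_catA.
apply: (tr _ _ _ (path_cat (cst y) (path_cat q (path_rev c)))); last exact: path_cat1p.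
by apply: (cat); [exact: path_catVp|exact: r].
Qed.

Lemma path_value_idempotent x (p : path x x) :
  path_homotopic (path_cat p p) p -> path_value p = false.
Proof. by move=> /path_value_homotopic; rewrite path_value_cat; xor. Qed.

Lemma path_value_cst x : path_value (cst x : path x x) = false.
Proof. by apply: path_value_idempotent; exact: path_cat1p. Qed.

Lemma path_value_loop (p : path x0 x0) : path_value p = loop_value p.
Proof.
rewrite /path_value !loop_value_cat.
have idem (q : path x0 x0) : path_homotopic (path_cat q q) q -> loop_value q = false.
  by move=> /loop_value_homotopic; rewrite loop_value_cat; xor.
have : loop_value (path_cat (gam x0) (path_rev (gam x0))) = false.
  rewrite (loop_value_homotopic (path_catpV (gam x0))); apply: idem.
  exact: path_cat1p.
by rewrite loop_value_cat; xor.
Qed.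

End Characters.

Section Chart.
Variables (R : realType) (X : topologicalType) (V : normedModType R[i]) (O : set V).
Variables (e : X -> V) (g : V -> X).
Hypotheses (oO : open O) (ce : continuous e) (eO : forall z, O (e z)) (ge : cancel e g).
Hypotheses (eg : forall v, O v -> e (g v) = v) (cg : forall v, O v -> {for v, continuous g}).
Local Notation I := (unit_interval R).
Local Notation path x y := {path I from x to y}.

Lemma continuous_into (T : topologicalType) (h : T -> V) : continuous h ->
  (forall t, O (h t)) -> continuous (fun t => g (h t)).
Proof.
move=> ch hO t; apply: (@continuous_comp _ _ _ h g); first exact: ch.
exact: cg.
Qed.

Lemma continuous_seg (T : topologicalType) (h k : T -> V) (l : T -> R) :
  continuous h -> continuous k -> continuous l ->
  continuous (fun t => seg (h t) (k t) (l t)).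
Proof.
move=> ch ck cl t; apply: cvgD; first exact: ch.
apply: cvgZ; last by apply: cvgB; [exact: ck|exact: ch].
have cr : continuous (fun s : R => s%:C%C : R[i]^o).
  move=> s; have := @seg_continuous R (R[i]^o) 0 1 s.
  have -> : seg (0 : R[i]^o) 1 = fun s : R => s%:C%C.
    by apply/funext => r; rewrite /seg subr0 add0r /GRing.scale /= mulr1.
  exact.
exact: (@continuous_comp _ _ _ l (fun s : R => s%:C%C : R[i]^o) t (cl t) (@cr _)).
Qed.

Lemma straight_homotopy (x y : X) (p q : path x y) :
  (forall t s, 0 <= s <= 1 -> O (seg (e (p t)) (e (q t)) s)) -> path_homotopic p q.
Proof.
move=> h; exists (fun u : I * I => g (seg (e (p u.2)) (e (q u.2)) (ival u.1))).
have i01 (t : I) : 0 <= ival t <= 1 by rewrite ival_ge0 ival_le1.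
split=> [|t|t|s|s] /=.
- apply: continuous_into; last by move=> u; exact: h.
  have cp (r : path x y) : continuous (fun u : I * I => e (r u.2)).
    move=> u; apply: (@continuous_comp _ _ _ snd (fun t => e (r t))).
      exact: cvg_snd.
    by apply: (@continuous_comp _ _ _ r e); [exact: path_continuous|exact: ce].
  apply: continuous_seg => //; exact: ival_fst_continuous.
- by rewrite ival0 seg0 ge.
- by rewrite ival1 seg1 ge.
- by rewrite !path_zero segxx ge.
- by rewrite !path_one segxx ge.
Qed.

Definition in_seg (a b : V) := forall t, 0 <= t <= 1 -> O (seg a b t).

Lemma seg_path_exists (a b : V) : in_seg a b ->
  exists p : path (g a) (g b), forall t, p t = g (seg a b (ival t)).
Proof.
move=> ab; pose h (t : I) := g (seg a b (ival t)).
have ch : continuous h.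
  apply: continuous_into; last by move=> t; apply: ab; rewrite ival_ge0 ival_le1.
  move=> t; apply: (@continuous_comp _ _ _ (@ival R) (seg a b)).
    exact: ival_continuous.
  exact: seg_continuous.
have h0 : h zero = g a by rewrite /h ival0 seg0.
have h1 : h one = g b by rewrite /h ival1 seg1.
by exists (mk_path ch h0 h1).
Qed.

Definition triangle (a b c : V) : set V := [set z | exists s t, [/\ 0 <= s, 0 <= t, s + t <= 1 &
  z = a + s%:C%C *: (b - a) + t%:C%C *: (c - a)]].

Lemma convex_triangle a b c : convex (triangle a b c).
Proof.
move=> z z' r [s [t [s0 t0 st ->]]] [s' [t' [s0' t0' st' ->]]] /andP[r0 r1].
exists ((1 - r) * s + r * s'), ((1 - r) * t + r * t').
have r1' : 0 <= 1 - r by rewrite subr_ge0.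
split; [by rewrite addr_ge0// mulr_ge0|by rewrite addr_ge0// mulr_ge0|by nra|].
rewrite segE -!addrA; move: (b - a) (c - a) => u v; rewrite !scalerDr !scalerA -!rmorphM /=.
rewrite addrACA -scalerDl -rmorphD /= subrK scale1r; congr (a + _).
by rewrite addrACA -!scalerDl -!rmorphD.
Qed.

Lemma triangle_hull a b c : (forall s t, 0 <= s <= 1 -> 0 <= t <= 1 ->
  O (seg a (seg b c t) s)) -> triangle a b c `<=` O.
Proof.
move=> h z [s [t [s0 t0 st ->]]].
have [st0|st0] := eqVneq (s + t) 0.
  have [-> ->] : s = 0 /\ t = 0 by lra.
  have := h 0 0; rewrite lexx ler01 !seg0 => /(_ isT isT).
  by rewrite !scale0r !addr0.
have stp : 0 < s + t by rewrite lt_neqAle eq_sym st0 addr_ge0.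
have := h (s + t) (t / (s + t)).
rewrite addr_ge0// st divr_ge0 ?addr_ge0//= ler_pdivrMr// mul1r lerDr s0 => /(_ isT isT).
congr O; rewrite {1}/seg segB scalerDr !scalerA -!rmorphM /= addrA.
have -> : (s + t) * (1 - t / (s + t)) = s by field.
by have -> : (s + t) * (t / (s + t)) = t by field.
Qed.

Section Cocycle.
Variables (x0 : X) (chi : pi1 R x0 -> bool) (gam : forall x : X, path x0 x).
Hypothesis chiM : character chi.
Local Notation value := (path_value chi gam).

(** The path over the segment is unique if it exists; a truth value avoids choosing it. *)
Definition chord (a b : V) : bool :=
  `[< exists2 p : path (g a) (g b), (forall t, p t = g (seg a b (ival t))) & value p >].

Lemma chordE (a b : V) (p : path (g a) (g b)) : (forall t, p t = g (seg a b (ival t))) ->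
  chord a b = value p.
Proof.
move=> pE; apply/asboolP/idP => [[q qE]|vp]; last by exists p.
by rewrite (path_value_eq chi gam (q := p)) // => t; rewrite qE pE.
Qed.

(** A side of a triangle is homotopic to the two other sides by a straight homotopy,
    which stays in the triangle. *)
Lemma chord_cocycle : cocycle O chord.
Proof.
move=> a b c /triangle_hull TO.
have T s t : 0 <= s -> 0 <= t -> s + t <= 1 ->
  triangle a b c (a + s%:C%C *: (b - a) + t%:C%C *: (c - a)) by move=> *; exists s, t.
have Ta : triangle a b c a.
  by have := T 0 0 (lexx _) (lexx _); rewrite !scale0r !addr0 ler01; exact.
have Tb : triangle a b c b.
  have := T 1 0 ler01 (lexx _); rewrite scale0r scale1r !addr0 lexx addrC subrK; exact.
have Tc : triangle a b c c.
  have := T 0 1 (lexx _) ler01; rewrite scale0r scale1r addr0 add0r lexx addrC subrK; exact.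
have sT u v t : triangle a b c u -> triangle a b c v -> 0 <= t <= 1 ->
  triangle a b c (seg u v t) by move=> ? ? ?; exact: convex_triangle.
have ex u v : triangle a b c u -> triangle a b c v ->
  exists p : path (g u) (g v), forall t, p t = g (seg u v (ival t)).
  by move=> uT vT; apply: seg_path_exists => t t01; apply: TO; exact: sT.
have [p pE] := ex a b Ta Tb; have [q qE] := ex b c Tb Tc; have [r rE] := ex a c Ta Tc.
rewrite (chordE pE) (chordE qE) (chordE rE) -path_value_cat//.
apply: path_value_homotopic; apply: straight_homotopy => t s s01; apply: (TO).
have i01 (u : I) : 0 <= ival u <= 1 by rewrite ival_ge0 ival_le1.
apply: (sT) => //; first by rewrite rE eg; [exact: sT|apply: TO; exact: sT].
rewrite /= /mk_path /path_cat_fun; case: ifP => _; rewrite ?pE ?qE eg; try exact: sT;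
  by apply: TO; exact: sT.
Qed.

(** Along the initial pieces of a loop, the value of the character differs from
    the potential by a locally constant function. *)
Lemma character_trivial_on (S : set V) Phi (p : path x0 x0) : S `<=` O -> open S ->
  potential chord S Phi -> (forall t, S (e (p t))) -> chi (\pi_(pi1 R x0) p) = false.
Proof.
move=> SO oS pPhi pS.
pose q (u : R) := p (clamp u).
have cq : continuous q by apply: continuous_path_clamp; exact: continuous_id.
have part_cont (s u : R) : continuous (fun t : I => q ((u - s) * ival t + s)).
  apply: (@continuous_path_clamp R X _ _ _ p).
  by apply: continuous_affine; exact: ival_continuous.
have part0 (s u : R) : q ((u - s) * ival (zero : I) + s) = q s by rewrite ival0 mulr0 add0r.
have part1 (s u : R) : q ((u - s) * ival (one : I) + s) = q u by rewrite ival1 mulr1 subrK.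
pose part (s u : R) : path (q s) (q u) := mk_path (@part_cont s u) (part0 s u) (part1 s u).
have partE s u t : part s u t = q ((u - s) * ival t + s) by [].
have part_cat (s u : R) : value (part 0 u) = value (part 0 s) (+) value (part s u).
  rewrite -path_value_cat//; apply: path_value_homotopic; apply: path_homotopic_sym.
  apply: (@path_homotopic_reparam R X q
    (fun t => s * Num.min (2 * t + 0) 1 + (u - s) * Num.max 0 (2 * t + -1))
    (fun t => u * t + 0)).
  - exact: cq.
  - have cid : continuous (id : R -> R) by exact: continuous_id.
    have c1 : continuous (fun t : R => s * Num.min (2 * t + 0) 1).
      apply: continuous_scale; apply: continuous_minr; first exact: continuous_affine.
      exact: cst_continuous.
    have c2 : continuous (fun t : R => (u - s) * Num.max 0 (2 * t + -1)).
      apply: continuous_scale; apply: continuous_maxr; last exact: continuous_affine.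
      exact: cst_continuous.
    by move=> t; apply: cvgD; [exact: c1|exact: c2].
  - by apply: continuous_affine; exact: continuous_id.
  - by rewrite (min_idPl _); [|lra]; rewrite (max_idPl _); [|lra]; lra.
  - by rewrite (min_idPr _); [|lra]; rewrite (max_idPr _); [|lra]; lra.
  - move=> t; have t0 := ival_ge0 t; have t1 := ival_le1 t.
    rewrite /= /mk_path /path_cat_fun /=; case: (leP (ival t) 2^-1) => th.
      rewrite /mk_path clampK; last by lra.
      by rewrite (min_idPl _); [|lra]; rewrite (max_idPl _); [|lra]; congr q; lra.
    rewrite /mk_path clampK; last by lra.
    by rewrite (min_idPr _); [|lra]; rewrite (max_idPr _); [|lra]; congr q; lra.
  - by move=> t; rewrite partE subr0.
have Sq u : S (e (q u)) by exact: pS.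
(* Near [u], the piece of [p] between [s] and [u] is homotopic to a segment. *)
have lc : value (part 0 0) (+) Phi (e (q 0)) = value (part 0 1) (+) Phi (e (q 1)).
  apply: (@constant_on_unit_interval R (fun u => value (part 0 u) (+) Phi (e (q u)))).
  move=> u _; have [N [cN oN Nu NO]] := nbhs_convex (open_nbhs_nbhs (conj oS (Sq u))).
  have ceq : continuous (fun s : R => e (q s)).
    by move=> s; apply: (@continuous_comp _ _ _ q e); [exact: cq|exact: ce].
  have nN : \forall s \near u, N (e (q s)).
    by apply: (ceq u); apply: open_nbhs_nbhs.
  have nP : \forall s \near u, chord (e (q s)) (e (q u)) = Phi (e (q s)) (+) Phi (e (q u)).
    exact: (ceq u _ (pPhi _ (Sq u))).
  have [d /= d0 dP] := nN.
  have nd : \forall s \near u, `|u - s| < d by exact: nbhsx_ballx.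
  near=> s => _.
  have sd : `|u - s| < d by near: s.
  have sP : chord (e (q s)) (e (q u)) = Phi (e (q s)) (+) Phi (e (q u)) by near: s.
  have Ns : N (e (q s)) by apply: dP.
  have SN : N `<=` O by move=> z /NO/SO.
  have [r rE] : exists r : path (g (e (q s))) (g (e (q u))),
      forall t, r t = g (seg (e (q s)) (e (q u)) (ival t)).
    by apply: seg_path_exists => t t01; apply: SN; exact: cN.
  have : chord (e (q s)) (e (q u)) = value (part s u).
    rewrite (chordE rE).
    have i01 (t : I) : 0 <= ival t <= 1 by rewrite ival_ge0 ival_le1.
    have r0 : r zero = q s by rewrite path_zero ge.
    have r1 : r one = q u by rewrite path_one ge.
    pose r' : path (q s) (q u) := mk_path (@path_continuous R X _ _ r) r0 r1.
    rewrite (path_value_eq chi gam (q := r'))//.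
    apply: path_value_homotopic; apply: straight_homotopy => t t' t01; apply: (SN).
    apply: (cN) => //; first by rewrite /= /mk_path rE eg; [|apply: (SN)]; apply: (cN).
    rewrite partE; apply: dP => /=.
    have -> : u - ((u - s) * ival t + s) = (u - s) * (1 - ival t) by ring.
    have /andP[t0 t1] := i01 t.
    rewrite normrM; apply: le_lt_trans sd; rewrite ler_piMr//.
    by rewrite ger0_norm; lra.
  by rewrite sP (part_cat s u); xor.
have q0 : q 0 = x0 by rewrite /q clamp0 path_zero.
have q1 : q 1 = x0 by rewrite /q clamp1 path_one.
have v0 : value (part 0 0) = false.
  rewrite (path_value_eq chi gam (q := cst (q 0) : path (q 0) (q 0))); first exact: path_value_cst.
  by move=> t; rewrite partE subrr mul0r add0r.
have v1 : value (part 0 1) = chi (\pi_(pi1 R x0) p).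
  rewrite (path_value_eq chi gam (q := p)); first exact: path_value_loop.
  by move=> t; rewrite partE subr0 mul1r addr0 /q ivalK.
transitivity (value (part 0 1)); first exact/esym.
have q01 : Phi (e (q 0)) = Phi (e (q 1)) by rewrite q0 q1.
by move: lc; rewrite v0 q01; xor.
Unshelve. all: by end_near. Qed.

End Cocycle.
End Chart.

(** * From characters to polynomial roots *)

Section CurveChart.
Variables (R : realType) (X : topologicalType).
Local Notation cx := (R[i]^o).
Variables a b c : {poly R[i]}.
Local Notation f := (cubic a b c).
Local Notation O := (curve_complement a b c).
Local Notation I := (unit_interval R).
Local Notation path x y := {path I from x to y}.
Variables (e : X -> (cx * cx)%type) (g : (cx * cx)%type -> X).
Hypotheses (ce : continuous e) (eO : forall z, O (e z)) (ge : cancel e g).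
Hypotheses (eg : forall v, O v -> e (g v) = v) (cg : forall v, O v -> {for v, continuous g}).

(** Some ray with positive real direction misses the three roots. *)
Lemma ray_to_infinity x y (M : R) : O (x, y) ->
  exists y', M < Re y' /\ in_seg O (x, y) (x, y').
Proof.
move=> fy; have [p1 [p2 [p3 h]]] := roots3_exists a b c x.
pose slope (p : cx) : R := Im (p - y) / Re (p - y).
have [m [_ _ ms]] := small_avoiding [:: slope p1; slope p2; slope p3] ltr01.
pose T : R := `|M - Re y| + 1.
have T0 : 0 < T by rewrite ltr_wpDl.
exists (y + T%:C%C * (1 +i* m)%C); split.
  rewrite ReD /= mul0r subr0 mulr1 /T.
  by have := ler_norm (M - Re y); lra.
move=> t /andP[t0 t1]; rewrite seg_pair segxx.
have -> : seg y (y + T%:C%C * (1 +i* m)%C) t = y + t%:C%C *: (T%:C%C * (1 +i* m)%C : cx).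
  by rewrite /seg [_ + _ - y]addrAC subrr add0r.
move=> /= z.
set s := t * T; have sE : t%:C%C *: (T%:C%C * (1 +i* m)%C : cx) = (s +i* (s * m))%C.
  rewrite /GRing.scale /= mulrA -rmorphM /= -/s.
  by apply/eqP; rewrite eq_complex /= !mul0r subr0 addr0 mulr1 !eqxx.
have z' : f x (y + (s +i* (s * m))%C) = 0 by rewrite -sE.
have [s0|s0] := eqVneq s 0.
  by apply: fy; move: z'; rewrite s0 mul0r addr0.
have slopeE : slope (y + (s +i* (s * m))%C) = m.
  by rewrite /slope (addrC y) addrK /= mulrAC divff// mul1r.
move: ms; rewrite !inE !negb_or => /and3P[m1 m2 m3].
have /(roots3_eq0 _ h)[] := z' => pE; [move: m1|move: m2|move: m3];
  by rewrite -pE slopeE eqxx.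
Qed.

Lemma seg_path (x y : X) : in_seg O (e x) (e y) -> exists p : path x y, True.
Proof.
move=> /(seg_path_exists cg)[p _]; move: p; rewrite !ge => p.
by exists p.
Qed.

(** From each point follow a ray until it is above the curve over a large disc; the
    region reached is convex. *)
Lemma chart_path_connected (x y : X) : exists p : path x y, True.
Proof.
pose r := Num.max (nm (e x).1) (nm (e y).1) + 1.
have [M MP] := cubic_roots_bounded a b c r.
have xr : nball 0 r (e x).1.
  have : nm (e x).1 <= Num.max (nm (e x).1) (nm (e y).1) by rewrite le_max lexx.
  by rewrite /nball /= subr0 /r; lra.
have yr : nball 0 r (e y).1.
  have : nm (e y).1 <= Num.max (nm (e x).1) (nm (e y).1) by rewrite le_max lexx orbT.
  by rewrite /nball /= subr0 /r; lra.
pose T : set (cx * cx) := nball 0 r `*` above Re M.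
have TO : T `<=` O.
  move=> z [zr zM] /(MP _ _ _) h; move: zr; rewrite /nball /= subr0 => /h zM'.
  have := le_lt_trans (ler_norm (Re z.2)) (le_lt_trans (nm_Re z.2) zM').
  by move: zM; rewrite /above /=; lra.
have cT : convex T.
  by apply: convexX; [exact: convex_nball|apply: convex_above; exact: coordinate_Re].
have Oxy z : O ((e z).1, (e z).2) by rewrite -surjective_pairing.
have [u [uM xu]] := ray_to_infinity M (Oxy x).
have [v [vM yv]] := ray_to_infinity M (Oxy y).
have Tu : T ((e x).1, u) by split.
have Tv : T ((e y).1, v) by split.
rewrite -surjective_pairing in xu; rewrite -surjective_pairing in yv.
have [p _] : exists p : path x (g ((e x).1, u)), True.
  by apply: seg_path; rewrite eg//; exact: TO.
have [q _] : exists p : path (g ((e x).1, u)) (g ((e y).1, v)), True.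
  by apply: seg_path; rewrite !eg; [move=> t t01; apply: TO; apply: cT|exact: TO|exact: TO].
have [s _] : exists p : path (g ((e y).1, v)) y, True.
  apply: seg_path; rewrite eg; last exact: TO.
  by move=> t /andP[t0 t1]; rewrite seg_rev; apply: yv; rewrite subr_ge0 t1 gerBl.
by exists (path_cat p (path_cat q s)).
Qed.

Hypothesis disc0 : disc a b c != 0.
Variables (x0 : X) (gam : forall x : X, path x0 x).
Implicit Types chi : pi1 R x0 -> bool.
Local Notation edge chi := (chord g chi gam).

(** Over a disc of parameters containing a given loop, the cocycle of the character has
    a potential, and the character is trivial on loops there. *)
Lemma character_no_mer chi : character chi -> no_mer a b c (edge chi) ->
  forall u, chi u = false.
Proof.
move=> chiM nomer u; rewrite -[u]reprK; set p := repr u.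
(* The first coordinate of the loop is bounded, by compactness. *)
have [r rP] : exists r : R, forall t, nm (e (p t)).1 < r.
  pose h (s : R) := nm (e (p (clamp s))).1.
  have ch : continuous h.
    move=> s; apply: (@continuous_comp _ _ _ (fun s => (e (p (clamp s))).1) nm).
      apply: (@continuous_comp _ _ _ (fun s => e (p (clamp s))) fst); last exact: cvg_fst.
      apply: (@continuous_comp _ _ _ (fun s => p (clamp s)) e); last exact: ce.
      by apply: continuous_path_clamp; exact: continuous_id.
    exact: continuous_nm.
  have [s _ sP] := EVT_max ler01 (continuous_subspaceT ch).
  exists (h s + 1) => t; apply: le_lt_trans (_ : h s < _); last by rewrite ltrDl.
  by rewrite -[t]ivalK; apply: sP; rewrite in_itv /= ival_ge0 ival_le1.
have cW := chord_cocycle ce ge eg cg gam chiM.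
have [Phi pPhi] := exact_no_mer cW disc0 r nomer.
apply: (character_trivial_on ce ge eg cg chiM _ _ pPhi).
- by move=> z [].
- apply: openI; first exact: open_curve_complement.
  by apply: openX; [exact: open_nball|exact: openT].
- by move=> t; split=> //; split=> //; rewrite /nball /= subr0.
Qed.

Lemma characterD chi chi' : character chi -> character chi' ->
  character (fun u => chi u (+) chi' u).
Proof. by move=> h h' u v; rewrite h h'; xor. Qed.

Lemma character_scale (k : bool) chi : character chi -> character (fun u => k && chi u).
Proof. by case: k => // _ u v. Qed.

Lemma chordD chi chi' :
  edge (fun u => chi u (+) chi' u) = fun z w => edge chi z w (+) edge chi' z w.
Proof.
apply/funext => z; apply/funext => w.
have [[p pE]|none] := pselect (exists p : path (g z) (g w),
    forall t, p t = g (seg z w (ival t))).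
  by rewrite !(chordE chi gam pE) !(chordE chi' gam pE) (chordE _ gam pE).
by rewrite /chord !asboolF // => -[p pE _]; apply: none; exists p.
Qed.

Lemma chord_scale (k : bool) chi : edge (fun u => k && chi u) = fun z w => k && edge chi z w.
Proof.
apply/funext => z; apply/funext => w.
have [[p pE]|none] := pselect (exists p : path (g z) (g w),
    forall t, p t = g (seg z w (ival t))).
  by rewrite !(chordE chi gam pE) (chordE _ gam pE).
by rewrite /chord !asboolF ?andbF // => -[p pE _]; apply: none; exists p.
Qed.

Definition nontrivial chi := exists u, chi u.

Lemma nontrivial_mer chi : character chi -> nontrivial chi -> ~ no_mer a b c (edge chi).
Proof. by move=> chiM [u cu] /(character_no_mer chiM)/(_ u); rewrite cu. Qed.

Lemma two_characters_root chi1 chi2 : character chi1 -> character chi2 ->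
    nontrivial chi1 -> nontrivial chi2 -> nontrivial (fun u => chi1 u (+) chi2 u) ->
  exists L, poly_root a b c L.
Proof.
move=> c1 c2 n1 n2 n12.
apply: (two_cocycles_root disc0 (chord_cocycle ce ge eg cg gam c1)
  (chord_cocycle ce ge eg cg gam c2)).
- exact: nontrivial_mer.
- exact: nontrivial_mer.
- by rewrite -chordD; apply: nontrivial_mer => //; exact: characterD.
Qed.

Lemma three_characters_roots chi1 chi2 chi3 :
    character chi1 -> character chi2 -> character chi3 ->
    (forall k1 k2 k3, k1 || k2 || k3 ->
       nontrivial (fun u => (k1 && chi1 u) (+) (k2 && chi2 u) (+) (k3 && chi3 u))) ->
  exists L1 L2 L3, [/\ poly_root a b c L1, poly_root a b c L2, poly_root a b c L3 &
    [/\ L1 <> L2, L2 <> L3 & L1 <> L3]].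
Proof.
move=> c1 c2 c3 indep.
apply: (three_cocycles_roots disc0 (chord_cocycle ce ge eg cg gam c1)
  (chord_cocycle ce ge eg cg gam c2) (chord_cocycle ce ge eg cg gam c3)).
move=> k1 k2 k3 /indep nk.
have -> : combination (edge chi1) (edge chi2) (edge chi3) k1 k2 k3 =
    edge (fun u => (k1 && chi1 u) (+) (k2 && chi2 u) (+) (k3 && chi3 u)).
  by rewrite !chordD !chord_scale.
by apply: nontrivial_mer => //; do 2?apply: characterD; exact: character_scale.
Qed.

End CurveChart.

(** * Sign characters from square roots *)

Section SquareRoots.
Variable R : realType.
Local Notation cx := (R[i]^o).
Local Notation I := (unit_interval R).
Implicit Types z w : cx.

(** The sum of [z] and its modulus bisects the argument of [z]; scaled, it is the
    principal square root. *)
Definition psqrt z : cx := (Num.sqrt (2 * (nm z + Re z)))^-1%:C%C * (z + (nm z)%:C%C).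

Lemma near1_Re z : nm (z - 1) < 1 -> 0 < Re z.
Proof.
move=> z1; have := le_lt_trans (nm_Re (z - 1)) z1.
by rewrite ReD ReN /= ltr_norml; lra.
Qed.

Lemma psqrtK z : nm (z - 1) < 1 -> psqrt z ^+ 2 = z.
Proof.
move=> /near1_Re rz; have n0 := nm_ge0 z.
have s0 : 0 < 2 * (nm z + Re z) by rewrite mulr_gt0// ltr_wpDl.
rewrite /psqrt exprMn -rmorphXn /= exprVn sqr_sqrtr ?ltW//.
have -> : (z + (nm z)%:C%C) ^+ 2 = (2 * (nm z + Re z))%:C%C * z.
  have := nm_sqr z; move: (nm z) => n; case: z {rz n0 s0} => x y /= nE.
  have yy : y ^+ 2 = n ^+ 2 - x ^+ 2 by rewrite nE; ring.
  apply/eqP; rewrite expr2 eq_complex /=; apply/andP; split; apply/eqP; last by ring.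
  by transitivity ((x + n) ^+ 2 - y ^+ 2); [ring|rewrite yy; ring].
by rewrite mulrA -rmorphM /= mulVf ?gt_eqF// mul1r.
Qed.

Lemma continuous_real_complex : continuous (fun s : R => s%:C%C : cx).
Proof.
move=> s; have := @seg_continuous R cx 0 1 s.
have -> : seg (0 : cx) 1 = fun s : R => s%:C%C.
  by apply/funext => r; rewrite /seg subr0 add0r /GRing.scale /= mulr1.
exact.
Qed.

Lemma continuous_Re : continuous (fun z : cx => Re z : R).
Proof.
move=> z A /nbhs_ballP[e /= e0 eA]; apply/nbhs_nmP; exists e => // w wz; apply: eA.
by rewrite /ball /= -ReN -ReD; apply: le_lt_trans (nm_Re _) _; rewrite nmBC.
Qed.

Section Continuity.
Variable T : topologicalType.
Implicit Types u v : T -> cx.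

Lemma continuous_mulc u v : continuous u -> continuous v -> continuous (fun t => u t * v t : cx).
Proof. by move=> cu cv t; apply: cvgM; [exact: cu|exact: cv]. Qed.

Lemma continuous_divc u v : continuous u -> continuous v -> (forall t, v t != 0) ->
  continuous (fun t => u t / v t : cx).
Proof. by move=> cu cv v0 t; apply: cvgM; [exact: cu|apply: cvgV; [exact: v0|exact: cv]]. Qed.

Lemma continuous_oppc u : continuous u -> continuous (fun t => - u t : cx).
Proof. by move=> cu t; apply: cvgN; exact: cu. Qed.

Lemma continuous_addc u v : continuous u -> continuous v -> continuous (fun t => u t + v t : cx).
Proof. by move=> cu cv t; apply: cvgD; [exact: cu|exact: cv]. Qed.

Lemma continuous_psqrt u : continuous u -> (forall t, nm (u t - 1) < 1) ->
  continuous (fun t => psqrt (u t)).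
Proof.
move=> cu u1.
have cn : continuous (fun t => nm (u t)).
  by apply: continuous_compose cu _; exact: continuous_nm.
apply: continuous_mulc; last first.
  exact: (continuous_addc cu (continuous_compose cn continuous_real_complex)).
apply: (@continuous_compose _ _ _ (fun t => (Num.sqrt (2 * (nm (u t) + Re (u t))))^-1)
  (fun s : R => s%:C%C : cx)); last exact: continuous_real_complex.
have cs : continuous (fun t => Num.sqrt (2 * (nm (u t) + Re (u t)))).
  apply: (@continuous_compose _ _ _ (fun t => 2 * (nm (u t) + Re (u t))) Num.sqrt).
    apply: continuous_scale; apply: continuous_add => //.
    exact: (continuous_compose cu continuous_Re).
  exact: sqrt_continuous.
move=> t; apply: cvgV; last exact: cs.
rewrite gt_eqF// sqrtr_gt0 mulr_gt0//.
by rewrite ltr_wpDl ?nm_ge0//; exact: near1_Re.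
Qed.

End Continuity.

(** Uniform continuity, from the compactness of the square. *)
Lemma uniform_ratio (G : I * I -> cx) : continuous G -> (forall u, G u != 0) ->
  exists2 d : R, 0 < d & forall s t t' : R, 0 <= s <= 1 -> 0 <= t <= 1 ->
    `|t' - t| <= d -> nm (G (clamp s, clamp t') / G (clamp s, clamp t) - 1) < 1.
Proof.
move=> cG G0; pose H (u : R * R) := G (clamp u.1, clamp u.2).
have cH : continuous H.
  by apply: continuous_clamp_pair => //; [move=> ?; exact: cvg_fst|move=> ?; exact: cvg_snd].
pose K : set (R * R) := `[0, 1]%classic `*` `[0, 1]%classic.
have cK : compact K by apply: compact_setX; exact: segment_compact.
pose P (d : R) (u : R * R) := forall t', `|t' - u.2| <= `|d| ->
  nm (H (u.1, t') / H u - 1) < 1.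
have /(_ R (nbhs (0 : R)) P) h := (compact_near_coveringP K).1 cK.
have : \forall d \near (0 : R), K `<=` P d.
  apply: h => u Ku.
  have Hu : 0 < nm (H u) / 4 by rewrite divr_gt0// nm_gt0; exact: G0.
  have := cH u _ (nbhs_nball (H u) Hu).
  move=> [[A B] /= [/nbhs_ballP[r /= r0 rA] /nbhs_ballP[q /= q0 qB]] AB].
  have q2 : 0 < q / 2 by rewrite divr_gt0.
  exists (ball u.1 r `*` ball u.2 (q / 2), ball (0 : R) (q / 2)) => /=.
    split; last exact: nbhsx_ballx.
    exists (ball u.1 r, ball u.2 (q / 2)) => //; split; exact: nbhsx_ballx.
  move=> [v d] [/= [v1 v2] d0] t' t'v.
  have near t : ball u.2 q t -> nm (H (v.1, t) - H u) < nm (H u) / 4.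
    by move=> tq; apply: (AB (v.1, t)); split; [apply: rA|apply: qB].
  have h1 := near v.2; have h2 := near t'.
  have {}h1 : nm (H v - H u) < nm (H u) / 4.
    rewrite [v in H v]surjective_pairing; apply: h1.
    by move: v2; rewrite /ball /=; lra.
  have {}h2 : nm (H (v.1, t') - H u) < nm (H u) / 4.
    apply: h2; move: v2 d0 t'v; rewrite /ball /= sub0r normrN.
    have := ler_distD v.2 u.2 t'; rewrite (distrC v.2 t'); lra.
  have Hv0 : H v != 0 by exact: G0.
  have Hv : nm (H u) * 3 / 4 <= nm (H v).
    have := nm_tri (H u) (H v) 0; rewrite !subr0 (nmBC (H u)); lra.
  have -> : H (v.1, t') / H v - 1 = (H (v.1, t') - H v) / H v by rewrite mulrBl divff.
  rewrite nmM nmV ltr_pdivrMr ?nm_gt0// mul1r.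
  by have := nm_tri (H (v.1, t')) (H u) (H v); rewrite (nmBC (H u)); lra.
move=> /nbhs_ballP[d /= d0 dP]; exists (d / 2); first by rewrite divr_gt0.
move=> s t t' s01 t01 tt.
have d2 : ball (0 : R) d (d / 2) by rewrite /ball /= sub0r normrN ger0_norm; lra.
apply: (dP _ d2 (s, t)) => /=; last by rewrite [`|d / 2|]ger0_norm; lra.
by split; rewrite /= in_itv.
Qed.

Lemma min_dist (s t d : R) : 0 <= d -> `|Num.min s (t + d) - Num.min s t| <= d.
Proof. by case: (leP s (t + d)); case: (leP s t) => *; rewrite ler_norml; lra. Qed.

(** A square root along the first coordinate axis extends step by step, the ratio of
    the values at consecutive steps being close to 1. *)
Lemma square_root_lift (G : I * I -> cx) k : continuous G -> (forall u, G u != 0) ->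
  (forall s, G (s, zero) = k) ->
  exists2 sg : I * I -> cx, continuous sg & forall u, sg u ^+ 2 = G u.
Proof.
move=> cG G0 Gk; have [d d0 dP] := uniform_ratio cG G0.
have [n nd] : exists n : nat, n.+1%:R^-1 <= d.
  exists (Num.truncn d^-1); rewrite invf_ple ?posrE//.
  by apply/ltW/truncnS_gt.
(* [lev m] cuts the second coordinate off at [m / n.+1]. *)
pose lev m (t : I) : I := clamp (Num.min (ival t) (m%:R / n.+1%:R)).
have clev m : continuous (fun u : I * I => G (clamp (ival u.1), lev m u.2)).
  apply: (@continuous_clamp_pair R _ _ G (fun u : I * I => ival u.1)
    (fun u : I * I => Num.min (ival u.2) (m%:R / n.+1%:R))) => //.
    exact: ival_fst_continuous.
  apply: continuous_minr; first exact: ival_snd_continuous.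
  exact: cst_continuous.
have step m : exists2 sg : I * I -> cx, continuous sg &
    forall u, sg u ^+ 2 = G (clamp (ival u.1), lev m u.2).
  elim: m => [|m [sg csg sgP]].
    exists (fun=> sqrtc k : cx); first exact: cst_continuous.
    move=> u; rewrite sqr_sqrtc /lev mul0r (min_idPr (ival_ge0 _)) clamp0.
    by rewrite Gk.
  exists (fun u => sg u * psqrt (G (clamp (ival u.1), lev m.+1 u.2) /
                                 G (clamp (ival u.1), lev m u.2))); last first.
    move=> u; rewrite exprMn sgP psqrtK; first by rewrite mulrC divfK.
    have t0 := ival_ge0 u.2; have t1 := ival_le1 u.2.
    have m0 : 0 <= m%:R / n.+1%:R :> R by rewrite divr_ge0.
    apply: dP; first by rewrite ival_ge0 ival_le1.
      by rewrite le_min t0 m0 ge_min t1.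
    apply: le_trans nd; rewrite -natr1 mulrDl mul1r.
    have p0 : 0 < n.+1%:R^-1 :> R by rewrite invr_gt0.
    by apply: min_dist; exact: ltW.
  apply: (continuous_mulc csg); apply: (continuous_psqrt
    (continuous_divc (clev m.+1) (clev m) (fun u => G0 _))).
  move=> u; have t0 := ival_ge0 u.2; have t1 := ival_le1 u.2.
  have m0 : 0 <= m%:R / n.+1%:R :> R by rewrite divr_ge0.
  apply: dP; first by rewrite ival_ge0 ival_le1.
    by rewrite le_min t0 m0 ge_min t1.
  apply: le_trans nd; rewrite -natr1 mulrDl mul1r.
  have p0 : 0 < n.+1%:R^-1 :> R by rewrite invr_gt0.
  by apply: min_dist; exact: ltW.
have [sg csg sgP] := step n.+1; exists sg => // u; rewrite sgP /lev.
by rewrite divff ?pnatr_eq0// (min_idPl (ival_le1 _)) !ivalK -surjective_pairing.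
Qed.

(** Two square roots differ by a sign, which is locally constant. *)
Lemma square_root_unique (u v : I -> cx) : continuous u -> continuous v ->
  (forall t, u t ^+ 2 = v t ^+ 2) -> (forall t, v t != 0) -> u zero = v zero -> u one = v one.
Proof.
move=> cu cv uv v0 e0.
pose r (t : I) : cx := u t / v t.
have cr : continuous r := continuous_divc cu cv v0.
have r1 t : r t = 1 \/ r t = -1.
  have /eqP : r t ^+ 2 = 1 by rewrite /r exprMn exprVn uv divff// expf_neq0.
  by rewrite sqrf_eq1 => /orP[]/eqP ->; [left|right].
pose P (s : R) := r (clamp s) == 1.
have : P 0 = P 1.
  apply: (@constant_on_unit_interval R P) => s _.
  have crs : continuous (fun s : R => r (clamp s)).
    exact: (continuous_compose (@clamp_continuous R) cr).
  have : \forall s' \near s, nball (r (clamp s)) 1 (r (clamp s')).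
    by apply: (crs s); exact: nbhs_nball.
  apply: filterS => s'; rewrite /nball /= => rr _.
  have n2 : nm (1 - -1 : cx) = 2.
    have -> : (1 - -1 : cx) = 2%:C%C by apply/eqP; rewrite eq_complex /=; apply/andP; split; apply/eqP; lra.
    by rewrite nm_real ger0_norm.
  rewrite /P; have [e|e] := r1 (clamp s); have [e'|e'] := r1 (clamp s').
  - by rewrite e e'.
  - by exfalso; move: rr; rewrite e e' nmBC n2; lra.
  - by exfalso; move: rr; rewrite e e' n2; lra.
  - by rewrite e e'.
rewrite /P clamp0 clamp1 /r e0 divff// eqxx => /esym/eqP h.
by rewrite -[u one](divfK (v0 one)) h mul1r.
Qed.

End SquareRoots.

Section Slices.
Variables (R : realType) (S : topologicalType).
Local Notation I := (unit_interval R).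

Lemma continuous_pair_r (s : S) : continuous (fun t : I => (s, t)).
Proof.
move=> t; exact: (@cvg_pair I S I (nbhs t) (nbhs s) (nbhs t) _ _ _ _ _
  (@cvg_cst S s I (nbhs t) _) (@cvg_id _ _)).
Qed.

Lemma continuous_pair_l (s : S) : continuous (fun t : I => (t, s)).
Proof.
move=> t; exact: (@cvg_pair I I S (nbhs t) (nbhs t) (nbhs s) _ _ _ _ _
  (@cvg_id _ _) (@cvg_cst S s I (nbhs t) _)).
Qed.

End Slices.

Section SignCharacter.
Variables (R : realType) (X : topologicalType).
Local Notation cx := (R[i]^o).
Local Notation I := (unit_interval R).
Local Notation path x y := {path I from x to y}.
Variable h : X -> cx.
Hypotheses (ch : continuous h) (h0 : forall x, h x != 0).

Definition is_lift x y (p : path x y) (sg : I -> cx) :=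
  continuous sg /\ forall t, sg t ^+ 2 = h (p t).

Lemma lift_neq0 x y (p : path x y) sg : is_lift p sg -> forall t, sg t != 0.
Proof. by move=> [_ sq] t; rewrite -sqrf_eq0 sq. Qed.

Lemma sqr_pm (a b : cx) : a ^+ 2 = b ^+ 2 -> a = b \/ a = - b.
Proof. by move/eqP; rewrite eqf_sqr => /orP[]/eqP; [left|right]. Qed.

Lemma lift_opp x y (p : path x y) sg : is_lift p sg -> is_lift p (fun t => - sg t).
Proof. by move=> [c sq]; split; [exact: continuous_oppc|move=> t; rewrite sqrrN]. Qed.

Lemma lift_from x y (p : path x y) w : w ^+ 2 = h x ->
  exists2 sg, is_lift p sg & sg zero = w.
Proof.
move=> wx; have [||s|sg csg sq] := @square_root_lift R (fun u => h (p u.2)) (h x).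
- refine (continuous_compose (continuous_compose _ (@path_continuous R X x y p)) ch).
  by move=> ?; exact: cvg_snd.
- by move=> u; exact: h0.
- by rewrite path_zero.
have l : is_lift p (fun t => sg (zero, t)).
  split=> [|t]; last by rewrite sq.
  exact: (@continuous_compose _ _ _ _ sg (@continuous_pair_r R I zero) csg).
have [|e|e] := @sqr_pm (sg (zero, zero)) w; first by rewrite sq path_zero wx.
  by exists (fun t => sg (zero, t)).
by exists (fun t => - sg (zero, t)); [exact: lift_opp|rewrite e opprK].
Qed.

Lemma lift_unique x y (p : path x y) sg sg' : is_lift p sg -> is_lift p sg' ->
  sg zero = sg' zero -> sg one = sg' one.
Proof.
move=> l l'; apply: square_root_unique; [exact: l.1|exact: l'.1| |exact: lift_neq0 l'].
by move=> t; rewrite l.2 l'.2.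
Qed.

(** The monodromy of the square roots of [h] along the path. *)
Definition lift_sign x y (p : path x y) : bool :=
  `[< exists2 sg, is_lift p sg & sg one <> sg zero >].

Lemma lift_signE x y (p : path x y) sg : is_lift p sg -> lift_sign p = (sg one != sg zero).
Proof.
move=> l; apply/asboolP/negP => [[sg' l' n] /eqP e|n]; last by exists sg => // /eqP.
have [e0|e0] := @sqr_pm (sg' zero) (sg zero) (etrans (l'.2 zero) (esym (l.2 zero))).
  by apply: n; rewrite (lift_unique l' l e0) e e0.
have := lift_unique l' (lift_opp l) e0; rewrite e => e1.
by apply: n; rewrite e1 e0.
Qed.

Lemma lift_cat x y z (p : path x y) (q : path y z) sg sg' :
  is_lift p sg -> is_lift q sg' -> sg one = sg' zero ->
  exists2 tau, is_lift (path_cat p q) tau & tau zero = sg zero /\ tau one = sg' one.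
Proof.
move=> [c sq] [c' sq'] e.
exists (fun t : I => if ival t <= 2^-1 then sg (clamp (2 * ival t))
                     else sg' (clamp (2 * ival t - 1))).
  split.
    apply: continuous_glue; first exact: ival_continuous.
    - refine (continuous_compose (continuous_comp_clamp _) c).
      by apply: continuous_scale; exact: ival_continuous.
    - refine (continuous_compose (continuous_comp_clamp _) c').
      by apply: continuous_affine; exact: ival_continuous.
    - move=> t ->; rewrite divff ?pnatr_eq0// subrr clamp0 clamp1 //.
  by move=> t; rewrite /= /mk_path /path_cat_fun; case: ifP => _; rewrite ?sq ?sq'.
split; first by rewrite ival0 invr_ge0 ler0n mulr0 clamp0.
rewrite ival1 ifF; last by apply/negbTE; rewrite -ltNge; lra.
by rewrite mulr1 (_ : 2 - 1 = 1) ?clamp1//; lra.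
Qed.

Lemma lift_rev x y (p : path x y) sg : is_lift p sg ->
  exists2 tau, is_lift (path_rev p) tau & tau zero = sg one /\ tau one = sg zero.
Proof.
move=> [c sq]; exists (fun t => sg (clamp (1 - ival t))).
  split=> [|t]; last by rewrite /= sq.
  refine (continuous_compose (continuous_comp_clamp _) c).
  by apply: continuous_flip; exact: ival_continuous.
by rewrite ival0 ival1 subr0 subrr clamp0 clamp1.
Qed.

Lemma lift_sign_cat x (p q : path x x) :
  lift_sign (path_cat p q) = lift_sign p (+) lift_sign q.
Proof.
have [sg l e] := lift_from p (sqr_sqrtc (h x)).
have w1 : sg one ^+ 2 = h x by rewrite l.2 path_one.
have [sg' l' e'] := lift_from q w1.
have [tau lt [t0 t1]] := lift_cat l l' (esym e').
rewrite (lift_signE lt) (lift_signE l) (lift_signE l') t0 t1.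
have n0 := lift_neq0 l zero.
have nN : - sg zero != sg zero by rewrite -subr_eq0 -opprD oppr_eq0 -mulr2n mulrn_eq0.
have v1 : sg' one ^+ 2 = sg' zero ^+ 2 by rewrite !l'.2 path_one path_zero.
have v0 : sg one ^+ 2 = sg zero ^+ 2 by rewrite !l.2 path_one path_zero.
have nN' : (sg zero == - sg zero) = false by rewrite eq_sym (negbTE nN).
have [a1|a1] := sqr_pm v1; rewrite a1 e'; have [a0|a0] := sqr_pm v0; rewrite a0.
- by rewrite eqxx.
- by rewrite eqxx (negbTE nN).
- by rewrite eqxx (negbTE nN).
- by rewrite opprK eqxx nN' (negbTE nN).
Qed.

(** The sign acquired along [g] is lost again on the way back. *)
Lemma lift_sign_conj x y (g : path x y) (p : path y y) :
  lift_sign (path_cat g (path_cat p (path_rev g))) = lift_sign p.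
Proof.
have [sg l e] := lift_from g (sqr_sqrtc (h x)).
have w1 : sg one ^+ 2 = h y by rewrite l.2 path_one.
have [sg' l' e'] := lift_from p w1.
have [rho lr [r0 r1]] := lift_rev l.
have v1 : sg' one ^+ 2 = sg' zero ^+ 2 by rewrite !l'.2 path_one path_zero.
have nN a : a != 0 :> cx -> - a != a by move=> ?; rewrite -subr_eq0 -opprD oppr_eq0 -mulr2n mulrn_eq0.
have [a1|a1] := sqr_pm v1.
  have [t lt [t0 t1]] : exists2 t, is_lift (path_cat p (path_rev g)) t &
      t zero = sg' zero /\ t one = rho one.
    by apply: lift_cat => //; rewrite a1 e' r0.
  have [u lu [u0 u1]] : exists2 u, is_lift (path_cat g (path_cat p (path_rev g))) u &
      u zero = sg zero /\ u one = t one.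
    by apply: lift_cat => //; rewrite t0 e'.
  by rewrite (lift_signE lu) (lift_signE l') u0 u1 t1 r1 a1 !eqxx.
have [t lt [t0 t1]] : exists2 t, is_lift (path_cat p (path_rev g)) t &
    t zero = sg' zero /\ t one = - rho one.
  have := lift_cat l' (lift_opp lr) _; apply; by rewrite a1 e' r0.
have [u lu [u0 u1]] : exists2 u, is_lift (path_cat g (path_cat p (path_rev g))) u &
    u zero = sg zero /\ u one = t one.
  by apply: lift_cat => //; rewrite t0 e'.
rewrite (lift_signE lu) (lift_signE l') u0 u1 t1 r1 a1 !nN //.
  exact: (lift_neq0 l').
exact: (lift_neq0 l).
Qed.

(** Lift the whole homotopy; its sides are constant because the end points are fixed. *)
Lemma lift_sign_homotopic x y (p q : path x y) : path_homotopic p q ->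
  lift_sign p = lift_sign q.
Proof.
move=> [H [cH Hp Hq Hx Hy]].
have [||s|sg csg sq] := @square_root_lift R (fun u => h (H u)) (h x).
- exact: (continuous_compose cH ch).
- by move=> u; exact: h0.
- by rewrite Hx.
have row s : continuous (fun t : I => sg (s, t)).
  exact: (@continuous_compose _ _ _ _ sg (@continuous_pair_r R I s) csg).
have col t : continuous (fun s : I => sg (s, t)).
  exact: (@continuous_compose _ _ _ _ sg (@continuous_pair_l R I t) csg).
have lp : is_lift p (fun t => sg (zero, t)) by split=> // t; rewrite sq Hp.
have lq : is_lift q (fun t => sg (one, t)) by split=> // t; rewrite sq Hq.
have edge t k : (forall s, H (s, t) = k) -> sg (one, t) = sg (zero, t).
  move=> Hk; apply: (@square_root_unique R (fun s => sg (s, t)) (fun=> sg (zero, t))) => //.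
  - exact: cst_continuous.
  - by move=> s; rewrite !sq !Hk.
  - by move=> _; rewrite -sqrf_eq0 sq.
by rewrite (lift_signE lp) (lift_signE lq) (edge one y Hy) (edge zero x Hx).
Qed.

Definition sign_character (x0 : X) (u : pi1 R x0) : bool := lift_sign (repr u).

Lemma sign_characterE x0 (p : path x0 x0) :
  sign_character (\pi_(pi1 R x0) p) = lift_sign p.
Proof. by apply: lift_sign_homotopic; exact: homotopic_repr. Qed.

Lemma sign_characterP x0 : character (@sign_character x0).
Proof.
move=> u v; rewrite -[in LHS](reprK u) -[in LHS](reprK v).
have -> : (\pi_(pi1 R x0) (repr u) * \pi_(pi1 R x0) (repr v))%g =
    \pi_(pi1 R x0) (path_cat (repr u) (repr v)) by exact: pi1_mulE.
by rewrite sign_characterE lift_sign_cat.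
Qed.

End SignCharacter.

(** * Signs of meridians *)

Section HalfTurn.
Variable R : realType.
Local Notation cx := (R[i]^o).
Local Notation I := (unit_interval R).

(** Its square winds once around 0 in the unit disc, and it is itself a square root of
    this loop, with opposite end points. *)
Definition half_turn (t : I) : cx :=
  (1 - 2 * ival t)%:C%C + 'i%C * (4 * ival t * (1 - ival t))%:C%C.

Lemma half_turn_coord t : half_turn t = ((1 - 2 * ival t) +i* (4 * ival t * (1 - ival t)))%C.
Proof.
by rewrite /half_turn; apply/eqP; rewrite eq_complex /=; apply/andP; split; apply/eqP; ring.
Qed.

Lemma nm_half_turn t : nm (half_turn t) <= 1.
Proof.
have t0 := ival_ge0 t; have t1 := ival_le1 t.
rewrite -(@ler_pXn2r _ 2) ?nnegrE ?nm_ge0// nm_sqr half_turn_coord /= expr1n.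
move: (ival t) t0 t1 => s s0 s1.
have w0 : 0 <= s * (1 - s) by rewrite mulr_ge0// subr_ge0.
have w1 : s * (1 - s) <= 1 / 4 by have := sqr_ge0 (s - 1 / 2); nra.
nra.
Qed.

Lemma half_turn_neq0 t : half_turn t != 0.
Proof.
apply/eqP; rewrite half_turn_coord => /eqP; rewrite eq_complex /= => /andP[/eqP h1 /eqP h2].
have s : ival t = 1 / 2 by lra.
by move: h2; rewrite s; lra.
Qed.

Lemma half_turn0 : half_turn zero = 1.
Proof. by rewrite half_turn_coord ival0; apply/eqP; rewrite eq_complex /=; apply/andP; split; apply/eqP; ring. Qed.

Lemma half_turn1 : half_turn one = - 1.
Proof.
rewrite half_turn_coord ival1; apply/eqP; rewrite eq_complex /=.
by apply/andP; split; apply/eqP; ring.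
Qed.

Lemma continuous_half_turn : continuous half_turn.
Proof.
have c1 : continuous (fun t : I => 1 - 2 * ival t).
  by apply/continuous_flip/continuous_scale; exact: ival_continuous.
have c2 : continuous (fun t : I => 4 * ival t * (1 - ival t)).
  by apply: continuous_mul; [apply: continuous_scale|apply: continuous_flip]; exact: ival_continuous.
have cc (v : I -> R) : continuous v -> continuous (fun t => (v t)%:C%C : cx).
  by move=> cv; exact: (continuous_compose cv (@continuous_real_complex R)).
apply: (continuous_addc (cc _ c1)); apply: (continuous_mulc _ (cc _ c2)).
exact: cst_continuous.
Qed.

End HalfTurn.

Section Meridian.
Variables (R : realType) (X : topologicalType).
Local Notation cx := (R[i]^o).
Variables a b c : {poly R[i]}.
Local Notation O := (curve_complement a b c).
Local Notation I := (unit_interval R).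
Local Notation path x y := {path I from x to y}.
Variables (e : X -> (cx * cx)%type) (g : (cx * cx)%type -> X) (x0 : X).
Hypotheses (ce : continuous e) (eO : forall z, O (e z)) (ge : cancel e g).
Hypotheses (eg : forall v, O v -> e (g v) = v) (cg : forall v, O v -> {for v, continuous g}).

(** The meridian about a point of one branch: the factors of the cubic vanishing there
    change sign along a lift, the others do not. *)
Lemma meridian_signs (J : finType) (H : J -> (cx * cx)%type -> cx) (x p : cx) (delta : J -> bool)
    (k : J -> cx -> cx) :
    (forall j, continuous (H j)) -> (forall z, O z <-> forall j, H j z != 0) ->
    (forall j, continuous (k j)) -> (forall j, k j p != 0) ->
    (forall j y, H j (x, y) = (if delta j then y - p else 1) * k j y) -> (exists j, delta j) ->
  exists u : pi1 R x0, forall j, sign_character (fun z => H j (e z)) u = delta j.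
Proof.
move=> cH OH ck k0 HE [j0 dj0].
(* Near [p] the nonvanishing parts [k j] stay so close to their values at [p] that the
   principal square root of the ratio is continuous. *)
have : \forall y \near p, forall j, nm (k j y / k j p - 1) < 1.
  apply: (@filter_forall _ J (fun j => [set y | nm (k j y / k j p - 1) < 1]) (nbhs p)) => j.
  have cr : continuous (fun y => k j y / k j p).
    apply: (continuous_divc (ck j)); first by move=> ?; exact: cst_continuous.
    by move=> _; exact: k0.
  have : \forall y \near p, nball (k j p / k j p) 1 (k j y / k j p).
    by apply: (cr p); exact: nbhs_nball.
  by rewrite /nball /= divff.
move=> /nbhs_nmP[r0 r00 near].
pose r := r0 / 2; have rp : 0 < r by rewrite /r divr_gt0.
have rr : r < r0 by rewrite /r; lra.
pose y (t : I) : cx := p + r%:C%C * half_turn t ^+ 2.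
have r0' : r%:C%C != 0 :> cx by rewrite eq_complex /= eqxx andbT gt_eqF.
have yp t : y t - p = r%:C%C * half_turn t ^+ 2 by rewrite /y addrC addKr.
have ynear t : nm (y t - p) < r0.
  apply: le_lt_trans rr; rewrite yp nmM nm_real gtr0_norm// nmX.
  by rewrite ler_piMr ?(ltW rp)// exprn_ile1 ?nm_ge0// nm_half_turn.
have kn t j : nm (k j (y t) / k j p - 1) < 1 by apply: near; exact: ynear.
have ky t j : k j (y t) != 0.
  by apply/eqP => ky; have := kn t j; rewrite ky mul0r sub0r nmN nm1 ltxx.
have yO t : O (x, y t).
  apply/OH => j; rewrite HE mulf_neq0//; case: ifP => _; last exact: oner_neq0.
  by rewrite yp mulf_neq0// expf_neq0// half_turn_neq0.
have cy : continuous y.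
  have cu := @continuous_half_turn R.
  apply: (@continuous_addc R I (fun=> p)); first exact: cst_continuous.
  apply: (@continuous_mulc R I (fun=> r%:C%C)); first exact: cst_continuous.
  exact: (continuous_mulc cu cu).
pose l t : X := g (x, y t).
have cl : continuous l.
  have cxy : continuous (fun t => (x, y t)).
    move=> t; exact: (@cvg_pair I cx cx (nbhs t) (nbhs x) (nbhs (y t)) _ _ _ _ _
      (@cvg_cst _ x I (nbhs t) _) (cy t)).
  exact: (continuous_into cg cxy yO).
have l1 : l one = l zero by rewrite /l /y half_turn0 half_turn1 sqrrN.
pose lp : path (l zero) (l zero) := mk_path cl erefl l1.
have [q _] := chart_path_connected eO ge eg cg x0 (l zero).
exists (\pi_(pi1 R x0) (path_cat q (path_cat lp (path_rev q)))) => j.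
have cHe : continuous (fun z => H j (e z)) by exact: (continuous_compose ce (cH j)).
have He0 z : H j (e z) != 0 by exact: (OH (e z)).1.
rewrite (sign_characterE cHe He0) (lift_sign_conj cHe He0).
pose w t : cx := sqrtc (k j p) * psqrt (k j (y t) / k j p).
have w2 t : w t ^+ 2 = k j (y t) by rewrite /w exprMn sqr_sqrtc psqrtK// mulrC divfK.
have cw : continuous w.
  apply: (@continuous_mulc R I (fun=> sqrtc (k j p))); first exact: cst_continuous.
  apply: continuous_psqrt (kn ^~ j); apply: (@continuous_divc R I _ (fun=> k j p)).
  - exact: (continuous_compose cy (ck j)).
  - exact: cst_continuous.
  - by move=> _; exact: k0.
have w1 : w one = w zero by rewrite /w /y half_turn0 half_turn1 sqrrN.
have w0 : w zero != 0 by rewrite -sqrf_eq0 w2.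
clearbody w.
have cu : continuous (fun t : I => sqrtc r%:C%C * half_turn t : cx).
  apply: (@continuous_mulc R I (fun=> sqrtc r%:C%C)); first exact: cst_continuous.
  exact: continuous_half_turn.
have lw : is_lift (fun z => H j (e z)) lp
    (fun t => if delta j then sqrtc r%:C%C * half_turn t * w t else w t).
  split; first by case: (delta j); [exact: (continuous_mulc cu cw)|exact: cw].
  move=> t; have -> : e (lp t) = (x, y t) by rewrite /= /mk_path /l eg.
  rewrite HE; case: (delta j); last by rewrite w2 mul1r.
  by rewrite !exprMn sqr_sqrtc w2 yp.
rewrite (lift_signE He0 lw); case: (delta j); last by rewrite w1 eqxx.
rewrite half_turn0 half_turn1 w1 mulr1 mulrN1 mulNr.
have s0 : sqrtc r%:C%C * w zero != 0 :> cx by rewrite mulf_neq0// -sqrf_eq0 sqr_sqrtc.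
by rewrite -subr_eq0 -opprD oppr_eq0 -mulr2n mulrn_eq0.
Qed.

Hypothesis disc0 : disc a b c != 0.

Lemma poly_eq0P (p : {poly R[i]}) : (forall x, p.[x] = 0) -> p = 0.
Proof.
move=> p0; apply/eqP; apply: contraT => /closed_nonrootP[x]; by rewrite /root p0 eqxx.
Qed.

Lemma poly_rootE L : poly_root a b c L <-> L ^+ 3 + a * L ^+ 2 + b * L + c = 0.
Proof.
split=> [h|h x]; first by apply: poly_eq0P => x; horner_eval; have := h x.
by have := congr1 (fun p : {poly R[i]} => p.[x]) h; rewrite /cubic; horner_eval.
Qed.

(** With [cofactor0], the coefficients of the quotient of the cubic by [y - L]. *)
Definition cofactor1 (L : {poly R[i]}) : {poly R[i]} := a + L.
Definition cofactor0 (L : {poly R[i]}) : {poly R[i]} := b + L * cofactor1 L.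

Lemma cubic_factor L : poly_root a b c L -> forall x y, cubic a b c x y =
  (y - L.[x]) * (y ^+ 2 + (cofactor1 L).[x] * y + (cofactor0 L).[x]).
Proof.
move=> h x y; have := h x; rewrite /cofactor0 /cofactor1 /cubic; horner_eval.
move=> h'; rewrite -[LHS]subr0 -[in LHS]h'; ring.
Qed.

(** Divided differences of the equation of the roots give the coefficients of the cubic,
    so that the factorization also holds where the roots meet. *)
Lemma cubic_splits L1 L2 L3 : poly_root a b c L1 -> poly_root a b c L2 -> poly_root a b c L3 ->
    L1 <> L2 -> L2 <> L3 -> L1 <> L3 ->
  forall x, roots3 a b c x L1.[x] L2.[x] L3.[x].
Proof.
move=> /poly_rootE h1 /poly_rootE h2 /poly_rootE h3 /eqP n12 /eqP n23 /eqP n13.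
have q L : L ^+ 3 + a * L ^+ 2 + b * L + c = 0 -> L1 != L ->
    L ^+ 2 + L1 * L + L1 ^+ 2 + a * (L + L1) + b = 0.
  move=> hL n; have : (L - L1) * (L ^+ 2 + L1 * L + L1 ^+ 2 + a * (L + L1) + b) = 0.
    rewrite -[RHS](subrr 0) -{1}hL -h1; ring.
  by move/eqP; rewrite mulf_eq0 subr_eq0 eq_sym (negbTE n) => /eqP.
have q2 := q _ h2 n12; have q3 := q _ h3 n13.
have aE : a = - (L1 + L2 + L3).
  have : (L3 - L2) * (a + (L1 + L2 + L3)) = 0 by rewrite -[RHS](subrr 0) -{1}q3 -q2; ring.
  by move/eqP; rewrite mulf_eq0 subr_eq0 eq_sym (negbTE n23) addr_eq0 => /eqP.
have bE : b = - (L2 ^+ 2 + L1 * L2 + L1 ^+ 2 + a * (L2 + L1)).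
  by apply/eqP; rewrite -addr_eq0 addrC q2.
have cE : c = - (L1 ^+ 3 + a * L1 ^+ 2 + b * L1) by apply/eqP; rewrite -addr_eq0 addrC h1.
by move=> x y; rewrite /cubic cE bE aE; horner_eval; ring.
Qed.

Lemma continuous_poly_fst (p : {poly R[i]}) : continuous (fun z : cx * cx => p.[z.1] : cx).
Proof.
move=> z; apply: (@continuous_comp _ _ _ fst (fun x : cx => p.[x] : cx)); first exact: cvg_fst.
exact: continuous_poly.
Qed.

Lemma continuous_snd_sub (L : {poly R[i]}) : continuous (fun z : cx * cx => z.2 - L.[z.1] : cx).
Proof.
have c2 : continuous (snd : cx * cx -> cx) by move=> z; exact: cvg_snd.
apply: (continuous_addc c2); apply: continuous_oppc; exact: continuous_poly_fst.
Qed.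

Lemma continuous_sub_cst (q : cx) : continuous (fun y : cx => y - q : cx).
Proof.
apply: (@continuous_addc R cx id (fun=> - q)); first by move=> y; exact: cvg_id.
exact: cst_continuous.
Qed.

Lemma poly_root_fibre L : poly_root a b c L -> exists x p2 p3,
  [/\ roots3 a b c x L.[x] p2 p3, distinct3 L.[x] p2 p3 &
      forall y : cx, y ^+ 2 + (cofactor1 L).[x] * y + (cofactor0 L).[x] = (y - p2) * (y - p3)].
Proof.
move=> rL; have [x gx] := good_exists disc0.
have [p2 [p3 h3]] : exists p2 p3, roots3 a b c x L.[x] p2 p3.
  have [q1 [q2 [q3 hq]]] := roots3_exists a b c x.
  have [] := (roots3_eq0 L.[x] hq).1 (rL x) => ->.
  - by exists q2, q3.
  - by exists q3, q1; exact: roots3_rot.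
  - by exists q1, q2; do 2!apply: roots3_rot.
exists x, p2, p3; split=> // [|y]; first by rewrite -(disc_distinct3 h3).
have [aE bE _] := roots3_coef h3.
by rewrite /cofactor0 /cofactor1; horner_eval; rewrite aE bE; ring.
Qed.

(** The signs of the two factors, told apart by the meridians at a root of each. *)
Lemma root_two_characters L : poly_root a b c L ->
  exists chi1 chi2 : pi1 R x0 -> bool, [/\ character chi1, character chi2,
    exists u, chi1 u = true /\ chi2 u = false & exists u, chi1 u = false /\ chi2 u = true].
Proof.
move=> rL; have fE := cubic_factor rL.
pose Q (z : cx * cx) : cx := z.2 ^+ 2 + (cofactor1 L).[z.1] * z.2 + (cofactor0 L).[z.1].
pose H (j : bool) (z : cx * cx) : cx := if j then z.2 - L.[z.1] else Q z.
have c2 : continuous (snd : cx * cx -> cx) by move=> z; exact: cvg_snd.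
have cH j : continuous (H j).
  case: j; first exact: continuous_snd_sub.
  apply: (@continuous_addc R (cx * cx)%type (fun z => z.2 ^+ 2 + (cofactor1 L).[z.1] * z.2)).
    apply: (@continuous_addc R (cx * cx)%type (fun z => z.2 ^+ 2)).
      exact: (continuous_mulc c2 c2).
    exact: (continuous_mulc (@continuous_poly_fst _) c2).
  exact: continuous_poly_fst.
have OH z : O z <-> forall j, H j z != 0.
  rewrite /curve_complement /= fE; split=> [/eqP|h].
    by rewrite mulf_eq0 negb_or => /andP[h1 h2] [].
  by apply/eqP; rewrite mulf_neq0//; [exact: (h true)|exact: (h false)].
have [x [p2 [p3 [h3 /and3P[n12 n23 n13] QE]]]] := poly_root_fibre rL.
have cHe j : continuous (fun z => H j (e z)) by exact: (continuous_compose ce (cH j)).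
have He0 j z : H j (e z) != 0 by exact: (OH (e z)).1.
exists (@sign_character R X (fun z => H true (e z)) x0),
       (@sign_character R X (fun z => H false (e z)) x0); split.
- exact: (sign_characterP (cHe _) (He0 _)).
- exact: (sign_characterP (cHe _) (He0 _)).
- have [||||u uP] := @meridian_signs bool H x L.[x] id
    (fun j y => if j then 1 else (y - p2) * (y - p3)) cH OH; last by exists u; rewrite !uP.
  + by case; [move=> ?; exact: cst_continuous|exact: (continuous_mulc (@continuous_sub_cst _) (@continuous_sub_cst _))].
  + by case; [exact: oner_neq0|rewrite mulf_neq0// subr_eq0].
  + by case=> y; rewrite /H ?mulr1// /Q /= QE mul1r.
  + by exists true.
- have [||||u uP] := @meridian_signs bool H x p2 negb
    (fun j y => if j then y - L.[x] else y - p3) cH OH; last by exists u; rewrite !uP.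
  + by case; exact: continuous_sub_cst.
  + by case; rewrite subr_eq0// eq_sym.
  + by case=> y; rewrite /H ?mul1r// /Q /= QE.
  + by exists false.
Qed.

Lemma roots_three_characters L1 L2 L3 :
    poly_root a b c L1 -> poly_root a b c L2 -> poly_root a b c L3 ->
    L1 <> L2 -> L2 <> L3 -> L1 <> L3 ->
  exists chi : 'I_3 -> pi1 R x0 -> bool, (forall j, character (chi j)) /\
    forall i, exists u, forall j, chi j u = (j == i).
Proof.
move=> r1 r2 r3 n12 n23 n13; have fE := cubic_splits r1 r2 r3 n12 n23 n13.
pose L (j : 'I_3) : {poly R[i]} := tnth [tuple L1; L2; L3] j.
pose H (j : 'I_3) (z : cx * cx) : cx := z.2 - (L j).[z.1].
have cH j : continuous (H j) by exact: continuous_snd_sub.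
have fH x y : cubic a b c x y = \prod_j H j (x, y).
  by rewrite !big_ord_recl big_ord0 /H /L /= fE mulr1 mulrA.
have OH z : O z <-> forall j, H j z != 0.
  rewrite /curve_complement /= fH -surjective_pairing; split=> [/eqP h j|h].
    by apply: contra h => /eqP hj; rewrite (bigD1 j)//= hj mul0r.
  by apply/eqP/prodf_neq0.
have [x gx] := good_exists disc0.
have dL i j : i != j -> (L i).[x] != (L j).[x].
  have /and3P[] : distinct3 L1.[x] L2.[x] L3.[x] by rewrite -(disc_distinct3 (fE x)).
  move=> m12 m23 m13; rewrite /L.
  by case: i => [[|[|[|i]]] ?] //; case: j => [[|[|[|j]]] ?] //= _; rewrite /tnth //= eq_sym.
have cHe j : continuous (fun z => H j (e z)) by exact: (continuous_compose ce (cH j)).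
have He0 j z : H j (e z) != 0 by exact: (OH (e z)).1.
exists (fun j => @sign_character R X (fun z => H j (e z)) x0); split.
  by move=> j; exact: (sign_characterP (cHe _) (He0 _)).
move=> i; have [||||u uP] := @meridian_signs 'I_3 H x (L i).[x] (fun j => j == i)
    (fun j y => if j == i then 1 else y - (L j).[x]) cH OH; last by exists u.
- move=> j; case: (j == i); first by move=> ?; exact: cst_continuous.
  exact: continuous_sub_cst.
- move=> j; case: (eqVneq j i) => [_|n]; first exact: oner_neq0.
  by rewrite subr_eq0 eq_sym; exact: dL.
- by move=> j y; case: (eqVneq j i) => [->|_]; rewrite ?mulr1 ?mul1r.
- by exists i.
Qed.

End Meridian.

(** * Elementary abelian quotients *)

Section ElementaryQuotient.
Variables (G : groupType) (Q : zmodType) (QN : forall a : Q, - a = a).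

Section Map.
Variables (q : G -> Q) (chi : G -> bool).
Hypotheses (qM : forall u v, q (u * v)%g = q u + q v)
  (chiM : forall u v, chi (u * v)%g = chi u (+) chi v).

(** The hypotheses are arguments of the map, so that the instance below can use them. *)
Definition to_dihedral (u : G) : dihedral Q := let _ := (QN, qM, chiM) in (q u, chi u).

Lemma to_dihedralM : {morph to_dihedral : u v / (u * v)%g}.
Proof.
move=> u v; rewrite /to_dihedral qM chiM; congr (_, _) => /=.
by case: (chi u) => //=; rewrite QN.
Qed.

HB.instance Definition _ := isMultiplicative.Build G (dihedral Q) to_dihedral to_dihedralM.
End Map.

(** In exponent 2 the action by -1 is trivial and the semidirect product is direct. *)
Lemma elementary_quotient : has_quotient G (dihedral Q) <-> exists q chi,
  [/\ forall u v, q (u * v)%g = q u + q v, forall u v, chi (u * v)%g = chi u (+) chi v &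
      forall (a : Q) (k : bool), exists u : G, q u = a /\ chi u = k].
Proof.
split=> [[f fS]|[q [chi [qM chiM S]]]].
  exists (fun u => (f u).1), (fun u => (f u).2); split.
  - by move=> u v; rewrite gmulfM /=; case: (f u).2 => //=; rewrite QN.
  - by move=> u v; rewrite gmulfM.
  - by move=> a k; have [u uE] := fS (a, k); exists u; rewrite uE.
exists (to_dihedral qM chiM : {multiplicative G -> dihedral Q}) => -[a k].
by have [u [ua uk]] := S a k; exists u; rewrite /= /to_dihedral ua uk.
Qed.
End ElementaryQuotient.

Section Z2.

Lemma Z2_opp (a : 'Z_2) : - a = a.
Proof. by apply/val_inj; case: a => [[|[|]]]. Qed.

Lemma Z2_of_boolD (k l : bool) : Z2_of_bool (k (+) l) = Z2_of_bool k + Z2_of_bool l.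
Proof. by apply/val_inj; case: k l => [] []. Qed.

Lemma Z2_of_boolK : cancel Z2_of_bool (fun a => a == 1).
Proof. by case. Qed.

Lemma eq1_Z2K : cancel (fun a : 'Z_2 => a == 1) Z2_of_bool.
Proof. by move=> a; apply/val_inj; case: a => [[|[|]]]. Qed.

Lemma eq1_Z2D (x y : 'Z_2) : (x + y == 1) = (x == 1) (+) (y == 1).
Proof. by rewrite -[x]eq1_Z2K -[y]eq1_Z2K -Z2_of_boolD !Z2_of_boolK. Qed.

End Z2.

Section CurveQuotient.
Variables (R : realType) (X : topologicalType).
Local Notation cx := (R[i]^o).
Variables a b c : {poly R[i]}.
Local Notation O := (curve_complement a b c).
Local Notation I := (unit_interval R).
Variables (e : X -> (cx * cx)%type) (g : (cx * cx)%type -> X) (x0 : X).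
Hypotheses (ce : continuous e) (eO : forall z, O (e z)) (ge : cancel e g).
Hypotheses (eg : forall v, O v -> e (g v) = v) (cg : forall v, O v -> {for v, continuous g}).
Hypothesis disc0 : disc a b c != 0.
Implicit Types chi : pi1 R x0 -> bool.

Lemma paths_from_base : exists gam : forall x : X, {path I from x0 to x}, True.
Proof.
by exists (fun x => projT1 (cid (chart_path_connected eO ge eg cg x0 x))).
Qed.

Lemma character1 chi : character chi -> chi 1%g = false.
Proof. by move=> chiM; have := chiM 1%g 1%g; rewrite mulg1; case: (chi _). Qed.

Lemma character_if chi (k : bool) u : character chi -> chi (if k then u else 1%g) = k && chi u.
Proof. by case: k => // /character1. Qed.

Lemma dihedral2_quotient : has_quotient (pi1 R x0) (dihedral 'Z_2) <->
  exists L, poly_root a b c L.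
Proof.
apply: (iff_trans (elementary_quotient _ Z2_opp)); split.
  move=> [q [chi [qM chiM S]]]; have [gam _] := paths_from_base.
  apply: (two_characters_root ce eO ge eg cg disc0 gam (chi1 := fun u => q u == 1) (chi2 := chi)).
  - by move=> u v; rewrite qM eq1_Z2D.
  - exact: chiM.
  - by have [u [uE _]] := S 1 true; exists u; rewrite uE.
  - by have [u [_ uE]] := S 1 true; exists u; rewrite uE.
  - by have [u [uE uE']] := S 1 false; exists u; rewrite uE uE'.
move=> [L /(root_two_characters x0 ce eO ge eg cg disc0)].
move=> [chi1 [chi2 [c1 c2 [u [u1 u2]] [v [v1 v2]]]]].
exists (fun u => Z2_of_bool (chi1 u)), chi2; split => //.
  by move=> w w'; rewrite c1 Z2_of_boolD.
move=> k l; exists ((if k == 1%R then u else 1%g) * (if l then v else 1%g))%g.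
by rewrite c1 c2 !character_if// u1 u2 v1 v2 !andbT !andbF !addbF eq1_Z2K.
Qed.

Lemma dihedral3_quotient : has_quotient (pi1 R x0) (dihedral ('Z_2 * 'Z_2)%type) <->
  exists L1 L2 L3, [/\ poly_root a b c L1, poly_root a b c L2, poly_root a b c L3 &
    [/\ L1 <> L2, L2 <> L3 & L1 <> L3]].
Proof.
have QN (u : ('Z_2 * 'Z_2)%type) : - u = u by case: u => u v; congr (_, _); exact: Z2_opp.
apply: (iff_trans (elementary_quotient _ QN)); split.
  move=> [q [chi [qM chiM S]]]; have [gam _] := paths_from_base.
  apply: (three_characters_roots ce eO ge eg cg disc0 gam (chi1 := fun u => (q u).1 == 1)
    (chi2 := fun u => (q u).2 == 1) (chi3 := chi)) => //.
  - by move=> u v; rewrite qM eq1_Z2D.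
  - by move=> u v; rewrite qM eq1_Z2D.
  - move=> k1 k2 k3 k0.
    have [u [uE uE']] := S (Z2_of_bool k1, Z2_of_bool (~~ k1 && k2)) (~~ k1 && ~~ k2).
    exists u; rewrite uE uE' /= !Z2_of_boolK.
    by clear -k0; move: k1 k2 k3 k0 => [] [] [].
move=> [L1 [L2 [L3 [r1 r2 r3 [n12 n23 n13]]]]].
have [chi [chiM S]] := roots_three_characters x0 ce eO ge eg cg disc0 r1 r2 r3 n12 n23 n13.
pose j1 : 'I_3 := @Ordinal 3 0 isT; pose j2 : 'I_3 := @Ordinal 3 1 isT.
pose j3 : 'I_3 := @Ordinal 3 2 isT.
have [u uE] := S j1; have [v vE] := S j2; have [w wE] := S j3.
exists (fun u => (Z2_of_bool (chi j1 u), Z2_of_bool (chi j2 u))), (chi j3); split.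
- by move=> s t; rewrite !chiM !Z2_of_boolD.
- exact: chiM.
move=> [k l] m.
exists (((if k == 1%R then u else 1) * (if l == 1%R then v else 1)) * (if m then w else 1))%g.
by rewrite !chiM !character_if// !uE !vE !wE /= !andbT !andbF !addbF /= !eq1_Z2K.
Qed.

End CurveQuotient.

(** * Sections over a Hirzebruch surface in coordinates *)

Section CoxSections.
Variables (R : realType) (d : nat).
Local Notation cx := (R[i]^o).
Local Notation i0 := (inord 0 : 'I_4).
Local Notation i1 := (inord 1 : 'I_4).
Local Notation i2 := (inord 2 : 'I_4).
Local Notation i3 := (inord 3 : 'I_4).
Implicit Types (f : cox_ring R) (w : cox_space R) (u v : (cx * cx)%type) (P : {poly R[i]}) (Q : nat -> {poly R[i]}).

Definition ev f w : cx := meval (tnth [tuple w.1.1; w.1.2; w.2.1; w.2.2]) f.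

Lemma prod_ord4 (S : comNzRingType) (F : 'I_4 -> S) : \prod_i F i = F i0 * F i1 * F i2 * F i3.
Proof.
rewrite !big_ord_recl big_ord0 mulr1 !mulrA; do 3?congr (_ * _); congr F;
  by apply/val_inj; rewrite /= ?inordK.
Qed.

Lemma evE f w : ev f w = \sum_(m <- msupp f) mcoeff m f *
  (w.1.1 ^+ m i0 * w.1.2 ^+ m i1 * w.2.1 ^+ m i2 * w.2.2 ^+ m i3).
Proof.
rewrite /ev mevalE; apply: eq_bigr => m _; congr (_ * _); rewrite prod_ord4.
by do 3?congr (_ * _); rewrite (tnth_nth 0) inordK.
Qed.

Definition bidegree (m : multinom 4) : nat * nat := ((m i2 + m i3)%N, (m i0 + m i1 + d * m i3)%N).

Lemma in_classE a b f : in_class d a b f <-> forall m, m \in msupp f -> bidegree m = (a, b).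
Proof. by split=> h m /h; [move=> [<- <-]|move=> [<- <-]]. Qed.

Lemma in_class_sum (I : Type) (r : seq I) (P : pred I) (F : I -> cox_ring R) a b :
  (forall i, P i -> in_class d a b (F i)) -> in_class d a b (\sum_(i <- r | P i) F i).
Proof.
move=> h; apply: (big_ind (in_class d a b)) => [m|f g hf hg m|//].
  by rewrite (msupp0 4 R[i]).
by move=> /msuppD_le; rewrite mem_cat => /orP[/hf|/hg].
Qed.

Lemma in_class_mul a b a' b' f g : in_class d a b f -> in_class d a' b' g ->
  in_class d (a + a') (b + b') (f * g).
Proof.
move=> /in_classE hf /in_classE hg; apply/in_classE => m /msuppM_le/allpairsP[[m1 m2] /=].
move=> [/hf [<- <-] /hg [<- <-] ->]; rewrite /bidegree !mnmDE; congr (_, _); lia.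
Qed.

Lemma in_class1 : in_class d 0 0 (1 : cox_ring R).
Proof.
apply/in_classE => m; rewrite -[1]/(mpolyC 4 1) msupp1 inE => /eqP ->.
by rewrite /bidegree !mnm0E muln0.
Qed.

Lemma in_class_exp a b f k : in_class d a b f -> in_class d (k * a) (k * b) (f ^+ k).
Proof.
move=> h; elim: k => [|k IHk]; first by rewrite expr0; exact: in_class1.
by rewrite exprS !mulSn; exact: in_class_mul.
Qed.

Lemma in_class_scale a b f (k : R[i]) : in_class d a b f -> in_class d a b (k *: f).
Proof. by move=> h m /msuppZ_le/h. Qed.

Lemma in_class_var i : in_class d (bidegree (mnm1 i)).1 (bidegree (mnm1 i)).2 (mpolyX R[i] (mnm1 i)).
Proof. by apply/in_classE => m; rewrite msuppX inE => /eqP ->; case: (bidegree _). Qed.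

Lemma in_class_x (k l : R[i]) :
  in_class d 0 1 (k *: mpolyX R[i] (mnm1 i0) + l *: mpolyX R[i] (mnm1 i1)).
Proof.
have h0 := @in_class_var i0; have h1 := @in_class_var i1.
rewrite /bidegree /= !mnm1E -!val_eqE /= !inordK// muln0 !addn0 in h0 h1.
by move=> m /msuppD_le; rewrite mem_cat => /orP[/msuppZ_le/h0|/msuppZ_le/h1].
Qed.

Lemma in_class_s : in_class d 1 0 (mpolyX R[i] (mnm1 i2)).
Proof.
have h := @in_class_var i2.
by rewrite /bidegree /= !mnm1E -!val_eqE /= !inordK// muln0 !addn0 in h.
Qed.

Lemma in_class_t : in_class d 1 d (mpolyX R[i] (mnm1 i3)).
Proof.
have h := @in_class_var i3.
by rewrite /bidegree /= !mnm1E -!val_eqE /= !inordK// muln1 !addn0 in h.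
Qed.

Section Class.
Variables (a b : nat) (f : cox_ring R).
Hypothesis fab : in_class d a b f.

Lemma ev_act l m w : ev f (cox_act d l m w) = m ^+ a * l ^+ b * ev f w.
Proof.
rewrite !evE mulr_sumr; apply: eq_big_seq => n /fab[<- <-] /=.
rewrite !exprMn -exprM !exprD mulnC; ring.
Qed.

(** The coefficient of [t ^+ k], restricted to the line of base points [x u + v]. *)
Definition chart_coef u v k : {poly R[i]} := \sum_(m <- msupp f | m i3 == k)
  mcoeff m f *: ((u.1 *: 'X + v.1%:P) ^+ m i0 * (u.2 *: 'X + v.2%:P) ^+ m i1).

Lemma ev_chart u v (x s t : cx) :
  ev f ((x * u.1 + v.1, x * u.2 + v.2), (s, t)) =
  \sum_(k < a.+1) (chart_coef u v k).[x] * s ^+ (a - k) * t ^+ k.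
Proof.
transitivity (\sum_(m <- msupp f) \sum_(k < a.+1 | m i3 == k) mcoeff m f *
  ((x * u.1 + v.1) ^+ m i0 * (x * u.2 + v.2) ^+ m i1 * s ^+ m i2 * t ^+ m i3)).
  rewrite evE; apply: eq_big_seq => m /fab[ma _] /=.
  have k : (m i3 < a.+1)%N by rewrite ltnS -ma leq_addl.
  by rewrite (big_pred1 (Ordinal k))// => j; rewrite eq_sym.
rewrite (exchange_big_dep xpredT) //=; apply: eq_bigr => k _.
rewrite /chart_coef horner_sum !mulr_suml big_seq_cond [RHS]big_seq_cond.
apply: eq_bigr => m /andP[/fab[ma _] /eqP mk]; rewrite -mk -ma addnK.
rewrite hornerZ hornerM !horner_exp !hornerD !hornerZ !hornerX !hornerC.
by rewrite [u.1 * x]mulrC [u.2 * x]mulrC; ring.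
Qed.

Lemma size_linear_exp (k l : R[i]) n : (size ((k *: 'X + l%:P) ^+ n)%R <= n.+1)%N.
Proof.
apply: leq_trans (size_poly_exp_leq _ _) _; rewrite ltnS -[leqRHS]mul1n leq_mul2r; apply/orP; right.
suff : (size (k *: 'X + l%:P)%R <= 2)%N by case: (size _).
apply: leq_trans (size_polyD _ _) _; rewrite geq_max (leq_trans (size_polyC_leq1 _))// andbT.
by apply: leq_trans (size_scale_leq _ _) _; rewrite size_polyX.
Qed.

Lemma size_chart_coef u v k : (size (chart_coef u v k) <= (b - d * k).+1)%N.
Proof.
apply: leq_trans (size_sum _ _ _) _; apply/bigmax_leqP_seq => m /fab[_ mb] /eqP mk.
apply: leq_trans (size_scale_leq _ _) _; apply: leq_trans (size_polyMleq _ _) _.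
have := size_linear_exp u.1 v.1 (m i0); have := size_linear_exp u.2 v.2 (m i1).
move: mb; rewrite mk; set p := size _; set q := size _ => <-; lia.
Qed.

End Class.

(** In the class [n E + n d F] the coefficient of [t ^+ n] has degree 0 in the base
    coordinates. *)
Definition lead n f : cx := \sum_(m <- msupp f | m i3 == n) mcoeff m f.

Lemma chart_coef_lead n f u v : in_class d n (n * d) f -> chart_coef f u v n = (lead n f)%:P.
Proof.
move=> fn; rewrite /lead rmorph_sum /= /chart_coef big_seq_cond [RHS]big_seq_cond.
apply: eq_bigr => m /andP[/fn[_ mb] /eqP mn]; move: mb; rewrite mn mulnC => mb.
have [-> ->] : m i0 = 0%N /\ m i1 = 0%N by move: mb; lia.
by rewrite !expr0 mulr1 alg_polyC.
Qed.

Lemma ev_exceptional n f w : in_class d n (n * d) f -> w.2.1 = 0 -> ev f w = lead n f * w.2.2 ^+ n.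
Proof.
move=> fn; case: w => [[p q] [s t]] /= ->.
have := ev_chart fn (0, 0) (p, q) 0 0 t; rewrite /= !mulr0 !add0r => ->.
rewrite big_ord_recr /= (chart_coef_lead _ _ fn) hornerC subnn expr0 mulr1 big1 ?add0r// => k _.
by rewrite expr0n subn_eq0 leqNgt ltn_ord mulr0 mul0r.
Qed.

(** Along a polynomial curve the section is a polynomial, which vanishes if its product
    with [q] does. *)
Lemma ev_density f (q w0 w1 w2 w3 : {poly R[i]}) : q != 0 ->
    (forall x, q.[x] != 0 -> ev f ((w0.[x], w1.[x]), (w2.[x], w3.[x])) = 0) ->
  forall x, ev f ((w0.[x], w1.[x]), (w2.[x], w3.[x])) = 0.
Proof.
move=> q0 h.
pose p := \sum_(m <- msupp f) mcoeff m f *: (w0 ^+ m i0 * w1 ^+ m i1 * w2 ^+ m i2 * w3 ^+ m i3).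
have pE x : p.[x] = ev f ((w0.[x], w1.[x]), (w2.[x], w3.[x])).
  by rewrite evE horner_sum; apply: eq_bigr => m _; rewrite hornerZ !hornerM !horner_exp.
have /eqP : q * p = 0.
  apply: poly_eq0P => x; rewrite hornerM; have [->|/h] := eqVneq q.[x] 0; first by rewrite mul0r.
  by rewrite pE => ->; rewrite mulr0.
by rewrite mulf_eq0 (negbTE q0) => /eqP p0 x; rewrite -pE p0 horner0.
Qed.

Section Homogenization.
Variables u v : (cx * cx)%type.
Definition frame_det : cx := u.1 * v.2 - u.2 * v.1.
Hypothesis uv0 : frame_det != 0.

(** The coordinates of a base point in the frame [u, v]. *)
Definition along (p : (cx * cx)%type) : cx := (p.1 * v.2 - p.2 * v.1) / frame_det.
Definition across (p : (cx * cx)%type) : cx := (u.1 * p.2 - u.2 * p.1) / frame_det.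

Lemma frame_coordinates p : p = (along p * u.1 + across p * v.1, along p * u.2 + across p * v.2).
Proof.
by case: p => p q; rewrite /along /across /frame_det /=; congr (_, _); field; exact: uv0.
Qed.

Lemma along_line x : along (x * u.1 + v.1, x * u.2 + v.2) = x.
Proof. by rewrite /along /frame_det /=; field; exact: uv0. Qed.

Lemma across_line x : across (x * u.1 + v.1, x * u.2 + v.2) = 1.
Proof. by rewrite /across /frame_det /=; field; exact: uv0. Qed.

Definition hom_along : cox_ring R := (v.2 / frame_det) *: mpolyX R[i] (mnm1 i0) +
  (- v.1 / frame_det) *: mpolyX R[i] (mnm1 i1).
Definition hom_across : cox_ring R := (- u.2 / frame_det) *: mpolyX R[i] (mnm1 i0) +
  (u.1 / frame_det) *: mpolyX R[i] (mnm1 i1).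

(** The form of degree [n] that is [P] on the line [x u + v]. *)
Definition homogenize n P : cox_ring R :=
  \sum_(i < n.+1) P`_i *: (hom_along ^+ i * hom_across ^+ (n - i)).

Lemma in_class_homogenize n P : in_class d 0 n (homogenize n P).
Proof.
apply: in_class_sum => i _; apply: in_class_scale.
have := in_class_mul (@in_class_exp _ _ _ i (@in_class_x (v.2 / frame_det) (- v.1 / frame_det)))
  (@in_class_exp _ _ _ (n - i)%N (@in_class_x (- u.2 / frame_det) (u.1 / frame_det))).
by rewrite !muln0 !muln1 subnKC// -ltnS.
Qed.

Lemma ev_linear k l w :
  ev (k *: mpolyX R[i] (mnm1 i0) + l *: mpolyX R[i] (mnm1 i1)) w = k * w.1.1 + l * w.1.2.
Proof. by rewrite /ev mevalD !mevalZ !mevalXU !(tnth_nth 0) !inordK. Qed.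

Lemma ev_homogenize n P w : ev (homogenize n P) w =
  \sum_(i < n.+1) P`_i * (along w.1 ^+ i * across w.1 ^+ (n - i)).
Proof.
rewrite /homogenize /ev raddf_sum /=; apply: eq_bigr => i _.
rewrite mevalZ mevalM !rmorphXn /=; congr (_ * (_ ^+ _ * _ ^+ _)).
  by have := ev_linear (v.2 / frame_det) (- v.1 / frame_det) w; rewrite /ev => ->; rewrite /along; ring.
by have := ev_linear (- u.2 / frame_det) (u.1 / frame_det) w; rewrite /ev => ->; rewrite /across; ring.
Qed.

Definition monic_section n (Q : nat -> {poly R[i]}) : cox_ring R :=
  mpolyX R[i] (mnm1 i3) ^+ n + \sum_(k < n) mpolyX R[i] (mnm1 i2) ^+ (n - k) * 
    mpolyX R[i] (mnm1 i3) ^+ k * homogenize ((n - k) * d) (Q k).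

Lemma in_class_monic_section n Q : in_class d n (n * d) (monic_section n Q).
Proof.
move=> m /msuppD_le; rewrite mem_cat => /orP[|].
  by have := @in_class_exp _ _ _ n in_class_t; rewrite muln1; apply.
move: m; change (in_class d n (n * d) (\sum_(k < n) mpolyX R[i] (mnm1 i2) ^+ (n - k) * 
    mpolyX R[i] (mnm1 i3) ^+ k * homogenize ((n - k) * d) (Q k))).
apply: in_class_sum => k _.
have := in_class_mul (in_class_mul (@in_class_exp _ _ _ (n - k)%N in_class_s) (@in_class_exp _ _ _ k in_class_t))
  (@in_class_homogenize ((n - k) * d)%N (Q k)).
have kn : (k <= n)%N := ltnW (ltn_ord k).
have -> : ((n - k) * 1 + k * 1 + 0 = n)%N by lia.
by have -> : ((n - k) * 0 + k * d + (n - k) * d = n * d)%N by rewrite muln0 add0n -mulnDl subnKC.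
Qed.

Lemma ev_monic_section n Q w : ev (monic_section n Q) w = w.2.2 ^+ n +
  \sum_(k < n) w.2.1 ^+ (n - k) * w.2.2 ^+ k * ev (homogenize ((n - k) * d) (Q k)) w.
Proof.
rewrite /monic_section /ev mevalD raddf_sum /=; congr (_ + _).
  by rewrite rmorphXn /= mevalXU (tnth_nth 0) inordK.
apply: eq_bigr => k _; rewrite !mevalM !rmorphXn /= !mevalXU.
by rewrite !(tnth_nth 0) !inordK.
Qed.

Lemma ev_homogenize_line n P x st : (size P <= n.+1)%N ->
  ev (homogenize n P) ((x * u.1 + v.1, x * u.2 + v.2), st) = P.[x].
Proof.
move=> sP; rewrite ev_homogenize along_line across_line (horner_coef_wide _ sP).
by apply: eq_bigr => i _; rewrite expr1n mulr1.
Qed.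

Lemma lead_monic_section n Q : lead n (monic_section n Q) = 1.
Proof.
have := ev_exceptional (w := ((0, 0), (0, 1))) (@in_class_monic_section n Q) erefl.
rewrite ev_monic_section /= expr1n mulr1 => <-; rewrite big1 ?addr0// => k _.
by rewrite expr0n subn_eq0 leqNgt ltn_ord !mul0r.
Qed.

End Homogenization.
End CoxSections.

(** * Monic polynomials over a polynomial ring *)

Section MonicOverPolynomials.
Variable K : closedFieldType.
Implicit Types (P G D : {poly {poly K}}) (L : {poly K}).

(** A linear factor has a root in the fraction field.  In lowest terms [r' / t'], the
    equation of a monic polynomial forces [t'] to divide a power of [r'], so that [t'] is
    a constant. *)
Lemma linear_factor_root P D (c : {poly K}) M : P \is monic -> c != 0 -> c *: P = M * D ->
  size D = 2%N -> exists L, P.[L] = 0.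
Proof.
move=> mP c0 cP sD.
have aux (E : fieldType) (p q k : E) : p != 0 -> p * k * (- q / p) + q * k = 0.
  by move=> p0; field.
have aux' (E : fieldType) (w p q : E) j k : p != 0 ->
    p ^+ (j + k) * (w * (- q / p) ^+ j) = w * ((- q) ^+ j * p ^+ k).
  by move=> p0; rewrite exprMn exprVn exprD; field; rewrite expf_neq0.
pose r := D`_0; pose t := D`_1.
have t0 : t != 0 by rewrite /t -[1%N]/(2.-1) -sD -lead_coefE lead_coef_eq0 -size_poly_eq0 sD.
pose h := gcdp r t; have h0 : h != 0 by rewrite gcdp_eq0 negb_and t0 orbT.
pose r' := r %/ h; pose t' := t %/ h.
have rE : r = r' * h by rewrite divpK// dvdp_gcdl.
have tE : t = t' * h by rewrite divpK// dvdp_gcdr.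
have t'0 : t' != 0 by apply: contraNneq t0; rewrite tE => ->; rewrite mul0r.
have cop : coprimep r' t'.
  by apply: coprimep_div_gcd; rewrite t0 orbT.
pose F (p : {poly K}) : {fraction {poly K}} := tofrac p.
have F0 p : (F p == 0) = (p == 0) by exact: tofrac_eq0.
pose x := - F r' / F t'.
have Px : (map_poly (@tofrac _) P).[x] = 0.
  have Dx : (map_poly (@tofrac _) D).[x] = 0.
    have -> : D = t *: 'X + r%:P.
      apply/polyP => i; rewrite coefD coefZ coefX coefC.
      case: i => [|[|i]]; rewrite ?(mulr0, mulr1, add0r, addr0)//.
      by rewrite nth_default// sD.
    rewrite rmorphD /= map_polyZ /= map_polyX map_polyC /= hornerD hornerZ hornerX hornerC /x.
    rewrite rE tE !rmorphM /=; apply: (aux {fraction {poly K}}); by rewrite F0.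
  have := congr1 (fun p => (map_poly (@tofrac _) p).[x]) cP.
  rewrite rmorphM /= hornerM Dx mulr0 map_polyZ hornerZ => /eqP.
  rewrite mulf_eq0 => /orP[Fc|/eqP//]; by move: c0; rewrite -F0 /F Fc.
pose n := (size P).-1.
have sP : size P = n.+1 by rewrite prednK// lt0n size_poly_eq0 monic_neq0.
have dv : t' %| r' ^+ n.
  have : \sum_(k < n.+1) P`_k * ((- r') ^+ k * t' ^+ (n - k)) = 0.
    apply/eqP; rewrite -F0 /F rmorph_sum /=; apply/eqP.
    transitivity (F t' ^+ n * (map_poly (@tofrac _) P).[x]); last by rewrite Px mulr0.
    rewrite (@horner_coef_wide _ n.+1); last by rewrite -sP; exact: size_poly.
    rewrite mulr_sumr; apply: eq_bigr => k _.
    have kn : (k <= n)%N by rewrite -ltnS.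
    rewrite coef_map /= !rmorphM !rmorphXn /= rmorphN /=.
    by have := aux' {fraction {poly K}} (F P`_k) (F t') (F r') k (n - k)%N; rewrite (subnKC kn) F0 => ->.
  rewrite big_ord_recr /= subnn expr0 mulr1.
  have -> : P`_n = 1 by have := monicP mP; rewrite lead_coefE sP.
  rewrite mul1r exprNn => /eqP; rewrite addrC addr_eq0 => /eqP h1.
  have : t' %| (-1) ^+ n * r' ^+ n.
    rewrite h1 dvdpNr; apply: (big_ind (fun p => t' %| p)) => [|p q dp dq|k _]; first exact: dvdp0.
      by rewrite dvdp_add.
    rewrite dvdp_mull// dvdp_mull// -(subnSK (ltn_ord k)) exprS dvdp_mulr//; exact: dvdpp.
  by rewrite -signr_odd; case: (odd n); rewrite ?expr1 ?expr0 ?mulN1r ?mul1r ?dvdpNr.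
have st : size t' = 1%N.
  apply/eqP; rewrite -dvdp1; have cn : coprimep t' (r' ^+ n) by rewrite coprimep_expr// coprimep_sym.
  move: cn => /coprimepP/(_ t' (dvdpp _) dv); by rewrite -size_poly_eq1 -dvdp1.
have [k k0 tk] : exists2 k, k != 0 & t' = k%:P by apply/size_poly1P; rewrite st.
exists (- (k^-1 *: r')); apply/eqP; rewrite -F0 /F -horner_map /=; apply/eqP; rewrite -[RHS]Px.
congr _.[_]; rewrite rmorphN /= /x mulNr; congr (- _).
by apply: (canRL (mulfK _)); [rewrite F0 tk polyC_eq0|rewrite /F -rmorphM /= tk mulrC mul_polyC scalerA mulfV// scale1r].
Qed.

(** In degree at most 3, one factor of a proper factorization is linear. *)
Lemma monic_factor_size P : P \is monic -> (size P <= 4)%N ->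
    ((2 < size P)%N -> forall L, P.[L] != 0) ->
  forall D, Pdiv.Idomain.dvdp D P -> (1 < size D)%N -> size D = size P.
Proof.
move=> mP sP noroot D dD sD.
have P0 : P != 0 by exact: monic_neq0.
have := dvdp_leq P0 dD; rewrite leq_eqVlt => /orP[/eqP//|lt].
have {}noroot : forall L, P.[L] != 0 by apply: noroot; exact: leq_ltn_trans lt.
have /Pdiv.Idomain.dvdpP[[c M] /= c0 cP] := dD.
have D0 : D != 0 by rewrite -size_poly_gt0; exact: leq_trans sD.
have M0 : M != 0.
  by apply: contraNneq P0 => M0; move: cP; rewrite M0 mul0r => /(congr1 (fun p : {poly {poly K}} => size p));
  rewrite size_scale// size_poly0 => /eqP; rewrite size_poly_eq0.
have sE : size P = (size M + size D).-1 by rewrite -size_mul// -cP size_scale.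
have noL (Q N : {poly {poly K}}) : size Q = 2%N -> c *: P = N * Q -> False.
  by move=> sQ /(linear_factor_root mP c0)/(_ sQ)[L /eqP]; rewrite (negbTE (noroot L)).
have [s2|s2] := eqVneq (size D) 2%N; first by case: (noL _ _ s2 cP).
have s2' : size M = 2%N by move: sE sP lt sD s2; move: (size P) (size D) (size M) => p q m; lia.
by case: (noL M D s2'); rewrite mulrC.
Qed.

(** Elimination: away from finitely many values of the parameter, the two polynomials
    have no common zero. *)
Lemma elimination P G : P \is monic -> (1 < size P)%N ->
    (forall D, Pdiv.Idomain.dvdp D P -> (1 < size D)%N -> size D = size P) ->
    (forall T, G != T * P) ->
  exists2 r : {poly K}, r != 0 & exists A B, r%:P = A * P + B * G.
Proof.
move=> mP sP irr nG.
have [sG|sG] := leqP (size G) 1.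
  have GE := size1_polyC sG; exists G`_0; last by exists 0, 1; rewrite mul0r add0r mul1r -GE.
  by apply: contraNneq (nG 0) => g0; rewrite GE g0 mul0r.
have [[A B] /= _ rE] := resultant_in_ideal sP sG.
exists (resultant P G); last by exists A, B.
rewrite resultant_eq0; apply/negP => sD.
have dP := Pdiv.Idomain.dvdp_gcdl P G; have dG := Pdiv.Idomain.dvdp_gcdr P G.
have e := irr _ dP sD.
have eq : Pdiv.Idomain.eqp (Pdiv.Idomain.gcdp P G) P by rewrite -(dvdp_size_eqp dP) e.
have : Pdiv.Idomain.dvdp P G by rewrite -(eqp_dvdl _ eq).
by move=> /(Pdiv.IdomainMonic.dvdpP mP)[T GE]; move: (nG T); rewrite GE eqxx.
Qed.

(** If the degree of [L] exceeded [d], the power [L ^+ n] would dominate all the other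
    terms of the equation. *)
Lemma root_size (d n : nat) P L : size P = n.+1 -> P \is monic ->
  (forall k, (k < n)%N -> (size (P`_k : {poly K})%R <= ((n - k) * d).+1)%N) -> P.[L] = 0 -> (size L <= d.+1)%N.
Proof.
move=> sP mP sk PL; rewrite leqNgt; apply/negP => sL.
have L0 : L != 0 by rewrite -size_poly_gt0; exact: leq_trans sL.
have [e eE] : exists e, size L = e.+1 by exists (size L).-1; rewrite prednK// size_poly_gt0.
have sLX k : size (L ^+ k) = (k * e).+1.
  elim: k => [|k IHk]; first by rewrite expr0 size_poly1.
  by rewrite exprS size_mul ?expf_neq0// IHk eE; lia.
have := PL; rewrite horner_coef sP big_ord_recr /=.
have -> : P`_n = 1 by have := monicP mP; rewrite lead_coefE sP.
rewrite mul1r => /eqP; rewrite addrC addr_eq0 => /eqP h.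
have : (size (L ^+ n) <= n * e)%N.
  rewrite h size_polyN; apply: leq_trans (size_sum _ _ _) _; apply/bigmax_leqP => k _.
  apply: leq_trans (size_polyMleq _ _) _; rewrite sLX.
  have kn := ltn_ord k; have := sk _ kn; set s := size _ => sle.
  have ed : (d < e)%N by move: sL; rewrite eE; lia.
  have : ((n - k) * d + k * e < n * e)%N.
    have -> : (n * e = (n - k) * e + k * e)%N by rewrite -mulnDl subnK// ltnW.
    by rewrite ltn_add2r ltn_pmul2l// subn_gt0.
  move: sle; lia.
by rewrite sLX ltnn.
Qed.

End MonicOverPolynomials.

(** * Irreducible zero loci *)

Section Points.
Variables (R : realType) (d : nat).
Local Notation cx := (R[i]^o).
Local Notation surface := (hirzebruch R d).
Local Notation act := (cox_act d).
Implicit Types (l m x y : cx) (f g : cox_ring R) (w : cox_space R) (u v p : (cx * cx)%type) (z : surface).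

Lemma cox_domainP z : cox_domain (cox z).
Proof. exact: set_mem (valP (repr z)). Qed.

Definition point w (h : w \in @cox_domain R) : surface := \pi_surface (SigSub h).

Lemma cox_point w (h : w \in @cox_domain R) : exists l m, [/\ l != 0, m != 0 & cox (point h) = act l m w].
Proof.
have /eqmodP : \pi_surface (SigSub h) = \pi_surface (repr (point h)) by rewrite reprK.
by move=> /asboolP[l [m [l0 m0 e]]]; exists l, m.
Qed.

Lemma point_eq w w' (h : w \in @cox_domain R) (h' : w' \in @cox_domain R) l m :
  l != 0 -> m != 0 -> w' = act l m w -> point h = point h'.
Proof. by move=> l0 m0 e; apply/eqmodP/asboolP; exists l, m. Qed.

Lemma cox_inj z w (h : w \in @cox_domain R) l m : l != 0 -> m != 0 -> cox z = act l m w -> z = point h.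
Proof.
move=> l0 m0 e; rewrite -[z]reprK; apply/esym.
have -> : repr z = SigSub (valP (repr z)) by apply/val_inj.
exact: point_eq l0 m0 e.
Qed.

Lemma ev_act_eq0 a b f l m w : in_class d a b f -> l != 0 -> m != 0 ->
  (ev f (act l m w) == 0) = (ev f w == 0).
Proof.
move=> fab l0 m0; rewrite (ev_act fab) mulf_eq0 mulf_eq0.
by rewrite !expf_eq0 (negbTE l0) (negbTE m0) !andbF.
Qed.

Lemma zero_locus_point a b f w (h : w \in @cox_domain R) : in_class d a b f ->
  zero_locus f (point h) <-> ev f w = 0.
Proof.
move=> fab; have [l [m [l0 m0 e]]] := cox_point h.
change (ev f (cox (point h)) = 0 <-> ev f w = 0); rewrite e.
have e2 := ev_act_eq0 w fab l0 m0.
by split=> /eqP; [rewrite e2|rewrite -e2] => /eqP.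
Qed.

Definition line_coords u v (x y : cx) : cox_space R := ((x * u.1 + v.1, x * u.2 + v.2), (1, y)).

Section Frame.
Variables u v : (cx * cx)%type.
Hypothesis uv0 : frame_det u v != 0.

Lemma line_coords_domain x y : line_coords u v x y \in @cox_domain R.
Proof.
apply/mem_set; split; last by move=> /= [/eqP]; rewrite oner_eq0.
move=> /= e; have := across_line uv0 x; rewrite e /across /= !mulr0 subrr mul0r => /eqP.
by rewrite eq_sym oner_eq0.
Qed.

Definition line_point x y : surface := point (line_coords_domain x y).

Lemma across_eq0 p : (across u v p == 0) = (p.1 * u.2 == p.2 * u.1).
Proof.
by rewrite /across mulf_eq0 invr_eq0 (negbTE uv0) orbF subr_eq0 eq_sym [u.2 * _]mulrC [u.1 * _]mulrC.
Qed.

Definition base_coord w : cx := along u v w.1 / across u v w.1.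
Definition fibre_coord w : cx := w.2.2 / (w.2.1 * across u v w.1 ^+ d).

Lemma normalize w : across u v w.1 != 0 -> w.2.1 != 0 ->
  w = act (across u v w.1) w.2.1 (line_coords u v (base_coord w) (fibre_coord w)).
Proof.
move=> a0 s0; case: w a0 s0 => [p [s t]] /= a0 s0.
rewrite /cox_act /line_coords /base_coord /fibre_coord /=; congr (_, _).
  rewrite {1}(frame_coordinates uv0 p).
  by congr (_, _); rewrite mulrDr mulrA mulrCA divff// mulr1.
congr (_, _); first by rewrite mulr1.
by rewrite mulrC divfK// mulf_neq0 ?expf_neq0.
Qed.

Lemma coords_act l m w : l != 0 -> m != 0 ->
  (base_coord (act l m w), fibre_coord (act l m w)) = (base_coord w, fibre_coord w).
Proof.
move=> l0 m0; case: w => [p [s t]]; rewrite /base_coord /fibre_coord /=.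
have -> : across u v (l * p.1, l * p.2) = l * across u v p by rewrite /across /=; field; exact: uv0.
have -> : along u v (l * p.1, l * p.2) = l * along u v p by rewrite /along /=; field; exact: uv0.
congr (_, _); first by rewrite invfM mulrACA divff// mul1r.
by rewrite exprMn [m * s * _]mulrACA -mulf_div divff ?mulf_neq0 ?expf_neq0// mul1r.
Qed.

Lemma coords_line x y : base_coord (line_coords u v x y) = x /\ fibre_coord (line_coords u v x y) = y.
Proof.
rewrite /base_coord /fibre_coord /= along_line// across_line// expr1n mulr1 !divr1.
by split.
Qed.

Lemma cox_line_point x y : base_coord (cox (line_point x y)) = x /\ fibre_coord (cox (line_point x y)) = y.
Proof.
have [l [m [l0 m0 ->]]] := cox_point (line_coords_domain x y).
by have [-> ->] := coords_act (line_coords u v x y) l0 m0; exact: coords_line.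
Qed.

Lemma line_point_cox z : ~ fiber u z -> ~ exceptional_section z ->
  z = line_point (base_coord (cox z)) (fibre_coord (cox z)).
Proof.
move=> nF /eqP s0; have a0 : across u v (cox z).1 != 0 by rewrite across_eq0; apply/eqP.
exact: cox_inj a0 s0 (normalize a0 s0).
Qed.

Lemma line_point_fiber x y : ~ fiber u (line_point x y).
Proof.
have [l [m [l0 m0 e]]] := cox_point (line_coords_domain x y).
rewrite /fiber /line_point /= e /= => /eqP.
rewrite -[_ == _](across_eq0 (l * (x * u.1 + v.1), l * (x * u.2 + v.2))) => /eqP.
have -> : across u v (l * (x * u.1 + v.1), l * (x * u.2 + v.2)) =
    l * across u v (x * u.1 + v.1, x * u.2 + v.2) by rewrite /across /=; field; exact: uv0.
by rewrite across_line// mulr1 => /eqP; rewrite (negbTE l0).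
Qed.

Lemma line_point_exceptional x y : ~ exceptional_section (line_point x y).
Proof.
have [l [m [l0 m0 e]]] := cox_point (line_coords_domain x y).
by rewrite /exceptional_section /line_point /= e /= mulr1; exact/eqP.
Qed.

Definition chart_poly a f : {poly {poly R[i]}} := \poly_(k < a.+1) chart_coef f u v k.

Lemma chart_polyE a b f x y : in_class d a b f ->
  ((chart_poly a f).[y%:P]).[x] = ev f (line_coords u v x y).
Proof.
move=> fab; rewrite (ev_chart fab) horner_poly horner_sum; apply: eq_bigr => k _.
by rewrite hornerM -polyC_exp hornerC expr1n mulr1.
Qed.

End Frame.

Lemma horner_at_value (P : {poly {poly R[i]}}) L (x : R[i]) : (P.[(L.[x])%:P]).[x] = (P.[L]).[x].
Proof.
rewrite (horner_coef P L) (horner_coef P (L.[x])%:P) !horner_sum; apply: eq_bigr => k _.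
by rewrite !hornerM !horner_exp hornerC.
Qed.

Section MonicSection.
Variables (n : nat) (f : cox_ring R).
Hypotheses (fn : in_class d n (n * d) f) (f0 : lead n f != 0).

Lemma zero_locus_not_exceptional z : zero_locus f z -> ~ exceptional_section z.
Proof.
move=> fz s0; have : ev f (cox z) = 0 by exact: fz.
rewrite (ev_exceptional fn s0) => /eqP.
rewrite mulf_eq0 (negbTE f0) expf_eq0 => /andP[_ /eqP t0].
by have [_] := cox_domainP z; apply; move: s0 t0; rewrite /exceptional_section /=; case: (cox z).2 => s t /= -> ->.
Qed.

Definition monic_chart u v : {poly {poly R[i]}} := (lead n f)^-1%:P *: chart_poly u v n f.

Lemma monic_chartE u v x y : ((monic_chart u v).[y%:P]).[x] = (lead n f)^-1 * ev f (line_coords u v x y).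
Proof. by rewrite hornerZ hornerM hornerC (chart_polyE u v x y fn). Qed.

Lemma monic_chart_coef u v k : (monic_chart u v)`_k =
  if (k < n.+1)%N then (lead n f)^-1 *: chart_coef f u v k else 0.
Proof. by rewrite coefZ coef_poly; case: ifP => _; rewrite ?mulr0// mul_polyC. Qed.

Lemma monic_chart_monic u v : monic_chart u v \is monic /\ size (monic_chart u v) = n.+1.
Proof.
have top : (monic_chart u v)`_n = 1.
  by rewrite monic_chart_coef ltnSn (chart_coef_lead _ _ fn) -mul_polyC -polyCM mulVf.
have sz : size (monic_chart u v) = n.+1.
  apply/eqP; rewrite eqn_leq; apply/andP; split.
    by apply/leq_sizeP => k kn; rewrite monic_chart_coef ltnNge kn.
  by rewrite ltnNge; apply/negP => /leq_sizeP/(_ n (leqnn _)) /eqP; rewrite top oner_eq0.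
by split=> //; apply/monicP; rewrite lead_coefE sz.
Qed.

Lemma size_monic_chart_coef u v k : (k < n)%N ->
  (size ((monic_chart u v)`_k : {poly R[i]})%R <= ((n - k) * d).+1)%N.
Proof.
move=> kn; rewrite monic_chart_coef ltnS (ltnW kn); apply: leq_trans (size_scale_leq _ _) _.
by rewrite mulnBl [(k * d)%N]mulnC; exact: (size_chart_coef fn).
Qed.

Lemma zero_locus_over u v x : (0 < n)%N -> exists y, ev f (line_coords u v x y) = 0.
Proof.
move=> n0; have [mP sP] := monic_chart_monic u v.
pose p : {poly R[i]} := map_poly (horner_eval x) (monic_chart u v).
have sp : size p = n.+1.
  by rewrite size_map_poly_id0 // (monicP mP) /horner_eval hornerC oner_eq0.
have [y yP] : exists y, root p y by apply/closed_rootP; rewrite sp eqSS -lt0n.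
exists y; move: yP; rewrite /root /p.
have -> : (map_poly (horner_eval x) (monic_chart u v)).[y] = ((monic_chart u v).[y%:P]).[x].
  by rewrite -[RHS]/(horner_eval x _) -horner_map /= /horner_eval hornerC.
by rewrite monic_chartE mulf_eq0 invr_eq0 (negbTE f0) => /eqP.
Qed.

Lemma zero_locus_nonempty : (0 < n)%N -> @zero_locus R d f !=set0.
Proof.
move=> n0; have uv0 : frame_det (1, 0) (0, 1) != 0 :> cx.
  by rewrite /frame_det /= mulr1 mulr0 subr0 oner_eq0.
have [y fy] := zero_locus_over (1, 0) (0, 1) 0 n0.
by exists (line_point uv0 0 y); apply/(zero_locus_point _ fn).
Qed.

(** The closure of the graph of a root of the chart polynomial is a section. *)
Lemma root_section u v L : frame_det u v != 0 -> (monic_chart u v).[L] = 0 ->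
  exists g, [/\ in_class d 1 (1 * d) g, lead 1 g != 0,
    forall x y, ev g (line_coords u v x y) = y - L.[x] &
    forall w, cox_domain w -> ev g w = 0 -> ev f w = 0].
Proof.
move=> uv0 PL; have [mP sP] := monic_chart_monic u v.
have sL := root_size sP mP (@size_monic_chart_coef u v) PL.
pose g := monic_section d u v 1 (fun=> - L).
have gE w : ev g w = w.2.2 - w.2.1 * ev (homogenize u v d L) w.
  rewrite /g ev_monic_section big_ord1 !expr1 expr0 mulr1 subn0 mul1n; congr (_ + _).
  rewrite !ev_homogenize -mulrN; congr (_ * _).
  by rewrite -sumrN; apply: eq_bigr => i _; rewrite coefN mulNr.
have gl x y : ev g (line_coords u v x y) = y - L.[x].
  by rewrite gE /= mul1r (ev_homogenize_line uv0).
have gc : in_class d 1 (1 * d) g by exact: in_class_monic_section.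
have g1 : lead 1 g != 0.
  by rewrite /g lead_monic_section//; exact: oner_neq0.
exists g; split=> //.
have chart w : across u v w.1 != 0 -> w.2.1 != 0 -> ev g w = 0 -> ev f w = 0.
  move=> a0 s0 gw; have e := normalize uv0 a0 s0; move: gw; rewrite e => /eqP.
  rewrite (ev_act_eq0 _ gc)// gl subr_eq0 => /eqP yL; apply/eqP.
  rewrite (ev_act_eq0 _ fn)// yL; have := monic_chartE u v (base_coord u v w) L.[base_coord u v w].
  have -> : ((monic_chart u v).[(L.[base_coord u v w])%:P]).[base_coord u v w] =
      ((monic_chart u v).[L]).[base_coord u v w] by exact: horner_at_value.
  by rewrite PL horner0 => /esym/eqP; rewrite mulf_eq0 invr_eq0 (negbTE f0).
move=> w [_ w2] gw.
have [s0|s0] := eqVneq w.2.1 0.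
  by exfalso; apply: w2; move: gw; rewrite gE s0 mul0r subr0 => t0; case: (w.2) s0 t0 => s t /= -> ->.
case: w {w2} gw s0 => [[p1 p2] [s t]] /= gw s0.
(* A point of the section on the fibre at infinity is approached inside the section,
   moving its base point in the direction [v]. *)
pose A : {poly R[i]} := 'X + (across u v (p1, p2))%:P.
pose T : {poly R[i]} := s *: \sum_(i < d.+1) L`_i *: ((along u v (p1, p2)) ^+ i *: A ^+ (d - i)).
have tE e : ev (homogenize u v d L) ((p1 + e * v.1, p2 + e * v.2), (s, T.[e])) * s = T.[e].
  rewrite ev_homogenize /T hornerZ horner_sum mulrC; congr (_ * _).
  apply: eq_bigr => i _; rewrite !hornerZ horner_exp /A hornerD hornerX hornerC; congr (_ * (_ ^+ _ * _ ^+ _)).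
    by rewrite /along /frame_det /=; field; exact: uv0.
  by rewrite /across /frame_det /=; field; exact: uv0.
have A0 : A != 0 by rewrite -size_poly_eq0 /A size_XaddC.
have := @ev_density R f A (p1%:P + v.1 *: 'X) (p2%:P + v.2 *: 'X) s%:P T A0.
have T0 : T.[0] = t.
  move/eqP: gw; rewrite gE /= subr_eq0 => /eqP ->; rewrite -tE mulrC !ev_homogenize /=.
  by rewrite !mul0r !addr0.
clearbody T; move=> /(_ _ 0); rewrite !hornerD !hornerZ !hornerC !hornerX !mulr0 !addr0 T0; apply.
move=> e Ae; rewrite !hornerD !hornerZ !hornerC !hornerX; apply: chart => //=.
  move: Ae; rewrite /A hornerD hornerX hornerC; congr (_ != _).
  by rewrite /across /frame_det /=; field; exact: uv0.
rewrite gE /= ![v.1 * e]mulrC ![v.2 * e]mulrC [s * _]mulrC.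
by apply/eqP; rewrite subr_eq0 (tE e).
Qed.

(** All but finitely many fibres avoid two given points. *)
Lemma generic_frame z1 z2 : exists u v, [/\ frame_det u v != 0, ~ fiber u z1 & ~ fiber u z2].
Proof.
pose q z : {poly R[i]} := (cox z).1.1 *: 'X - (cox z).1.2%:P.
have q0 z : q z != 0.
  have [h _] := cox_domainP z; apply: contra_notN h => /eqP qz.
  have c0 := congr1 (fun p : {poly R[i]} => p`_0) qz; have c1 := congr1 (fun p : {poly R[i]} => p`_1) qz.
  move: c0 c1; rewrite /q !coefB !coefZ !coefX !coefC /= mulr0 mulr1 subr0 sub0r => /eqP.
  by rewrite oppr_eq0 => /eqP; case: (cox z).1 => s t /= -> ->.
have /closed_nonrootP[k] : q z1 * q z2 != 0 by rewrite mulf_neq0.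
rewrite /root hornerM mulf_eq0 negb_or => /andP[k1 k2].
have nF z : (q z).[k] != 0 -> ~ fiber (1, k) z.
  move=> /eqP h e; apply: h; rewrite /q hornerD hornerN hornerZ hornerX hornerC.
  by apply/eqP; rewrite subr_eq0; apply/eqP; move: e; rewrite /fiber /= mulr1.
exists (1, k), (0, 1); split; [|exact: nF|exact: nF].
by rewrite /frame_det /= mulr1 mulr0 subr0 oner_eq0.
Qed.

(** Two forms whose product vanishes on the curve: in a chart containing a point of the
    curve off each of them, neither is a multiple of the irreducible chart polynomial, so
    by elimination a generic fibre meets the curve at common zeros of neither. *)
Lemma irreducible_zero_locus : (0 < n <= 3)%N ->
    ((1 < n)%N -> forall g, in_class d 1 (1 * d) g -> lead 1 g != 0 ->
       ~ (forall w, cox_domain w -> ev g w = 0 -> ev f w = 0)) ->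
  zariski_irreducible (@zero_locus R d f).
Proof.
move=> /andP[n0 n3] nosec; split; first exact: zero_locus_nonempty.
move=> B1 B2 [S1 [c1 ->]] [S2 [c2 ->]] AB; apply: contrapT => /not_orP[n1 n2].
have witness (S : set (cox_ring R)) : ~ (zero_locus f `<=` \bigcap_(g in S) @zero_locus R d g) ->
    exists z g, [/\ zero_locus f z, S g & ~ zero_locus g z].
  move=> /existsNP[z] /not_implyP[fz] /existsNP[g] /not_implyP[Sg ng].
  by exists z, g.
have [z1 [g1 [fz1 Sg1 ng1]]] := witness _ n1.
have [z2 [g2 [fz2 Sg2 ng2]]] := witness _ n2.
have [a1 [b1 h1]] := c1 _ Sg1; have [a2 [b2 h2]] := c2 _ Sg2.
have [u [v [uv0 nF1 nF2]]] := generic_frame z1 z2.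
have [mP sP] := monic_chart_monic u v; set P := monic_chart u v in mP sP.
have irr : forall D, Pdiv.Idomain.dvdp D P -> (1 < size D)%N -> size D = size P.
  apply: (monic_factor_size mP); first by rewrite sP ltnS.
  rewrite sP ltnS => nn L; apply/negP => /eqP PL.
  have [g [gc gl _ gf]] := root_section uv0 PL.
  exact: nosec nn g gc gl gf.
have elim a b g z : in_class d a b g -> zero_locus f z -> ~ fiber u z -> ~ zero_locus g z ->
    exists2 r : {poly R[i]}, r != 0 & forall x y, ev f (line_coords u v x y) = 0 ->
      ev g (line_coords u v x y) = 0 -> r.[x] = 0.
  move=> gab fz nF ng.
  have zE := line_point_cox uv0 nF (zero_locus_not_exceptional fz).
  set x0 := base_coord _ _ _ in zE; set y0 := fibre_coord _ _ _ in zE.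
  have f0' : ev f (line_coords u v x0 y0) = 0.
    by apply/(zero_locus_point (line_coords_domain uv0 x0 y0) fn); rewrite -[point _]zE.
  have g0' : ev g (line_coords u v x0 y0) <> 0.
    by move=> /(zero_locus_point (line_coords_domain uv0 x0 y0) gab); rewrite -[point _]zE.
  have [|T|r r0 [A [B rE]]] := @elimination _ P (chart_poly u v a g) mP _ irr.
  - by rewrite sP ltnS.
  - apply/eqP => GE; apply: g0'; rewrite -(chart_polyE u v x0 y0 gab) GE !hornerM.
    by rewrite monic_chartE f0' !mulr0.
  - exists r; first exact: r0.
    move=> x y fxy gxy.
    have := congr1 (fun p : {poly {poly R[i]}} => (p.[y%:P]).[x]) rE.
    rewrite hornerC hornerD !hornerM hornerD !hornerM monic_chartE fxy (chart_polyE u v x y gab) gxy.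
    by rewrite !mulr0 addr0.
have [r1 r10 e1] := elim _ _ _ _ h1 fz1 nF1 ng1.
have [r2 r20 e2] := elim _ _ _ _ h2 fz2 nF2 ng2.
have /closed_nonrootP[x] : r1 * r2 != 0 by rewrite mulf_neq0.
rewrite /root hornerM mulf_eq0 negb_or => /andP[/eqP x1 /eqP x2].
have [y fy] := zero_locus_over u v x n0.
have dom := line_coords_domain uv0 x y.
have fp : zero_locus f (point dom) by apply/(zero_locus_point _ fn).
have [gp|gp] := AB _ fp.
  by apply: x1; apply: e1 fy _; apply/(zero_locus_point dom h1); exact: gp.
by apply: x2; apply: e2 fy _; apply/(zero_locus_point dom h2); exact: gp.
Qed.

End MonicSection.
End Points.

(** * The affine chart *)

Lemma three_points (T : Type) (B : set T) : (`I_3 #<= B)%card ->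
  exists b1 b2 b3, [/\ B b1, B b2, B b3 & [/\ b1 <> b2, b2 <> b3 & b1 <> b3]].
Proof.
move=> /card_leP[h].
pose el k (k3 : (k < 3)%N) : set_type `I_3 := SigSub (mem_set (k3 : `I_3 k)).
have neq k l (k3 : (k < 3)%N) (l3 : (l < 3)%N) : k != l -> val (h (el k k3)) <> val (h (el l l3)).
  move=> kl /val_inj/(inj (mem_set I) (mem_set I)) /(congr1 val) /= e.
  by move: kl; rewrite e eqxx.
exists (val (h (el 0 isT))), (val (h (el 1 isT))), (val (h (el 2 isT))).
by split; [exact: set_mem (valP _)|exact: set_mem (valP _)|exact: set_mem (valP _)|split; exact: neq].
Qed.

Section PointwiseContinuity.
Variables (R : realType) (T : topologicalType).
Local Notation cx := (R[i]^o).

Lemma continuous_divc_at (h k : T -> cx) (t : T) : continuous h -> continuous k -> k t != 0 ->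
  {for t, continuous (fun t => h t / k t : cx)}.
Proof. by move=> ch ck k0; apply: cvgM; [exact: ch|apply: cvgV; [exact: k0|exact: ck]]. Qed.

Lemma continuous_expc (h : T -> cx) n : continuous h -> continuous (fun t => h t ^+ n : cx).
Proof.
move=> ch; elim: n => [|n IHn]; first by move=> t; exact: cst_continuous.
have -> : (fun t => h t ^+ n.+1 : cx) = fun t => h t * h t ^+ n.
  by apply/funext => t; rewrite exprS.
exact: continuous_mulc.
Qed.
End PointwiseContinuity.

Section AffineChart.
Variables (R : realType) (d : nat).
Local Notation cx := (R[i]^o).
Local Notation surface := (hirzebruch R d).
Variables (f : cox_ring R) (u v : (cx * cx)%type).
Hypotheses (f3 : in_class d 3 (3 * d) f) (f0 : lead 3 f != 0) (uv0 : frame_det u v != 0).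
Local Notation A := (@zero_locus R d f).
Local Notation X := (set_type (affine_complement A (@fiber R d u))).

Definition curve_coef k (s t : (cx * cx)%type) : {poly R[i]} := (monic_chart 3 f s t)`_k.

Lemma cubic_chart s t x y : cubic (curve_coef 2 s t) (curve_coef 1 s t) (curve_coef 0 s t) x y =
  (lead 3 f)^-1 * ev f (line_coords s t x y).
Proof.
rewrite -(monic_chartE f3); have [mP sP] := monic_chart_monic f3 f0 s t.
have top : (monic_chart 3 f s t)`_3 = 1 by have := monicP mP; rewrite lead_coefE sP.
rewrite (horner_coef (monic_chart 3 f s t)) sP !big_ord_recr big_ord0 /= add0r top mul1r.
rewrite -/(curve_coef 0 s t) -/(curve_coef 1 s t) -/(curve_coef 2 s t) /cubic.
by rewrite !hornerD !hornerM !horner_exp !hornerC expr0 mulr1 expr1; ring.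
Qed.

Lemma cubic_chart_eq0 s t x y :
  cubic (curve_coef 2 s t) (curve_coef 1 s t) (curve_coef 0 s t) x y = 0 <->
  ev f (line_coords s t x y) = 0.
Proof.
rewrite cubic_chart; split=> [/eqP|->]; last by rewrite mulr0.
by rewrite mulf_eq0 invr_eq0 (negbTE f0) => /eqP.
Qed.

Local Notation a := (curve_coef 2 u v).
Local Notation b := (curve_coef 1 u v).
Local Notation c := (curve_coef 0 u v).
Local Notation O := (curve_complement a b c).

Definition to_chart (z : surface) : (cx * cx)%type := (base_coord u v (cox z), fibre_coord d u v (cox z)).

Lemma line_point_complement p : affine_complement A (fiber u) (line_point d uv0 p.1 p.2) <-> O p.
Proof.
have zE := zero_locus_point (line_coords_domain uv0 p.1 p.2) f3.
split=> [h /(cubic_chart_eq0 u v p.1 p.2).1 h'|h [[|]|]].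
- by apply: h; left; left; apply/zE.
- by move=> /zE h'; apply: h; apply/cubic_chart_eq0.
- exact: line_point_exceptional.
- exact: line_point_fiber.
Qed.

Lemma to_chartK (z : surface) : affine_complement A (fiber u) z ->
  line_point d uv0 (to_chart z).1 (to_chart z).2 = z.
Proof.
by move=> zA; rewrite /to_chart /= -(line_point_cox uv0)// => h; apply: zA; [right|left; right].
Qed.

Lemma line_pointK p : to_chart (line_point d uv0 p.1 p.2) = p.
Proof. by have [e1 e2] := cox_line_point d uv0 p.1 p.2; rewrite /to_chart e1 e2 -surjective_pairing. Qed.

Lemma continuous_pair (T S U : topologicalType) (h : T -> S) (k : T -> U) (t : T) :
  {for t, continuous h} -> {for t, continuous k} -> {for t, continuous (fun t => (h t, k t))}.
Proof.
move=> ch ck; exact: (@cvg_pair T S U (nbhs t) (nbhs (h t)) (nbhs (k t)) _ _ _ _ _ ch ck).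
Qed.

Lemma continuous_line_point : continuous (fun p : (cx * cx)%type => line_point d uv0 p.1 p.2).
Proof.
pose h (p : (cx * cx)%type) : set_type (@cox_domain R) := SigSub (line_coords_domain uv0 p.1 p.2).
have c1 : continuous (fst : cx * cx -> cx) by move=> ?; exact: cvg_fst.
have c2 : continuous (snd : cx * cx -> cx) by move=> ?; exact: cvg_snd.
have ch : continuous h.
  apply: continuous_comp_initial.
  have line (s t : cx) : continuous (fun p : (cx * cx)%type => p.1 * s + t : cx).
    apply: (@continuous_addc R (cx * cx)%type (fun p => p.1 * s)); last exact: cst_continuous.
    apply: (continuous_mulc c1); exact: cst_continuous.
  change (continuous (fun p : (cx * cx)%type =>
    ((p.1 * u.1 + v.1 : cx, p.1 * u.2 + v.2 : cx), (1 : cx, p.2)))).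
  have cl : continuous (fun p : (cx * cx)%type => (p.1 * u.1 + v.1 : cx, p.1 * u.2 + v.2 : cx)).
    by move=> p; exact: (@continuous_pair (cx * cx)%type cx cx _ _ p (line _ _ p) (line _ _ p)).
  have cr : continuous (fun p : (cx * cx)%type => (1 : cx, p.2)).
    by move=> p; exact: (@continuous_pair (cx * cx)%type cx cx (fun=> 1) snd p (@cst_continuous _ _ _ p) (c2 p)).
  by move=> p; exact: (@continuous_pair (cx * cx)%type (cx * cx)%type (cx * cx)%type _ _ p (cl p) (cr p)).
exact: (continuous_compose ch (@pi_continuous _ {eq_quot cox_equiv R d})).
Qed.

Definition chart_coords (w : cox_space R) : (cx * cx)%type := (base_coord u v w, fibre_coord d u v w).

Lemma continuous_cox11 : continuous (fun w : cox_space R => w.1.1 : cx).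
Proof. by move=> x; apply: (@continuous_comp _ _ _ fst fst); exact: cvg_fst. Qed.

Lemma continuous_cox12 : continuous (fun w : cox_space R => w.1.2 : cx).
Proof. by move=> x; apply: (@continuous_comp _ _ _ fst snd); [exact: cvg_fst|exact: cvg_snd]. Qed.

Lemma continuous_cox21 : continuous (fun w : cox_space R => w.2.1 : cx).
Proof. by move=> x; apply: (@continuous_comp _ _ _ snd fst); [exact: cvg_snd|exact: cvg_fst]. Qed.

Lemma continuous_cox22 : continuous (fun w : cox_space R => w.2.2 : cx).
Proof. by move=> x; apply: (@continuous_comp _ _ _ snd snd); exact: cvg_snd. Qed.

Lemma continuous_form (k l : cx) : continuous (fun w : cox_space R => k * w.1.1 + l * w.1.2 : cx).
Proof.
have cst (m : cx) : continuous (fun _ : cox_space R => m) by exact: cst_continuous.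
exact: (continuous_addc (continuous_mulc (cst _) continuous_cox11) (continuous_mulc (cst _) continuous_cox12)).
Qed.

Lemma continuous_across : continuous (fun w : cox_space R => across u v w.1).
Proof.
have -> : (fun w : cox_space R => across u v w.1) =
    fun w => (- u.2 / frame_det u v) * w.1.1 + (u.1 / frame_det u v) * w.1.2.
  by apply/funext => w; rewrite /across; ring.
exact: continuous_form.
Qed.

Lemma continuous_along : continuous (fun w : cox_space R => along u v w.1).
Proof.
have -> : (fun w : cox_space R => along u v w.1) =
    fun w => (v.2 / frame_det u v) * w.1.1 + (- v.1 / frame_det u v) * w.1.2.
  by apply/funext => w; rewrite /along; ring.
exact: continuous_form.
Qed.

Lemma continuous_chart_coords w : across u v w.1 != 0 -> w.2.1 != 0 ->
  {for w, continuous chart_coords}.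
Proof.
move=> a0 s0; apply: (@continuous_pair _ _ _ (fun w => base_coord u v w) (fun w => fibre_coord d u v w)).
  exact: (continuous_divc_at continuous_along continuous_across a0).
apply: (continuous_divc_at continuous_cox22
  (continuous_mulc continuous_cox21 (@continuous_expc _ _ _ d continuous_across))).
by rewrite mulf_neq0// expf_neq0.
Qed.

(** Representatives do not depend continuously on the point; but the coordinates are
    invariant under the action, so that preimages can be computed upstairs. *)
Lemma continuous_to_chart z : ~ fiber u z -> ~ exceptional_section z -> {for z, continuous to_chart}.
Proof.
move=> nF nE N; rewrite nbhsE => -[N0 [oN0 N0z] N0N].
pose U : set (cox_space R) := [set w | [/\ across u v w.1 != 0, w.2.1 != 0 & N0 (chart_coords w)]].
have oU : open U.
  rewrite openE => w [a0 s0 wN0]; rewrite /interior.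
  have near0 (h : cox_space R -> cx) : continuous h -> h w != 0 -> \forall w' \near w, h w' != 0.
    move=> ch h0; have : \forall w' \near w, nball (h w) (nm (h w)) (h w').
      by apply: ch; apply: nbhs_nball; rewrite nm_gt0.
    apply: filterS => w' hw'; apply: contraTneq hw' => ->.
    by rewrite /nball /= sub0r nmN ltxx.
  have h1 := near0 _ continuous_across a0; have h2 := near0 _ continuous_cox21 s0.
  have h3 : \forall w' \near w, N0 (chart_coords w').
    by apply: (continuous_chart_coords a0 s0); apply: open_nbhs_nbhs; split.
  by apply: filterS3 h1 h2 h3 => w' *; split.
pose V : set surface := [set z' | U (cox z')].
have Uact l m w : l != 0 -> m != 0 -> U (cox_act d l m w) <-> U w.
  move=> l0 m0; rewrite /U /= /chart_coords (coords_act d uv0 w l0 m0).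
  have -> : across u v (l * w.1.1, l * w.1.2) = l * across u v w.1.
    by rewrite /across /=; field; exact: uv0.
  by rewrite !mulf_eq0 (negbTE l0) (negbTE m0).
have oV : open V.
  change (open (\pi_surface @^-1` V)).
  have -> : \pi_surface @^-1` V = (set_val : set_type (@cox_domain R) -> cox_space R) @^-1` U.
    apply/seteqP; split=> -[w h].
      by rewrite /V /=; have [l [m [l0 m0 e]]] := cox_point d h; rewrite -/(point d h) e => /(Uact _ _ _ l0 m0).
    by move=> /= Uw; rewrite /V /=; have [l [m [l0 m0 e]]] := cox_point d h; rewrite -/(point d h) e; apply/(Uact _ _ _ l0 m0).
  by exists U.
have Vz : V z by split=> //; [rewrite across_eq0//; apply/eqP|apply/eqP].
have : nbhs z V by apply: open_nbhs_nbhs; split.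
by apply: filterS => z' [_ _ h]; exact: N0N.
Qed.

Section BasePoint.
Variable x0 : X.

Definition of_chart (p : (cx * cx)%type) : X := insubd x0 (line_point d uv0 p.1 p.2).

Definition chart_map (z : X) : (cx * cx)%type := to_chart (val z).

Lemma complement_of (z : X) : affine_complement A (fiber u) (val z).
Proof. exact: set_mem (valP z). Qed.

Lemma val_of_chart p : O p -> val (of_chart p) = line_point d uv0 p.1 p.2.
Proof. by move=> Op; rewrite val_insubd ifT//; apply/mem_set/line_point_complement. Qed.

Lemma chart_map_complement z : O (chart_map z).
Proof. by apply/line_point_complement; rewrite to_chartK; exact: complement_of. Qed.

Lemma chart_mapK : cancel chart_map of_chart.
Proof.
move=> z; apply/val_inj; rewrite val_of_chart; last exact: chart_map_complement.
by rewrite to_chartK//; exact: complement_of.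
Qed.

Lemma of_chartK p : O p -> chart_map (of_chart p) = p.
Proof. by move=> Op; rewrite /chart_map val_of_chart// line_pointK. Qed.

Lemma continuous_chart_map : continuous chart_map.
Proof.
move=> z; have zA := @complement_of z.
apply: (@continuous_comp _ _ _ (set_val : X -> surface) to_chart).
  exact: initial_continuous.
by apply: continuous_to_chart => h; apply: zA; [right|left; right].
Qed.

Lemma continuous_of_chart p : O p -> {for p, continuous of_chart}.
Proof.
move=> Op N [B [[W oW WB]] Bp BN].
have Wp : W (line_point d uv0 p.1 p.2).
  by rewrite -(val_of_chart Op); move: Bp; rewrite -WB.
have h1 : \forall q \near p, W (line_point d uv0 q.1 q.2).
  by apply: (continuous_line_point (x := p)); apply: open_nbhs_nbhs; split.
have h2 : nbhs p O.
  by apply: open_nbhs_nbhs; split=> //; exact: open_curve_complement.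
apply: filterS2 h1 h2 => q Wq Oq; apply: BN; rewrite -WB.
by rewrite /= -[set_val _]/(val (of_chart q)) val_of_chart.
Qed.
End BasePoint.

End AffineChart.

(** * A nonsingular fibre *)

Section NonsingularFibre.
Variables (R : realType) (d : nat).
Local Notation cx := (R[i]^o).
Variables (f : cox_ring R) (u v : (cx * cx)%type).
Hypotheses (f3 : in_class d 3 (3 * d) f) (f0 : lead 3 f != 0) (uv0 : frame_det u v != 0).
Local Notation disc_of s t := (disc (curve_coef f 2 s t) (curve_coef f 1 s t) (curve_coef f 0 s t)).

Lemma disc_of_three_roots s t x q1 q2 q3 : distinct3 q1 q2 q3 ->
  ev f (line_coords s t x q1) = 0 -> ev f (line_coords s t x q2) = 0 ->
  ev f (line_coords s t x q3) = 0 -> (disc_of s t).[x] != 0.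
Proof.
move=> dq /(cubic_chart_eq0 f3 f0) h1 /(cubic_chart_eq0 f3 f0) h2 /(cubic_chart_eq0 f3 f0) h3.
by rewrite (disc_distinct3 (roots3_of_roots dq h1 h2 h3)).
Qed.

(** The fibre lies at infinity in the chart; exchanging the two frame vectors puts it at
    the origin of another chart, where the discriminant is then nonzero. *)
Lemma disc_nonsingular : (`I_3 #<= @fiber R d u `&` @zero_locus R d f)%card -> disc_of u v != 0.
Proof.
move=> /three_points[z1 [z2 [z3 [[F1 A1] [F2 A2] [F3 A3] [n12 n23 n13]]]]].
have vu0 : frame_det v u != 0.
  by apply: contra uv0 => /eqP h; rewrite -oppr_eq0 -h /frame_det; apply/eqP; ring.
have over z : fiber u z -> zero_locus f z ->
    exists2 y, z = line_point d vu0 0 y & ev f (line_coords v u 0 y) = 0.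
  move=> Fz fz.
  have al : along v u (cox z).1 = 0.
    by move: Fz; rewrite /fiber /along /= => ->; rewrite subrr mul0r.
  have nF : ~ fiber v z.
    move=> /eqP; rewrite -(across_eq0 vu0) => /eqP ac; have [+ _] := cox_domainP z; apply.
    by rewrite (frame_coordinates vu0 (cox z).1) al ac !mul0r !addr0.
  have e := line_point_cox vu0 nF (zero_locus_not_exceptional f3 f0 fz).
  have b0 : base_coord v u (cox z) = 0 by rewrite /base_coord al mul0r.
  exists (fibre_coord d v u (cox z)); first by rewrite {1}e b0.
  by apply/(zero_locus_point (line_coords_domain vu0 0 _) f3); rewrite -b0 -[point _ _]e.
have [y1 e1 f1] := over _ F1 A1; have [y2 e2 f2] := over _ F2 A2; have [y3 e3 f3'] := over _ F3 A3.
have dy : distinct3 y1 y2 y3.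
  by apply/and3P; split; apply/eqP => e; [apply: n12|apply: n23|apply: n13]; rewrite ?e1 ?e2 ?e3 e.
have d0 := disc_of_three_roots dy f1 f2 f3'.
have dne : disc_of v u != 0 by apply: contraNneq d0 => ->; rewrite horner0.
have /closed_nonrootP[x] : disc_of v u * 'X != 0 by rewrite mulf_neq0// polyX_eq0.
rewrite /root hornerM hornerX mulf_eq0 negb_or => /andP[dx x0].
have [q1 [q2 [q3 hq]]] := roots3_exists (curve_coef f 2 v u) (curve_coef f 1 v u) (curve_coef f 0 v u) x.
have dq : distinct3 q1 q2 q3 by rewrite -(disc_distinct3 hq).
(* The point [(x, q)] of one chart is the point [(x^-1, q / x ^+ d)] of the other. *)
have zero q : [\/ q = q1, q = q2 | q = q3] -> ev f (line_coords u v x^-1 (q / x ^+ d)) = 0.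
  move=> /(roots3_eq0 q hq)/(cubic_chart_eq0 f3 f0) h.
  have e : line_coords v u x q = cox_act d x 1 (line_coords u v x^-1 (q / x ^+ d)).
    rewrite /line_coords /cox_act /=; congr (_, _); congr (_, _).
    - by field.
    - by field.
    - by rewrite mulr1.
    - by rewrite mul1r mulrC divfK// expf_neq0.
  by apply/eqP; rewrite -(ev_act_eq0 _ f3 x0 (oner_neq0 _)) -e h.
have dq' : distinct3 (q1 / x ^+ d) (q2 / x ^+ d) (q3 / x ^+ d).
  have inj : injective (fun q => q / x ^+ d) by apply: mulIf; rewrite invr_eq0 expf_neq0.
  by rewrite /distinct3 !(inj_eq inj).
apply: contraTneq (disc_of_three_roots dq' (zero _ _) (zero _ _) (zero _ _)) => [->|||].
- by rewrite horner0 eqxx.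
- by constructor 1.
- by constructor 2.
- by constructor 3.
Qed.

End NonsingularFibre.

(** * Components of a trigonal curve *)

Section ThreeValues.
Variables (T : Type) (t0 t1 t2 : T).

Definition three_values (k : nat) : T := if k is 0%N then t0 else if k is 1%N then t1 else t2.

Lemma three_values_inj : t0 <> t1 -> t1 <> t2 -> t0 <> t2 -> {in `I_3 &, injective three_values}.
Proof.
move=> n01 n12 n02 j k /set_mem + /set_mem; rewrite /=.
by case: j => [|[|[|j]]] //= _; case: k => [|[|[|k]]] //= _ e; exfalso;
  (apply: n01 || apply: n12 || apply: n02); congruence.
Qed.
End ThreeValues.

Section Components.
Variables (R : realType) (d : nat).
Local Notation cx := (R[i]^o).
Local Notation surface := (hirzebruch R d).
Local Notation Z f := (@zero_locus R d f).
Implicit Types (A B D : set surface) (f g h l : cox_ring R) (L : {poly R[i]}).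

Lemma closed_zero_locus a b f : in_class d a b f -> zariski_closed (Z f).
Proof.
move=> fab; exists [set f]; split; first by move=> _ ->; exists a, b.
by rewrite bigcap_set1.
Qed.

Lemma zero_locus_mul f g : Z (f * g) = Z f `|` Z g.
Proof.
apply/seteqP; split=> z; rewrite /zero_locus /= /cox_eval mevalM.
  by move=> /eqP; rewrite mulf_eq0 => /orP[]/eqP; [left|right].
by case=> ->; rewrite ?mulr0 ?mul0r.
Qed.

Lemma in_class_sub a b f g : in_class d a b f -> in_class d a b g -> in_class d a b (f - g).
Proof. by move=> hf hg m /msuppB_le; rewrite mem_cat => /orP[/hf|/hg]. Qed.

Section Covering.
Variables (A D1 D2 : set surface).
Hypotheses (cl1 : zariski_closed D1) (cl2 : zariski_closed D2) (AE : A = D1 `|` D2).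

Lemma component_sub B : zariski_irreducible B -> B `<=` A -> B `<=` D1 \/ B `<=` D2.
Proof. by rewrite AE => -[_ h] BA; exact: h. Qed.

Lemma component_eq B D : irreducible_component A B -> zariski_irreducible D -> D `<=` A ->
  B `<=` D -> B = D.
Proof. by move=> [_ _ m] iD DA BD; rewrite (m D). Qed.

Lemma two_components B : zariski_irreducible D1 -> zariski_irreducible D2 ->
  irreducible_component A B -> B = D1 \/ B = D2.
Proof.
move=> i1 i2 cB; have [BA iB _] := cB.
have [h|h] := component_sub iB BA; [left|right]; apply: component_eq cB _ _ h => //; rewrite AE.
  exact: subsetUl.
exact: subsetUr.
Qed.
End Covering.

Section Curve.
Variables (f : cox_ring R) (u v : (cx * cx)%type).
Hypotheses (f3 : in_class d 3 (3 * d) f) (f0 : lead 3 f != 0) (uv0 : frame_det u v != 0).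
Local Notation a := (curve_coef f 2 u v).
Local Notation b := (curve_coef f 1 u v).
Local Notation c := (curve_coef f 0 u v).
Local Notation line := (line_coords u v).
Hypothesis disc0 : disc a b c != 0.

(** Two sections of one class agreeing on the chart agree off the exceptional section,
    since the fibre at infinity is approached along lines. *)
Lemma ev_eq_of_chart m n h : in_class d m n h -> (forall x y, ev h (line x y) = 0) ->
  forall w, w.2.1 != 0 -> ev h w = 0.
Proof.
move=> hmn h0.
have chart w : across u v w.1 != 0 -> w.2.1 != 0 -> ev h w = 0.
  move=> a0 s0; apply/eqP; rewrite (normalize d uv0 a0 s0) (ev_act_eq0 _ hmn)//.
  by rewrite h0.
case=> [[p1 p2] [s t]] /= s0.
pose q : {poly R[i]} := 'X + (across u v (p1, p2))%:P.
have q0 : q != 0 by rewrite -size_poly_eq0 /q size_XaddC.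
have := @ev_density R h q (p1%:P + v.1 *: 'X) (p2%:P + v.2 *: 'X) s%:P t%:P q0.
move=> /(_ _ 0); rewrite !hornerD !hornerZ !hornerC !hornerX !mulr0 !addr0; apply.
move=> e qe; rewrite !hornerD !hornerZ !hornerC !hornerX; apply: chart => //=.
move: qe; rewrite /q hornerD hornerX hornerC; congr (_ != _).
by rewrite /across /frame_det /=; field; exact: uv0.
Qed.

Lemma zero_locus_sub m n f' g' : in_class d m n f' -> in_class d m n g' ->
    (forall x y, ev f' (line x y) = ev g' (line x y)) ->
  forall z, ~ exceptional_section z -> Z f' z -> Z g' z.
Proof.
move=> hf hg e z /eqP s0 fz; have h : ev (f' - g') (cox z) = 0.
  apply: (ev_eq_of_chart (in_class_sub hf hg)) => // x y.
  by have := e x y; rewrite /ev mevalB => ->; exact: subrr.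
have f'z : ev f' (cox z) = 0 := fz.
by move: h f'z; rewrite /ev mevalB => + f'z; rewrite f'z sub0r => /eqP; rewrite oppr_eq0 => /eqP.
Qed.

Lemma poly_root_chart L : poly_root a b c L -> (monic_chart 3 f u v).[L] = 0.
Proof.
move=> rL; apply: poly_eq0P => x; rewrite -horner_at_value.
by rewrite (monic_chartE f3) -(cubic_chart f3 f0); exact: rL.
Qed.

(** A root gives a section of the ruling; the irreducibility criterion applies to it
    since it has degree one over the base. *)
Lemma root_component L : poly_root a b c L -> exists l, [/\ in_class d 1 (1 * d) l, lead 1 l != 0,
  forall x y, ev l (line x y) = y - L.[x], Z l `<=` Z f & zariski_irreducible (Z l)].
Proof.
move=> /poly_root_chart/(root_section f3 f0 uv0)[l [lc l0 lE lf]]; exists l; split=> //.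
  by move=> z lz; apply: lf => //; exact: cox_domainP.
by apply: (irreducible_zero_locus lc l0).
Qed.

(** A section of the ruling is the graph of a polynomial in the chart. *)
Lemma section_root l : in_class d 1 (1 * d) l -> lead 1 l != 0 ->
  exists L, forall x, ev l (line x L.[x]) = 0.
Proof.
move=> lc l0; have [mP sP] := monic_chart_monic lc l0 u v.
have top : (monic_chart 1 l u v)`_1 = 1 by have := monicP mP; rewrite lead_coefE sP.
exists (- (monic_chart 1 l u v)`_0) => x.
have /eqP := monic_chartE lc u v x (- (monic_chart 1 l u v)`_0).[x].
rewrite horner_at_value (horner_coef (monic_chart 1 l u v)) sP !big_ord_recr big_ord0 /= top.
rewrite expr0 mulr1 expr1 mul1r add0r subrr horner0 eq_sym mulf_eq0 invr_eq0 (negbTE l0).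
by move/eqP.
Qed.

Lemma no_root_irreducible : (forall L, ~ poly_root a b c L) -> zariski_irreducible (Z f).
Proof.
move=> noroot; apply: (irreducible_zero_locus f3 f0) => // _ l lc l0 lf.
have [L lL] := section_root lc l0; apply: (noroot L) => x.
apply/(cubic_chart_eq0 f3 f0); apply: lf (lL x).
exact: set_mem (line_coords_domain uv0 x _).
Qed.

Lemma size_curve_coef k : (k < 3)%N -> (size (curve_coef f k u v) <= ((3 - k) * d).+1)%N.
Proof. exact: (size_monic_chart_coef f3). Qed.

(** The coefficients of the quotient of the cubic by [y - L] have the degrees that let it
    extend to a section of the class [2 E + 2 d F]. *)
Lemma residual_curve L : poly_root a b c L -> exists q, [/\ in_class d 2 (2 * d) q, lead 2 q != 0 &
  forall x y, ev q (line x y) = y ^+ 2 + (cofactor1 a L).[x] * y + (cofactor0 a b L).[x]].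
Proof.
move=> rL; have [mP sP] := monic_chart_monic f3 f0 u v.
have sL := root_size sP mP (@size_monic_chart_coef _ _ _ _ f3 u v) (poly_root_chart rL).
have s2 := @size_curve_coef 2 isT; have s1 := @size_curve_coef 1 isT.
have c1 : (size (cofactor1 a L) <= (1 * d).+1)%N.
  by apply: leq_trans (size_polyD _ _) _; rewrite geq_max s2 mul1n.
have c0 : (size (cofactor0 a b L) <= (2 * d).+1)%N.
  apply: leq_trans (size_polyD _ _) _; rewrite geq_max s1 /=.
  apply: leq_trans (size_polyMleq _ _) _; move: c1 sL; move: (size L) (size (cofactor1 a L)).
  by move=> p q; lia.
pose Q k := if k is 0%N then cofactor0 a b L else cofactor1 a L.
exists (monic_section d u v 2 Q); split.
- exact: in_class_monic_section.
- by rewrite lead_monic_section//; exact: oner_neq0.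
- move=> x y; rewrite ev_monic_section !big_ord_recr big_ord0 /=.
  by rewrite !(ev_homogenize_line uv0)//; ring.
Qed.

Lemma curve_split L l q : poly_root a b c L -> in_class d 1 (1 * d) l -> in_class d 2 (2 * d) q ->
    (forall x y, ev l (line x y) = y - L.[x]) ->
    (forall x y, ev q (line x y) = y ^+ 2 + (cofactor1 a L).[x] * y + (cofactor0 a b L).[x]) ->
    lead 2 q != 0 -> lead 1 l != 0 ->
  Z f = Z l `|` Z q.
Proof.
move=> rL lc qc lE qE q0 l0; rewrite -zero_locus_mul.
have lqc : in_class d 3 (3 * d) (lead 3 f *: (l * q)).
  apply: in_class_scale; have := in_class_mul lc qc.
  by rewrite (_ : 1 * d + 2 * d = 3 * d)%N//; lia.
have e x y : ev f (line x y) = ev (lead 3 f *: (l * q)) (line x y).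
  rewrite /ev mevalZ mevalM -!/(ev _ _) lE qE -(cubic_factor rL) (cubic_chart f3 f0).
  by rewrite mulrA divff// mul1r.
have scale z : Z (lead 3 f *: (l * q)) z <-> Z (l * q) z.
  rewrite /zero_locus /= /cox_eval mevalZ; split=> [/eqP|->]; last by rewrite mulr0.
  by rewrite mulf_eq0 (negbTE f0) => /eqP.
apply/seteqP; split=> z hz.
  by apply/scale; exact: (zero_locus_sub f3 lqc e (zero_locus_not_exceptional f3 f0 hz) hz).
apply: (zero_locus_sub lqc f3 (fun x y => esym (e x y))); last exact/scale.
move: hz; rewrite zero_locus_mul => -[hz|hz].
  exact: (zero_locus_not_exceptional lc l0 hz).
exact: (zero_locus_not_exceptional qc q0 hz).
Qed.

(** A root splits the curve into a section and a residual curve; a good fibre contains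
    points of the curve off each of them. *)
Lemma reducible_poly_root : reducible (Z f) <-> exists L, poly_root a b c L.
Proof.
split=> [[_ nirr]|[L rL]].
  by apply: contrapT => /forallNP h; apply: nirr; exact: no_root_irreducible.
split; first exact: (zero_locus_nonempty f3 f0).
move=> [_ irr].
have [l [lc l0 lE _ _]] := root_component rL; have [q [qc q0 qE]] := residual_curve rL.
have fE := curve_split rL lc qc lE qE q0 l0.
have [x [p2 [p3 [h3 /and3P[n12 n23 n13] QE]]]] := poly_root_fibre disc0 rL.
have on p : cubic a b c x p = 0 -> Z f (point d (line_coords_domain uv0 x p)).
  by move=> h; apply/(zero_locus_point _ f3)/(cubic_chart_eq0 f3 f0).
have [] := irr _ _ (closed_zero_locus lc) (closed_zero_locus qc); first by rewrite fE.
- have h : cubic a b c x p2 = 0 by rewrite h3 subrr mulr0 mul0r.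
  move=> /(_ _ (on _ h)) /(zero_locus_point _ lc) /eqP; rewrite lE subr_eq0 eq_sym.
  by rewrite (negbTE n12).
- have h : cubic a b c x L.[x] = 0 by exact: rL.
  move=> /(_ _ (on _ h)) /(zero_locus_point _ qc) /eqP; rewrite qE QE mulf_eq0 !subr_eq0.
  by rewrite (negbTE n12) (negbTE n13).
Qed.

(** The sum of the roots determines the third one; they are distinct because the
    discriminant is not zero. *)
Lemma residual_root L L2 : poly_root a b c L ->
    (forall x, L2.[x] ^+ 2 + (cofactor1 a L).[x] * L2.[x] + (cofactor0 a b L).[x] = 0) ->
  exists L1 L2 L3, [/\ poly_root a b c L1, poly_root a b c L2, poly_root a b c L3 &
    [/\ L1 <> L2, L2 <> L3 & L1 <> L3]].
Proof.
move=> rL h2; pose L3 := - (cofactor1 a L) - L2.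
have h x : roots3 a b c x L.[x] L2.[x] L3.[x].
  move=> y; rewrite (cubic_factor rL) -mulrA; congr (_ * _).
  have -> : L3.[x] = - (cofactor1 a L).[x] - L2.[x].
    by rewrite /L3 (hornerD (- cofactor1 a L) (- L2)) !hornerN.
  rewrite -[LHS]subr0 -[in LHS](h2 x); ring.
exists L, L2, L3; split=> [//|x|x|].
- by rewrite h subrr mulr0 mul0r.
- by rewrite h subrr mulr0.
- have [x gx] := good_exists disc0.
  have /and3P[/eqP n12 /eqP n23 /eqP n13] : distinct3 L.[x] L2.[x] L3.[x].
    by rewrite -(disc_distinct3 (h x)).
  by split=> e; [apply: n12|apply: n23|apply: n13]; rewrite e.
Qed.

Lemma three_components L1 L2 L3 :
    poly_root a b c L1 -> poly_root a b c L2 -> poly_root a b c L3 ->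
    L1 <> L2 -> L2 <> L3 -> L1 <> L3 ->
  has_components 3 (Z f).
Proof.
move=> r1 r2 r3 n12 n23 n13; have fE := cubic_splits r1 r2 r3 n12 n23 n13.
have [l1 [c1 e1 E1 s1 i1]] := root_component r1.
have [l2 [c2 e2 E2 s2 i2]] := root_component r2.
have [l3 [c3 e3 E3 s3 i3]] := root_component r3.
have c23 : in_class d 2 (2 * d) (l2 * l3).
  by have := in_class_mul c2 c3; rewrite (_ : 1 * d + 1 * d = 2 * d)%N//; lia.
have c123 : in_class d 3 (3 * d) (lead 3 f *: (l1 * (l2 * l3))).
  apply: in_class_scale; have := in_class_mul c1 c23.
  by rewrite (_ : 1 * d + 2 * d = 3 * d)%N//; lia.
have eE x y : ev f (line x y) = ev (lead 3 f *: (l1 * (l2 * l3))) (line x y).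
  rewrite /ev mevalZ !mevalM -!/(ev _ _) E1 E2 E3.
  have := cubic_chart f3 f0 u v x y; rewrite fE => /(congr1 (fun k => lead 3 f * k)).
  by rewrite (mulVKf f0) => <-; rewrite !mulrA.
have cover : Z f = Z l1 `|` Z (l2 * l3).
  rewrite -zero_locus_mul; apply/seteqP; split=> z.
    move=> fz; have := zero_locus_sub f3 c123 eE (zero_locus_not_exceptional f3 f0 fz) fz.
    rewrite /zero_locus /= /cox_eval mevalZ => /eqP; rewrite mulf_eq0 (negbTE f0).
    by move/eqP.
  by rewrite !zero_locus_mul => -[/s1|[/s2|/s3]].
have cases B : zariski_irreducible B -> B `<=` Z f -> [\/ B `<=` Z l1, B `<=` Z l2 | B `<=` Z l3].
  move=> iB BA; have [h|h] := component_sub (closed_zero_locus c1) (closed_zero_locus c23) cover iB BA.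
    by constructor 1.
  have [h'|h'] := component_sub (closed_zero_locus c2) (closed_zero_locus c3) (zero_locus_mul l2 l3) iB h.
    by constructor 2.
  by constructor 3.
have nsub l l' L L' : in_class d 1 (1 * d) l -> in_class d 1 (1 * d) l' ->
    (forall x y, ev l (line x y) = y - L.[x]) -> (forall x y, ev l' (line x y) = y - L'.[x]) ->
    L <> L' -> ~ (Z l `<=` Z l').
  move=> lc lc' lE lE' n sub; apply: n; apply/eqP; rewrite -subr_eq0; apply/eqP.
  apply: poly_eq0P => x; rewrite hornerD hornerN -lE'.
  apply/(zero_locus_point (line_coords_domain uv0 x L.[x]) lc'); apply: sub.
  by apply/(zero_locus_point _ lc); rewrite lE subrr.
have comp (D D' D'' : set surface) : zariski_irreducible D -> D `<=` Z f -> ~ (D `<=` D') -> ~ (D `<=` D'') ->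
    (forall B, zariski_irreducible B -> B `<=` Z f -> [\/ B `<=` D, B `<=` D' | B `<=` D'']) ->
    irreducible_component (Z f) D.
  move=> iD DA n1 n2 cs; split=> // B DB BA iB.
  case: (cs B iB BA) => h; first exact/seteqP.
    by case: n1; exact: subset_trans h.
  by case: n2; exact: subset_trans h.
have C1 : irreducible_component (Z f) (Z l1).
  apply: (comp _ (Z l2) (Z l3)) => //; [exact: (nsub _ _ L1 L2)|exact: (nsub _ _ L1 L3)].
have C2 : irreducible_component (Z f) (Z l2).
  apply: (comp _ (Z l1) (Z l3)) => //.
  - by apply: (nsub _ _ L2 L1) => // /esym.
  - exact: (nsub _ _ L2 L3).
  - by move=> B iB /(cases B iB)[]; [constructor 2|constructor 1|constructor 3].
have C3 : irreducible_component (Z f) (Z l3).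
  apply: (comp _ (Z l1) (Z l2)) => //.
  - by apply: (nsub _ _ L3 L1) => // /esym.
  - by apply: (nsub _ _ L3 L2) => // /esym.
  - by move=> B iB /(cases B iB)[]; [constructor 2|constructor 3|constructor 1].
pose D := three_values (Z l1) (Z l2) (Z l3).
rewrite /has_components.
have -> : [set B | irreducible_component (Z f) B] = D @` `I_3.
  apply/seteqP; split=> B; last by move=> [[|[|[|k]]] //= _ <-].
  move=> cB; have [BA iB m] := cB.
  have [h|h|h] := cases B iB BA.
  - by exists 0%N => //=; apply: m => //; case: C1.
  - by exists 1%N => //=; apply: m => //; case: C2.
  - by exists 2%N => //=; apply: m => //; case: C3.
have d12 : Z l1 <> Z l2 by move=> e; apply: (nsub _ _ L1 L2 c1 c2 E1 E2 n12); rewrite e.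
have d23 : Z l2 <> Z l3 by move=> e; apply: (nsub _ _ L2 L3 c2 c3 E2 E3 n23); rewrite e.
have d13 : Z l1 <> Z l3 by move=> e; apply: (nsub _ _ L1 L3 c1 c3 E1 E3 n13); rewrite e.
exact: inj_card_eq (three_values_inj d12 d23 d13).
Qed.

(** If exactly one root of the cubic is a polynomial, the residual curve is irreducible
    and the curve has at most two components. *)
Lemma components_poly_roots : has_components 3 (Z f) <->
  exists L1 L2 L3, [/\ poly_root a b c L1, poly_root a b c L2, poly_root a b c L3 &
    [/\ L1 <> L2, L2 <> L3 & L1 <> L3]].
Proof.
split=> [|[L1 [L2 [L3 [r1 r2 r3 [n12 n23 n13]]]]]]; last exact: three_components r1 r2 r3 _ _ _.
rewrite /has_components => /card_eqPle[_ /three_points].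
move=> [B1 [B2 [B3 [C1 C2 C3 [m12 m23 m13]]]]].
have two (D1 D2 : set surface) :
    (forall B, irreducible_component (Z f) B -> B = D1 \/ B = D2) -> False.
  by move=> h; case: (h _ C1); case: (h _ C2); case: (h _ C3) => e3 e2 e1;
    [apply: m12|apply: m12|apply: m13|apply: m23|apply: m23|apply: m13|apply: m12|apply: m12];
    congruence.
have [[L rL]|/forallNP none] := pselect (exists L, poly_root a b c L); last first.
  case: (two (Z f) (Z f)) => B cB; left; apply: (component_eq cB) => //.
    exact: no_root_irreducible.
  by case: cB.
have [[L2 h2]|/forallNP none] := pselect (exists L2 : {poly R[i]}, forall x,
    L2.[x] ^+ 2 + (cofactor1 a L).[x] * L2.[x] + (cofactor0 a b L).[x] = 0).
  exact: residual_root rL h2.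
have [l [lc l0 lE _ il]] := root_component rL; have [q [qc q0 qE]] := residual_curve rL.
have iq : zariski_irreducible (Z q).
  apply: (irreducible_zero_locus qc q0) => // _ g gc g0 gq.
  have [L' gL'] := section_root gc g0; apply: (none L') => x.
  rewrite -qE; apply: gq (gL' x); exact: set_mem (line_coords_domain uv0 x _).
case: (two (Z l) (Z q)) => B cB.
exact: (two_components (closed_zero_locus lc) (closed_zero_locus qc)
  (curve_split rL lc qc lE qE q0 l0) il iq cB).
Qed.

End Curve.
End Components.

Theorem theorem1p2p3 (R : realType) (d : nat) (C F : set (hirzebruch R d))
    (trigC : trigonal_curve C) (nsF : nonsingular_fiber C F)
    (x0 : set_type (affine_complement C F)) :
  (reducible C <-> has_quotient (pi1_afn x0) (dihedral 'Z_2)) /\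
  (has_components 3 C <->
     has_quotient (pi1_afn x0) (dihedral ('Z_2 * 'Z_2)%type)).
Proof.
case: trigC => CE [f [f3 _ fE]]; case: nsF => -[u u0 FE] F3; subst C F.
have f0 : lead 3 f != 0.
  apply/eqP => f0; have dom : ((1, 0), (0, 1)) \in @cox_domain R.
    by apply/mem_set; split=> /= -[] /eqP; rewrite ?oner_eq0.
  have [l [m [l0 m0 e]]] := cox_point d dom.
  have sE : exceptional_section (point d dom) by rewrite /exceptional_section /= e /= mulr0.
  suff : (zero_locus f `&` @exceptional_section R d) (point d dom) by rewrite CE.
  split=> //; apply/(zero_locus_point dom f3).
  by rewrite (ev_exceptional f3)// f0 mul0r.
have [v uv0] : exists v, frame_det u v != 0.
  have [u1|u1] := eqVneq u.1 0; last first.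
    by exists (0, 1); rewrite /frame_det /= mulr1 mulr0 subr0.
  exists (1, 0); rewrite /frame_det /= mulr1 mulr0 sub0r oppr_eq0.
  by apply/eqP => u2; apply: u0; move: u1 u2; case: (u) => s t /= -> ->.
have disc0 := disc_nonsingular f3 f0 uv0 F3.
rewrite (reducible_poly_root f3 f0 uv0 disc0) (components_poly_roots f3 f0 uv0 disc0).
split; apply: iff_sym.
- exact: (dihedral2_quotient x0 (@continuous_chart_map R d f u v uv0)
    (@chart_map_complement R d f u v f3 f0 uv0) (@chart_mapK R d f u v f3 f0 uv0 x0)
    (@of_chartK R d f u v f3 f0 uv0 x0) (@continuous_of_chart R d f u v f3 f0 uv0 x0) disc0).
- exact: (dihedral3_quotient x0 (@continuous_chart_map R d f u v uv0)
    (@chart_map_complement R d f u v f3 f0 uv0) (@chart_mapK R d f u v f3 f0 uv0 x0)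
    (@of_chartK R d f u v f3 f0 uv0 x0) (@continuous_of_chart R d f u v f3 f0 uv0 x0) disc0).
Qed.
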